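(* Let $x\ge0$ and suppose that the initial number of customers is $Q_0=x/(1-\rho)$ (rounded down to an integer), so that $(1-\rho)Q_0=x$ up to rounding. Then for any $t>0$, as $\rho\uparrow1$, $(1-\rho)\,Q_{\lfloor t/(1-\rho)^2\rfloor}$ converges in distribution to $Q^{[x]}(t)$, where $Q^{[x]}(\cdot)$ is the reflection at $0$, with initial condition $Q^{[x]}(0)=x$, of the Brownian motion $$B(t)=-t+\sqrt{\nu''(1)}\;W(t),\qquad \nu''(1)=\mathbb{E}[\Lambda^2]\,\mathbb{E}[S^2],$$ with $W(\cdot)$ a standard Brownian motion and $\mathbb{E}[\Lambda^2]$ evaluated in the limit $\rho\uparrow1$.
   Context: Consider an M/G/1 queue in which the arrival rate is resampled at every service completion. Service times are i.i.d. copies of a non-negative random variable $S$ with Laplace–Stieltjes transform $\sigma(\theta)=\mathbb{E}e^{-\theta S}$; the arrival rates are i.i.d. copies of a non-negative random variable $\Lambda$, independent of the service times; $\mathbb{E}[\Lambda^2]<\infty$ and $\mathbb{E}[S^2]<\infty$. Let $N_n$ be the number of customers arriving during the $n$-th service time (conditionally on its arrival rate and service time, Poisson with mean equal to their product); the $N_n$ are i.i.d. with probability generating function $\nu(z)=\mathbb{E}\,\sigma(\Lambda(1-z))$. Let $Q_n$ be the number of customers present at the $n$-th service completion, with $Q_{n+1}=(Q_n-1)^++N_{n+1}$, where $N_{n+1}$ is independent of $Q_n$. The load is $\rho:=\mathbb{E}\Lambda\,\mathbb{E}S$. Heavy-traffic regime: the law of $S$ is kept fixed and the arrival rate is scaled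 uniformly, i.e. $\Lambda=\rho\,\Lambda_1$ for a fixed non-negative random variable $\Lambda_1$ with $\mathbb{E}\Lambda_1\,\mathbb{E}S=1$, and $\rho\uparrow1$; thus in the limit $\mathbb{E}[\Lambda^2]=\mathbb{E}[\Lambda_1^2]$. The reflection at $0$ of $B$ started from $x$ is $Q^{[x]}(t)=x+B(t)+\max\{0,\sup_{0\le s\le t}(-x-B(s))\}$. *)

(* Defs.v *)
From HB Require Import structures.
From mathcomp Require Import all_boot all_order all_algebra.
From mathcomp Require Import all_classical all_reals all_analysis.

Set Implicit Arguments.
Unset Strict Implicit.
Unset Printing Implicit Defensive.

Import Order.TTheory GRing.Theory Num.Theory.
Import numFieldNormedType.Exports.

Local Open Scope classical_set_scope.
Local Open Scope ring_scope.

Definition mutually_independent (R : realType) (d : measure_display)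
    (T : measurableType d) (P : probability T R) (d' : measure_display)
    (T' : measurableType d') (I : eqType) (X : I -> T -> T') : Prop :=
  forall (s : seq I) (A : I -> set T'), uniq s -> (forall i, measurable (A i)) ->
    P (\bigcap_(i in [set` s]) X i @^-1` A i) =
    (\prod_(i <- s) P (X i @^-1` A i))%E.

Definition same_law (R : realType) (d1 d2 d' : measure_display)
    (T1 : measurableType d1) (P1 : probability T1 R)
    (T2 : measurableType d2) (P2 : probability T2 R)
    (T' : measurableType d') (X : T1 -> T') (Y : T2 -> T') : Prop :=
  forall A : set T', measurable A -> P1 (X @^-1` A) = P2 (Y @^-1` A).

(* Weak convergence along the filter F; each X i may live on its own
   probability space.  Measurability is part of the definition because the
   integral of a non-measurable function is meaningless. *)
Definition cvg_in_distribution (R : realType) (I : Type) (F : set_system I)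
    (d : I -> measure_display) (T : forall i, measurableType (d i))
    (P : forall i, probability (T i) R) (X : forall i, T i -> R)
    (d' : measure_display) (T' : measurableType d') (P' : probability T' R)
    (Y : T' -> R) : Prop :=
  [/\ forall i, measurable_fun [set: T i] (X i),
      measurable_fun [set: T'] Y &
      forall f : R -> R, continuous f -> bounded_fun f ->
        ('E_(P i)[f \o X i] @[i --> F] --> 'E_P'[f \o Y])%E].

(* Only times t >= 0 are constrained. The increments have variance t - s, and
   the second parameter of normal_prob is the standard deviation. *)
Record standard_brownian_motion (R : realType) (d : measure_display)
    (T : measurableType d) (P : probability T R) (W : R -> {RV P >-> R}) :
    Prop := StandardBrownianMotion {
  sbm_start : forall w, W 0 w = 0;
  sbm_indep : forall t : nat -> R, 0 <= t 0%N ->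
    {homo t : m n / (m <= n)%N >-> m <= n} ->
    mutually_independent P (fun (n : nat) (w : T) => W (t n.+1) w - W (t n) w);
  sbm_normal : forall s t : R, 0 <= s -> s < t ->
    forall A : set R, measurable A ->
    P ((fun w => W t w - W s w) @^-1` A) = normal_prob 0 (Num.sqrt (t - s)) A;
  sbm_continuous : forall w : T,
    {within `[0, +oo[, continuous (fun t : R => W t w : R)} }.

Definition reflection (R : realType) (x : R) (b : R -> R) (t : R) : R :=
  x + b t + Num.max 0 (sup [set - x - b s | s in `[0, t]]).

Definition laplace_stieltjes (R : realType) (d : measure_display)
    (T : measurableType d) (P : probability T R) (S : T -> R) (theta : R) : R :=
  fine ('E_P[fun w => expR (- (theta * S w))])%E.

Definition arrivals_pgf (R : realType) (d : measure_display)
    (T : measurableType d) (P : probability T R) (Lam S : T -> R) (z : R) : R :=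
  fine ('E_P[fun w => laplace_stieltjes P S (Lam w * (1 - z))])%E.

(* Lam and S, on (T0, P0), only prescribe the common laws of the arrival rates
   L n and of the service times V n.  In poisson_prob, which is the Dirac mass
   at 0 for rate 0, the second argument is a dummy. *)
Record resampled_MG1 (R : realType) (d0 : measure_display)
    (T0 : measurableType d0) (P0 : probability T0 R) (Lam S : T0 -> R)
    (d : measure_display) (T : measurableType d) (P : probability T R)
    (L V : nat -> {RV P >-> R}) (N : nat -> {RV P >-> nat}) : Prop :=
  ResampledMG1 {
  mg1_rate_law : forall n, same_law P P0 (L n) Lam;
  mg1_service_law : forall n, same_law P P0 (V n) S;
  mg1_rate_service_indep : mutually_independent P
    (fun i : nat + nat => match i with inl n => L n : T -> R | inr n => V n end);
  (* Given (L n, V n), the variable N n is Poisson with mean L n * V n. *)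
  mg1_arrivals_poisson : forall (n : nat) (C : set (R * R)) (K : set nat),
    measurable C ->
    P [set w | C (L n w, V n w) /\ K (N n w)] =
    (\int[P]_(w in [set w | C (L n w, V n w)])
        poisson_prob (L n w * V n w)%R 0 K)%E;
  mg1_arrivals_indep :
    mutually_independent P (fun (n : nat) (w : T) => N n w) }.

(* N n is the number of arrivals during the n-th service; N 0 is not used. *)
Fixpoint queue_length (Omega : Type) (q0 : nat) (N : nat -> Omega -> nat)
    (n : nat) (w : Omega) : nat :=
  if n is m.+1 then (queue_length q0 N m w - 1 + N m.+1 w)%N else q0.

(* Main.v *)
(** The scaled queue is compared with the random walk reflected at 0 whose
    increments are those of the given Brownian motion with drift at the times
    k (1 - rho)^2; by uniform continuity of its paths that walk converges
    pathwise to the reflection.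

    - Truncation.  Arrivals larger than K are discarded and the increments
      recentred.  As max(., 0) is a contraction and the discarded part is
      centred, the mean squared distance of the two chains grows at most by its
      variance per step.  The second moments of the mixed Poisson arrivals
      converge, so that K can be taken uniform in rho.
    - Softening.  Replacing max(y, 0) by ln (1 + exp (b y)) / b costs ln (n + 1) / b
      after n steps, and makes the state a function ln (a + c exp (b u)) / b of each
      single increment u, with slope in [0, 1] and third derivative O(b^2).
    - Lindeberg's exchange.  Replacing the truncated increments of size
      h = 1 - rho by Gaussian ones with the same mean and variance costs
      n h^3 b^2 = O(h b^2), since n is about t / h^2.  With b = h^(-1/4) both
      errors vanish.

    It suffices to test convergence on bounded C^3 functions.  For nu'', the pgf is
    the expectation of exp (- rho Lam1 S (1 - z)) on the product space, and is
    differentiated twice under the integral. *)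
Require Import Defs.
From HB Require Import structures.
From mathcomp Require Import all_boot all_order all_algebra.
From mathcomp Require Import all_classical all_reals all_analysis.
From mathcomp Require Import measurable_realfun ring lra.

Set Implicit Arguments.
Unset Strict Implicit.
Unset Printing Implicit Defensive.

Import Order.TTheory GRing.Theory Num.Theory.
Import numFieldNormedType.Exports.

Local Open Scope classical_set_scope.
Local Open Scope ring_scope.

(** * Bounded functions and Markov chains driven by independent variables *)

(** Only second moments are assumed, so the arrivals may have an infinite third moment; truncation
    must therefore precede any third-order expansion. The exchange then needs the value after all
    remaining steps as a smooth function of one increment. With max(., 0) it is not differentiable,
    and bounding the derivatives of an n-fold composition of smoothed maxima by the chain rule could
    cost a factor growing with n. The soft maximum escapes this: in the variable exp (b X) a step is
    affine, compositions stay in a two-parameter family, and the derivative bounds are uniform in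
    both parameters, hence in n.

    The Gaussian walk matched to the truncated arrivals carries their variance, not its limit; it is
    moved to the limiting variance by the same mean square coupling, now between two walks driven by
    one Brownian path. The means agree exactly: h (rho - 1) = - h^2 is the drift over a time h^2.

    The constants are fixed in the order del (threshold in the coupling), tau (tail of the second
    moment), K (truncation level); only then does rho tend to 1, since the exchange error depends on
    K and the coupling error contains tau / del. *)

(* bounded measurable functions *)
Definition bmf d (T : measurableType d) (R : realType) (f : T -> R) :=
  measurable_fun [set: T] f /\ exists M, forall x, `|f x| <= M.

Section bounded_integrals.
Context d (T : measurableType d) (R : realType) (P : probability T R).

Lemma bmf_integrable (f : T -> R) : bmf f -> P.-integrable [set: T] (EFin \o f).
Proof.
case=> mf [M fM]; apply: (@le_integrable _ _ _ P _ measurableT _ (EFin \o cst M)).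
- exact/measurable_EFinP.
- move=> x _ /=; rewrite lee_fin (le_trans (fM x))// ler_norm//.
- exact: finite_measure_integrable_cst.
Qed.

Lemma prob_Rintegral_cst (c : R) : \int[P]_x c = c.
Proof. by rewrite Rintegral_cst//= probability_setT mulr1. Qed.

Lemma le_norm_prob_Rintegral (f : T -> R) (M : R) : measurable_fun [set: T] f ->
  (forall x, `|f x| <= M) -> `|\int[P]_x f x| <= M.
Proof.
move=> mf fM.
have bf : bmf f by split => //; exists M.
apply: (le_trans (le_normr_Rintegral _ (bmf_integrable bf))) => //.
rewrite -(prob_Rintegral_cst M); apply: le_Rintegral => //.
- apply: bmf_integrable; split; first exact: measurableT_comp.
  by exists M => x; rewrite normr_id.
- by apply: bmf_integrable; split => //; exists `|M|.
Qed.

End bounded_integrals.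

Section bounded_fubini.
Context d1 d2 (T1 : measurableType d1) (T2 : measurableType d2) (R : realType).
Context (P1 : probability T1 R) (P2 : probability T2 R).
Variable f : T1 * T2 -> R.
Hypothesis bf : bmf f.

Lemma bmf_section1 x : bmf (fun y => f (x, y)).
Proof.
case: bf => mf [M fM]; split; last by exists M => y.
exact: measurableT_comp (pair1_measurable x).
Qed.

Lemma bmf_section2 y : bmf (fun x => f (x, y)).
Proof.
case: bf => mf [M fM]; split; last by exists M => x.
exact: measurableT_comp (pair2_measurable y).
Qed.

Let fint : (P1 \x P2)%E.-integrable [set: T1 * T2] (EFin \o f).
Proof. exact: bmf_integrable. Qed.

Lemma bmf_Rintegral1 : bmf (fun x => \int[P2]_y f (x, y)).
Proof.
have [mf [M fM]] := bf; split; last first.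
  by exists M => x; apply: le_norm_prob_Rintegral => //; case: (bmf_section1 x).
have /measurable_fubini_F := fint.
rewrite /fubini_F => h; apply: measurableT_comp h; exact: fine_measurable.
Qed.

Lemma bmf_Rintegral2 : bmf (fun y => \int[P1]_x f (x, y)).
Proof.
have [mf [M fM]] := bf; split; last first.
  by exists M => x; apply: le_norm_prob_Rintegral => //; case: (bmf_section2 x).
have /measurable_fubini_G := fint.
rewrite /fubini_G => h; apply: measurableT_comp h; exact: fine_measurable.
Qed.

Lemma EFin_Rintegral d (T : measurableType d) (P : probability T R) (g : T -> R) :
  bmf g -> (\int[P]_x g x)%:E = (\int[P]_x (g x)%:E)%E.
Proof.
by move=> bg; rewrite /Rintegral fineK// integrable_fin_num//; exact: bmf_integrable.
Qed.

Lemma bounded_Fubini :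
  \int[P1]_x \int[P2]_y f (x, y) = \int[P2]_y \int[P1]_x f (x, y).
Proof.
apply: EFin_inj; rewrite (EFin_Rintegral P1 bmf_Rintegral1) (EFin_Rintegral P2 bmf_Rintegral2).
under eq_integral do rewrite (EFin_Rintegral P2 (bmf_section1 _)).
under [RHS]eq_integral do rewrite (EFin_Rintegral P1 (bmf_section2 _)).
exact: (Fubini fint).
Qed.

Lemma bounded_Fubini1 :
  \int[(P1 \x P2)%E]_z f z = \int[P1]_x \int[P2]_y f (x, y).
Proof.
apply: EFin_inj; rewrite (EFin_Rintegral P1 bmf_Rintegral1) (EFin_Rintegral _ bf).
under [RHS]eq_integral do rewrite (EFin_Rintegral P2 (bmf_section1 _)).
by rewrite -(integral12_prod_meas1 fint).
Qed.

End bounded_fubini.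

(** Rectangles form a generating pi-system that contains the whole space, so finiteness of one total
    mass suffices. The measures are not assumed to be probabilities: below they are a law restricted
    to an event and a law rescaled by the mass of that event. *)
Lemma rectangles_unique d1 d2 (T1 : measurableType d1) (T2 : measurableType d2)
    (R : realType) (m1 m2 : {measure set (T1 * T2) -> \bar R}) :
  (m1 [set: T1 * T2] < +oo)%E ->
  (forall A B, measurable A -> measurable B -> m1 (A `*` B) = m2 (A `*` B)) ->
  forall C, measurable C -> m1 C = m2 C.
Proof.
move=> m1oo m12 C mC.
pose G : set (set (T1 * T2)) :=
  [set C | exists A, measurable A /\ exists B, measurable B /\ C = A `*` B].
apply: (measure_unique G (fun=> setT)) => //.
- rewrite measurable_prod_measurableType //; congr (<<s _ >>).
  rewrite predeqE; split => [[A mA [B mB <-]]|[A [mA [B [mB ->]]]]].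
    by exists A; split => //; exists B.
  by exists A => //; exists B.
- move=> /= _ _ [X1 [mX1 [X2 [mX2 ->]]]] [Y1 [mY1 [Y2 [mY2 ->]]]].
  rewrite -setXI; exists (X1 `&` Y1); split; first exact: measurableI.
  by exists (X2 `&` Y2); split => //; exact: measurableI.
- by move=> n; exists setT; split => //; exists setT; split => //; rewrite setXTT.
- by rewrite bigcup_const.
- by move=> A [A1 [mA1 [A2 [mA2 ->]]]]; rewrite m12.
Qed.

(** [Z m] drives the step from time [m] to [m.+1]. The state space is arbitrary so that two coupled
    walks can be run as one chain on pairs. *)
Fixpoint chain (Omega S U : Type) (step : S * U -> S) (Z : nat -> Omega -> U)
    (x0 : S) (n : nat) (w : Omega) : S :=
  if n is m.+1 then step (chain step Z x0 m w, Z m w) else x0.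

Section chain.
Context d (T : measurableType d) (R : realType) (P : probability T R).
Context d' (U : measurableType d') (Z : nat -> T -> U) (mu : probability U R).
Hypothesis mZ : forall k, measurable_fun [set: T] (Z k).
Hypothesis Z_law : forall k A, measurable A -> P (Z k @^-1` A) = mu A.
Hypothesis Z_indep : mutually_independent P Z.
Context dS (S : measurableType dS) (step : S * U -> S).
Hypothesis mstep : measurable_fun [set: S * U] step.
Variable x0 : S.

Local Notation X := (chain step Z x0).

Lemma measurable_chain n : measurable_fun [set: T] (X n).
Proof.
elim: n => [|n ih] /=; first exact: measurable_cst.
apply: measurableT_comp => //; exact/measurable_fun_pair.
Qed.

Let later (s : seq nat) (B : nat -> set U) := \bigcap_(i in [set` s]) Z i @^-1` B i.

Let mlater s B : (forall i, measurable (B i)) -> measurable (later s B).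
Proof.
move=> mB; apply: fin_bigcap_measurable => // i _.
by rewrite -[X in measurable X]setTI; exact: mZ.
Qed.

Let mX n A : measurable A -> measurable (X n @^-1` A).
Proof.
by move=> mA; rewrite -[X in measurable X]setTI; exact: measurable_chain.
Qed.

(* X n is independent of the later increments.  Carrying the events on
   [later s B] through the induction avoids generated sigma-algebras: each step
   only needs the uniqueness of a product law on rectangles. *)
Lemma chain_later_indep n (A : set S) (s : seq nat) (B : nat -> set U) :
  measurable A -> uniq s -> (forall i, i \in s -> (n <= i)%N) ->
  (forall i, measurable (B i)) ->
  P (X n @^-1` A `&` later s B) = (P (X n @^-1` A) * P (later s B))%E.
Proof.
elim: n A s B => [|n ih] A s B mA us sn mB.
  have [xA|xA] := pselect (A x0).
    rewrite (_ : X 0 @^-1` A = setT); last by apply/seteqP; split.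
    by rewrite setTI probability_setT mul1e.
  rewrite (_ : X 0 @^-1` A = set0); last by apply/seteqP; split.
  by rewrite set0I measure0 mul0e.
pose XZ w := (X n w, Z n w).
have mXZ : measurable_fun [set: T] XZ.
  by apply/measurable_fun_pair => //; exact: measurable_chain.
pose mf : {mfun T >-> (S * U)%type} := mfun_Sub (mem_set mXZ).
have mE := mlater s mB.
have PE : P (later s B) \is a fin_num by rewrite fin_num_measure.
pose r : {nonneg R} := NngNum (fine_ge0 (measure_ge0 P (later s B))).
(* Two finite measures on pairs: the joint law of [X n] and [Z n] restricted to [later s B], and the
   full joint law times the mass of that event. Their equality on the preimage of [A] under [step]
   is the claim. *)
pose restr_law : {measure set (S * U) -> \bar R} := pushforward (mrestr P mE) mf.
pose m1 := restr_law mXZ.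
pose m2 : {measure set (S * U) -> \bar R} := mscale r (distribution P mf).
have /(_ (step @^-1` A)) : forall C, measurable C -> m1 C = m2 C.
  apply: rectangles_unique.
    rewrite /m1 /= /pushforward /mrestr/= (@le_lt_trans _ _ 1%E) ?ltry//.
    by rewrite preimage_setT setTI; exact: probability_le1.
  move=> A' B' mA' mB'.
  rewrite /m1 /m2 /= /mscale /distribution /pushforward /mrestr /= fineK//.
  have XZE : mf @^-1` (A' `*` B') = X n @^-1` A' `&` Z n @^-1` B'.
    by apply/seteqP; split => w /=.
  have ns : n \notin s by apply/negP => /sn; rewrite ltnn.
  (* [B2] adds the event on [Z n] to the family of later events, so that the induction hypothesis
     applies to [n :: s]. *)
  pose B2 i := if i == n then B' else B i.
  have mB2 i : measurable (B2 i) by rewrite /B2; case: ifP.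
  have l1 : later [:: n] B2 = Z n @^-1` B'.
    rewrite /later set_cons1 bigcap_set1 /B2 eqxx//.
  have l2 : later (n :: s) B2 = Z n @^-1` B' `&` later s B.
    rewrite /later (_ : [set` n :: s] = n |` [set` s]); last first.
      by apply/seteqP; split => i /=; rewrite inE => /predU1P.
    rewrite bigcap_setU1 /B2 eqxx; congr (_ `&` _).
    apply: eq_bigcapr => i /= si; case: eqP => // e; by rewrite -e si in ns.
  rewrite XZE -setIA -l2 ih//=; last 2 first.
  - by rewrite ns.
  - by move=> i; rewrite inE => /predU1P[->//|/sn/ltnW].
  rewrite /distribution /pushforward XZE -l1 ih//; last by move=> i; rewrite inE => /eqP ->.
  rewrite muleCA; congr (_ * _)%E.
  rewrite l1 l2 muleC.
  have := @Z_indep (n :: s) B2; rewrite -/(later _ _) l2 => ->//; last by rewrite /= ns.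
  rewrite big_cons {1}/B2 eqxx; congr (_ * _)%E.
  rewrite Z_indep//; apply: eq_big_seq => i si; rewrite /B2.
  by case: eqP => // e; rewrite -e si in ns.
rewrite /m1 /m2 /= /mscale /distribution /pushforward /mrestr /= fineK// => h.
rewrite [RHS]muleC -h//.
by rewrite -[X in measurable X]setTI; exact: mstep.
Qed.

Definition chain_mfun n : {mfun T >-> S} := mfun_Sub (mem_set (measurable_chain n)).

Lemma chain_pair_law n (C : set (S * U)) : measurable C ->
  P ((fun w => (X n w, Z n w)) @^-1` C) =
  (distribution P (chain_mfun n) \x mu)%E C.
Proof.
move=> mC; have mXZ : measurable_fun [set: T] (fun w => (X n w, Z n w)).
  by apply/measurable_fun_pair => //; exact: measurable_chain.
pose mf : {mfun T >-> (S * U)%type} := mfun_Sub (mem_set mXZ).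
apply/esym; apply: (product_measure_unique (m' := distribution P mf)) => // A B mA mB.
rewrite /distribution /= /pushforward /= -(Z_law n mB).
have := @chain_later_indep n A [:: n] (fun=> B) mA.
rewrite /later set_cons1 bigcap_set1 => <-//.
by move=> i; rewrite inE => /eqP ->.
Qed.

(** Stated for nonnegative extended-real functions because it is applied to squared distances, whose
    integrability is itself a consequence of the bound obtained. *)
Lemma chain_tonelli n (F : S * U -> \bar R) :
  measurable_fun [set: S * U] F -> (forall z, 0 <= F z)%E ->
  (\int[P]_w F (X n w, Z n w) = \int[P]_w \int[mu]_z F (X n w, z))%E.
Proof.
move=> mF F0; have mXZ : measurable_fun [set: T] (fun w => (X n w, Z n w)).
  by apply/measurable_fun_pair => //; exact: measurable_chain.
pose mf : {mfun T >-> (S * U)%type} := mfun_Sub (mem_set mXZ).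
have := @ge0_integral_distribution _ _ _ _ _ P mf _ mF F0.
rewrite /= => <-.
rewrite (eq_measure_integral (distribution P (chain_mfun n) \x mu)%E); last first.
  by move=> A mA _; exact: chain_pair_law.
rewrite (fubini_tonelli1 _ mF F0) ge0_integral_distribution//.
- exact: measurable_fun_fubini_tonelli_F mF F0.
- by move=> y; apply: integral_ge0.
Qed.

(** The transition operator of the chain, acting on functions of the state. *)
Definition chain_op (f : S -> R) (y : S) : R := \int[mu]_z f (step (y, z)).

Lemma bmf_step (f : S -> R) : bmf f -> bmf (fun p => f (step p)).
Proof.
by case=> mf [M fM]; split; [exact: measurableT_comp|exists M => x].
Qed.

Lemma bmf_chain_op (f : S -> R) : bmf f -> bmf (chain_op f).
(* Measurability of the partial integral comes from Fubini, which asks for a probability on the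
   state space; the Dirac mass at [x0] serves. *)
Proof. by move=> bf; exact: (bmf_Rintegral1 (\d_x0 : probability S R) mu (bmf_step bf)). Qed.

Lemma bmf_iter_chain_op (f : S -> R) n : bmf f -> bmf (iter n chain_op f).
Proof. by move=> bf; elim: n => [//|n ih]; exact: bmf_chain_op. Qed.

Lemma bmf_chain (f : S -> R) n : bmf f -> bmf (fun w => f (X n w)).
Proof.
case=> mf [M fM]; split; last by exists M => x.
by apply: measurableT_comp => //; exact: measurable_chain.
Qed.

Lemma Rintegral_chainS (f : S -> R) n : bmf f ->
  \int[P]_w f (X n.+1 w) = \int[P]_w chain_op f (X n w).
Proof.
move=> bf /=; have mXZ : measurable_fun [set: T] (fun w => (X n w, Z n w)).
  by apply/measurable_fun_pair => //; exact: measurable_chain.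
pose mf : {mfun T >-> (S * U)%type} := mfun_Sub (mem_set mXZ).
have bfs := bmf_step bf.
transitivity (\int[distribution P mf]_p f (step p)).
  rewrite /Rintegral integral_distribution//.
    by apply/measurable_EFinP; case: bfs.
  by apply: bmf_integrable; exact: bmf_chain n.+1 bf.
transitivity (\int[(distribution P (chain_mfun n) \x mu)%E]_p f (step p)).
  rewrite /Rintegral; congr fine.
  by apply: eq_measure_integral => A mA _; exact: chain_pair_law.
rewrite bounded_Fubini1// /Rintegral integral_distribution//.
- by apply/measurable_EFinP; case: (bmf_chain_op bf).
- by apply: bmf_integrable; exact: bmf_chain (bmf_chain_op bf).
Qed.

End chain.

(** Peeling off the last step replaces [f] by its image under the transition operator. Expectations
    become iterates of an operator, so chains living on unrelated probability spaces can be compared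
    state by state. *)
Lemma Rintegral_chain d (T : measurableType d) (R : realType) (P : probability T R)
    d' (U : measurableType d') (Z : nat -> T -> U) (mu : probability U R)
    dS (S : measurableType dS) (step : S * U -> S) :
  (forall k, measurable_fun [set: T] (Z k)) ->
  (forall k A, measurable A -> P (Z k @^-1` A) = mu A) ->
  mutually_independent P Z -> measurable_fun [set: S * U] step ->
  forall (f : S -> R) n y, bmf f ->
  \int[P]_w f (chain step Z y n w) = iter n (chain_op mu step) f y.
Proof.
move=> mZ Zl Zi ms f n y; elim: n f => [|n ih] f bf /=.
  exact: prob_Rintegral_cst.
rewrite (Rintegral_chainS mZ Zl Zi ms)// ih; last exact: bmf_chain_op.
by rewrite -iterSr.
Qed.

Lemma prob_integrable_cst d (T : measurableType d) (R : realType)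
    (P : probability T R) (c : R) : P.-integrable [set: T] (EFin \o cst c).
Proof. exact: finite_measure_integrable_cst. Qed.

Section centered.
Context d (T : measurableType d) (R : realType) (P : probability T R).
Variable eta : T -> R.
Hypothesis ieta : P.-integrable [set: T] (EFin \o eta).
Hypothesis ieta2 : P.-integrable [set: T] (EFin \o (fun z => eta z ^+ 2)).

Let cE c : (fun z => (c + eta z) ^+ 2) = (fun z => c ^+ 2 + (2 * c * eta z + eta z ^+ 2)).
Proof. by apply/funext => z; ring. Qed.

Let ilin c : P.-integrable [set: T] (EFin \o (fun z => 2 * c * eta z)).
Proof.
have := integrableZl measurableT (2 * c) ieta.
by apply: eq_integrable => // z _ /=; rewrite EFinM.
Qed.

Let ilin2 c : P.-integrable [set: T] (EFin \o (fun z => 2 * c * eta z + eta z ^+ 2)).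
Proof. by have := integrableD measurableT (ilin c) ieta2; apply: eq_integrable. Qed.

Lemma integrable_shift_sqr c : P.-integrable [set: T] (EFin \o (fun z => (c + eta z) ^+ 2)).
Proof.
rewrite cE; have := integrableD measurableT (prob_integrable_cst P (c ^+ 2)) (ilin2 c).
by apply: eq_integrable.
Qed.

Lemma Rintegral_shift_sqr c : \int[P]_z eta z = 0 ->
  \int[P]_z (c + eta z) ^+ 2 = c ^+ 2 + \int[P]_z eta z ^+ 2.
Proof.
move=> eta0; rewrite cE RintegralD//; last exact: prob_integrable_cst.
rewrite prob_Rintegral_cst RintegralD//.
by rewrite RintegralZl// eta0 mulr0 add0r.
Qed.

End centered.

(** * Coupling of reflected walks *)

(** The increment is a function [xi] of the driver, so that two walks are coupled by sharing the
    drivers and differing only in [xi]. *)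
Definition reflect_step (R : realType) (U : Type) (xi : U -> R) (p : R * U) : R :=
  Num.max (p.1 + xi p.2) 0.

Lemma measurable_reflect_step (R : realType) d (U : measurableType d) (xi : U -> R) :
  measurable_fun [set: U] xi ->
  measurable_fun [set: R * U] (reflect_step xi).
Proof.
move=> mxi; apply: measurable_funrpos.
by apply: measurable_funD => //; exact: measurableT_comp.
Qed.

Lemma max0_contract (R : realDomainType) (a b : R) :
  (Num.max a 0 - Num.max b 0) ^+ 2 <= (a - b) ^+ 2.
Proof.
have [a0|a0] := leP a 0; have [b0|b0] := leP b 0;
  have := sqr_ge0 a; have := sqr_ge0 b; have := sqr_ge0 (a - b); nra.
Qed.

Section coupling.
Context d (T : measurableType d) (R : realType) (P : probability T R).
Context d' (U : measurableType d') (Z : nat -> T -> U) (mu : probability U R).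
Hypothesis mZ : forall k, measurable_fun [set: T] (Z k).
Hypothesis Z_law : forall k A, measurable A -> P (Z k @^-1` A) = mu A.
Hypothesis Z_indep : mutually_independent P Z.
Variables (xi xi' : U -> R).
Hypotheses (mxi : measurable_fun [set: U] xi) (mxi' : measurable_fun [set: U] xi').
Let eta z := xi z - xi' z.
Hypothesis ieta : mu.-integrable [set: U] (EFin \o eta).
Hypothesis ieta2 : mu.-integrable [set: U] (EFin \o (fun z => eta z ^+ 2)).
Hypothesis eta0 : \int[mu]_z eta z = 0.
Variable x0 : R.

Local Notation X := (chain (reflect_step xi) Z x0).
Local Notation X' := (chain (reflect_step xi') Z x0).

Let pair_step (p : (R * R) * U) : R * R :=
  (reflect_step xi (p.1.1, p.2), reflect_step xi' (p.1.2, p.2)).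

Let mpair_step : measurable_fun [set: (R * R) * U] pair_step.
Proof.
apply/measurable_fun_pair.
- apply: (measurableT_comp (measurable_reflect_step mxi)).
  by apply/measurable_fun_pair => //; exact: measurableT_comp.
- apply: (measurableT_comp (measurable_reflect_step mxi')).
  by apply/measurable_fun_pair => //; exact: measurableT_comp.
Qed.

Let pair_chainE n w : chain pair_step Z (x0, x0) n w = (X n w, X' n w).
Proof. by elim: n => //= n ->. Qed.

Let mX n : measurable_fun [set: T] (X n).
Proof. by apply: measurable_chain => //; exact: measurable_reflect_step. Qed.

Let mX' n : measurable_fun [set: T] (X' n).
Proof. by apply: measurable_chain => //; exact: measurable_reflect_step. Qed.

(* max(., 0) is a contraction and eta has mean 0, so that one step adds at most
   the second moment of eta: no maximal inequality is needed. *)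
Lemma reflect_coupling n :
  (\int[P]_w ((X n w - X' n w) ^+ 2)%:E <= (n%:R * \int[mu]_z eta z ^+ 2)%:E)%E.
Proof.
set e := \int[mu]_z _; have e0 : 0 <= e by apply: Rintegral_ge0 => z _; exact: sqr_ge0.
elim: n => [|n ih].
  under eq_integral do rewrite /= subrr expr0n/=.
  by rewrite integral0 mul0r.
pose F (p : (R * R) * U) := ((p.1.1 - p.1.2 + eta p.2) ^+ 2)%:E.
have mF : measurable_fun [set: (R * R) * U] F.
  apply/measurable_EFinP; apply: measurable_funX; apply: measurable_funD.
    by apply: measurable_funB => //; exact: measurableT_comp.
  by apply: measurable_funB; exact: measurableT_comp.
apply: (@le_trans _ _ (\int[P]_w F ((X n w, X' n w), Z n w))%E).
  apply: ge0_le_integral => //.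
  - by move=> w _; rewrite lee_fin sqr_ge0.
  - by apply/measurable_EFinP; apply: measurable_funX; apply: measurable_funB.
  - apply: measurableT_comp => //; apply/measurable_fun_pair => //.
    exact/measurable_fun_pair.
  - move=> w _; rewrite /F/= /reflect_step/= lee_fin.
    apply: le_trans (max0_contract _ _) _.
    by rewrite le_eqVlt; apply/orP; left; apply/eqP; rewrite /eta; ring.
have F0 z : (0 <= F z)%E by rewrite lee_fin sqr_ge0.
have := chain_tonelli mZ Z_law Z_indep mpair_step (x0, x0) n mF F0.
under eq_integral do rewrite pair_chainE.
move=> ->.
have inner w : (\int[mu]_z F (chain pair_step Z (x0, x0) n w, z) =
    ((X n w - X' n w) ^+ 2)%:E + e%:E)%E.
  rewrite pair_chainE /F /= -EFinD -(Rintegral_shift_sqr ieta ieta2)//.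
  by rewrite /Rintegral fineK// integrable_fin_num//; exact: integrable_shift_sqr.
under eq_integral do rewrite inner.
rewrite ge0_integralD//=; last 2 first.
- by move=> w _; rewrite lee_fin sqr_ge0.
- by apply/measurable_EFinP; apply: measurable_funX; apply: measurable_funB.
rewrite integral_cst//= probability_setT mule1 -natr1 mulrDl mul1r EFinD.
by rewrite leeD2r.
Qed.

(** [|u| <= del + u^2 / del] turns the mean square bound into a first moment bound without
    Cauchy-Schwarz; [del] stays free and is fixed before the truncation level. *)
Lemma reflect_coupling_lipschitz n (f : R -> R) (K del : R) : bmf f -> 0 <= K ->
  (forall u v, `|f u - f v| <= K * `|u - v|) -> 0 < del ->
  `|\int[P]_w f (X n w) - \int[P]_w f (X' n w)| <=
  K * (del + n%:R * (\int[mu]_z eta z ^+ 2) / del).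
Proof.
move=> bf K0 fK del0.
have bfX : bmf (fun w => f (X n w)).
  by apply: bmf_chain => //; exact: measurable_reflect_step.
have bfX' : bmf (fun w => f (X' n w)).
  by apply: bmf_chain => //; exact: measurable_reflect_step.
have iX := bmf_integrable P bfX; have iX' := bmf_integrable P bfX'.
rewrite -RintegralB//.
apply: (le_trans (le_normr_Rintegral _ _)) => //.
  by have := integrableB measurableT iX iX'; apply: eq_integrable.
have coup := reflect_coupling n.
set e := \int[mu]_z _ in coup *.
have iD2 : P.-integrable [set: T] (EFin \o (fun w => (X n w - X' n w) ^+ 2)).
  apply/integrableP; split.
    by apply/measurable_EFinP; apply: measurable_funX; exact: measurable_funB.
  under eq_integral do rewrite gee0_abs ?lee_fin ?sqr_ge0//.
  exact: le_lt_trans coup (ltry _).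
have iZ : P.-integrable [set: T] (EFin \o (fun w => K / del * (X n w - X' n w) ^+ 2)).
  have := integrableZl measurableT (K / del) iD2.
  by apply: eq_integrable => // w _ /=; rewrite EFinM.
apply: (@le_trans _ _ (\int[P]_w (K * del + K / del * (X n w - X' n w) ^+ 2))).
  apply: le_Rintegral => //.
  - have := integrable_norm (integrableB measurableT iX iX').
    by apply: eq_integrable.
  - have := integrableD measurableT (prob_integrable_cst P (K * del)) iZ.
    by apply: eq_integrable.
  move=> w _; apply: le_trans (fK _ _) _.
  rewrite -mulrA -mulrDr ler_wpM2l// -(ler_pM2l del0) mulrDr mulVKf ?gt_eqF//.
  rewrite -[in leRHS]real_normK ?num_real//.
  have := sqr_ge0 (`|X n w - X' n w| - del); have := normr_ge0 (X n w - X' n w).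
  nra.
rewrite RintegralD//; last exact: prob_integrable_cst.
rewrite prob_Rintegral_cst RintegralZl// mulrDr lerD2l -mulrA ler_wpM2l//.
rewrite mulrC; apply: ler_wpM2r; first by rewrite invr_ge0 ltW.
rewrite -lee_fin; apply: le_trans coup.
by rewrite /Rintegral fineK//; exact: integrable_fin_num.
Qed.

End coupling.

(** * Soft reflection and Lindeberg's exchange *)

Section taylor.
Context (R : realType).
Implicit Types (g h : R -> R) (C x : R).

(** Mean value theorem from 0. The factor 1 / (k + 1) is given up, so that three applications leave
    the crude constant [C] in the Taylor remainder. *)
Lemma derive_growth h h' C k : (forall x, is_derive x 1 h (h' x)) -> h 0 = 0 ->
  (forall x, `|h' x| <= C * `|x| ^+ k) -> forall x, `|h x| <= C * `|x| ^+ k.+1.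
Proof.
move=> dh h0 h'C x.
have ch a b : {within `[a, b], continuous h}.
  by apply: derivable_within_continuous => y _; exact: ex_derive.
have C0 : 0 <= C.
  have := h'C 1; rewrite normr1 expr1n mulr1; exact: le_trans.
have bound c : `|c| <= `|x| -> `|h' c * x| <= C * `|x| ^+ k.+1.
  move=> cx; rewrite normrM exprSr mulrA ler_wpM2r// (le_trans (h'C c))//.
  by rewrite ler_wpM2l// lerXn2r// nnegrE.
have [x0|x0|->] := ltgtP x 0; last by rewrite h0 normr0 expr0n mulr0.
- have [c cx] := MVT x0 (fun y _ => dh y) (ch x 0).
  rewrite h0 !sub0r mulrN => /oppr_inj ->; apply: bound.
  move: cx; rewrite in_itv/= => /andP[xc c0].
  by rewrite !ler0_norm ?lerN2 ltW.
- have [c cx] := MVT x0 (fun y _ => dh y) (ch 0 x).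
  rewrite h0 !subr0 => ->; apply: bound.
  move: cx; rewrite in_itv/= => /andP[xc c0].
  by rewrite !ger0_norm ltW.
Qed.

Lemma taylor_remainder3 g g1 g2 g3 C :
  (forall x, is_derive x 1 g (g1 x)) -> (forall x, is_derive x 1 g1 (g2 x)) ->
  (forall x, is_derive x 1 g2 (g3 x)) -> (forall x, `|g3 x| <= C) ->
  forall x, `|g x - (g 0 + g1 0 * x + g2 0 / 2 * x ^+ 2)| <= C * `|x| ^+ 3.
Proof.
move=> dg dg1 dg2 g3C.
have r2 x : `|g2 x - g2 0| <= C * `|x| ^+ 1.
  pose h2 y := g2 y - g2 0.
  apply: (@derive_growth h2 g3 _ 0); rewrite /h2 ?subrr//.
    by move=> y; apply: is_derive_eq; rewrite subr0.
  by move=> y; rewrite expr0 mulr1.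
have r1 x : `|g1 x - (g1 0 + g2 0 * x)| <= C * `|x| ^+ 2.
  pose h1 y := g1 y - (g1 0 + g2 0 * y).
  apply: (@derive_growth h1 (fun y => g2 y - g2 0) _ 1) => //.
    move=> y; rewrite /h1; apply: is_derive_eq; rewrite /GRing.scale/=. ring.
  by rewrite /h1 mulr0 addr0 subrr.
move=> x; pose h0 y := g y - (g 0 + g1 0 * y + g2 0 / 2 * y ^+ 2).
apply: (@derive_growth h0 (fun y => g1 y - (g1 0 + g2 0 * y)) _ 2) => //.
  move=> y; rewrite /h0; apply: is_derive_eq; rewrite /GRing.scale/=; by field.
by rewrite /h0 expr2 !mulr0 !addr0 subrr.
Qed.

End taylor.

Section log_affine_exp.
Context (R : realType) (b : R) (b0 : 0 < b) (a c : R) (a0 : 0 <= a) (c0 : 0 < c).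

(** The general form of a composition of soft steps seen as a function of one increment [u]; [a] and
    [c] collect everything else. Its derivative [soft_slope] is a logistic function. *)
Definition soft_flow (u : R) := ln (a + c * expR (b * u)) / b.
Definition soft_slope (u : R) := c * expR (b * u) / (a + c * expR (b * u)).

Let den0 u : 0 < a + c * expR (b * u).
Proof. by rewrite ltr_wpDl// mulr_gt0// expR_gt0. Qed.

Let is_derive_exp_scale (u : R) :
  is_derive u 1 (fun y => expR (b * y)) (b * expR (b * u)).
Proof.
have dlin : is_derive u 1 (fun y => b * y) b.
  by apply: is_derive_eq; rewrite /GRing.scale/=; ring.
by have := is_derive1_comp (is_derive_expR (b * u)) dlin; rewrite mulrC.
Qed.

Lemma is_derive_soft_flow (u : R) : is_derive u 1 soft_flow (soft_slope u).
Proof.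
have d1 : is_derive u 1 (fun y => a + c * expR (b * y)) (c * (b * expR (b * u))).
  have dexp := is_derive_exp_scale u.
  by apply: is_derive_eq; rewrite /GRing.scale/=; ring.
have d2 := is_derive1_ln (den0 u).
have d3 := @is_derive1_comp _ (@ln R) (fun y => a + c * expR (b * y)) _ _ _ d2 d1.
rewrite /soft_flow /soft_slope.
apply: is_derive_eq.
rewrite /GRing.scale/=.
by field; rewrite !gt_eqF.
Qed.

(** The logistic equation. Each differentiation costs one factor [b] and otherwise only polynomials
    in a slope that lies in [0, 1], whence bounds free of [a] and [c]. *)
Lemma is_derive_soft_slope (u : R) :
  is_derive u 1 soft_slope (b * soft_slope u * (1 - soft_slope u)).
Proof.
have dexp : is_derive u 1 (fun y => c * expR (b * y)) (c * (b * expR (b * u))).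
  have dexp := is_derive_exp_scale u.
  by apply: is_derive_eq; rewrite /GRing.scale/=; ring.
have dden : is_derive u 1 (fun y => (a + c * expR (b * y))^-1)
    (- (a + c * expR (b * u)) ^- 2 *: (c * (b * expR (b * u)))).
  apply: is_deriveV; first by rewrite gt_eqF.
  by apply: is_derive_eq; rewrite /GRing.scale/=; ring.
rewrite /soft_slope; apply: is_derive_eq.
rewrite /GRing.scale/=; field.
by rewrite gt_eqF.
Qed.

Lemma soft_slope_itv (u : R) : 0 <= soft_slope u <= 1.
Proof.
rewrite /soft_slope; have e0 : 0 < c * expR (b * u) by rewrite mulr_gt0// expR_gt0.
apply/andP; split; first by apply: divr_ge0; exact: ltW.
by rewrite ler_pdivrMr// mul1r lerDr.
Qed.

Variables (f f1 f2 f3 : R -> R) (M : R).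
Hypotheses (df : forall x : R, is_derive x 1 f (f1 x))
  (df1 : forall x : R, is_derive x 1 f1 (f2 x))
  (df2 : forall x : R, is_derive x 1 f2 (f3 x)).
Hypotheses (f1M : forall x, `|f1 x| <= M) (f2M : forall x, `|f2 x| <= M)
  (f3M : forall x, `|f3 x| <= M).

Local Notation g := soft_flow.
Local Notation p := soft_slope.

(** The first three derivatives of [f] along the flow, by the chain rule and p' = b p (1 - p). *)
Let psi1 u := f1 (g u) * p u.
Let psi2 u := f2 (g u) * p u ^+ 2 + b * (f1 (g u) * (p u * (1 - p u))).
Let psi3 u := f3 (g u) * p u ^+ 3 + 3 * b * (f2 (g u) * (p u ^+ 2 * (1 - p u))) +
   b ^+ 2 * (f1 (g u) * (p u * (1 - p u) * (1 - 2 * p u))).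

Let dp := is_derive_soft_slope.
Let dfg (h h1 : R -> R) (dh : forall x : R, is_derive x 1 h (h1 x)) (u : R) :
  is_derive u 1 (fun y => h (g y)) (h1 (g u) * p u).
Proof. exact: (@is_derive1_comp _ h soft_flow _ _ _ (dh _) (is_derive_soft_flow u)). Qed.

Let dpsi (u : R) : is_derive u 1 (fun y => f (g y)) (psi1 u).
Proof. exact: dfg. Qed.

Let dpsi1 (u : R) : is_derive u 1 psi1 (psi2 u).
Proof.
have := dfg df1 u; have := dp u => h1 h2.
rewrite /psi1; apply: is_derive_eq.
by rewrite /psi2 /GRing.scale/=; ring.
Qed.

Let dpsi2 (u : R) : is_derive u 1 psi2 (psi3 u).
Proof.
have := dfg df1 u; have := dfg df2 u; have := dp u => h1 h2 h3.
rewrite /psi2; apply: is_derive_eq.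
by rewrite /psi3 /GRing.scale/=; ring.
Qed.

Let psi3M u : `|psi3 u| <= M * (1 + 3 * b + b ^+ 2).
Proof.
have M0 : 0 <= M by apply: le_trans (f1M 0).
have /andP[p0 p1] := soft_slope_itv u.
have q0 : 0 <= 1 - p u by rewrite subr_ge0.
have q1 : 1 - p u <= 1 by rewrite gerBl.
have mulM (y z : R) : `|y| <= M -> `|z| <= 1 -> `|y * z| <= M.
  by move=> yM z1; rewrite normrM -[leRHS]mulr1 ler_pM.
have mul1 (y z : R) : `|y| <= 1 -> `|z| <= 1 -> `|y * z| <= 1.
  by move=> yM z1; rewrite normrM -[leRHS]mulr1 ler_pM.
have np : `|p u| <= 1 by rewrite ger0_norm.
have nq : `|1 - p u| <= 1 by rewrite ger0_norm.
have npq : `|1 - 2 * p u| <= 1 by rewrite ler_norml; apply/andP; split; lra.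
have nX k : `|p u ^+ k| <= 1 by rewrite normrX exprn_ile1.
have -> : M * (1 + 3 * b + b ^+ 2) = M + M * (3 * b) + M * b ^+ 2 by ring.
rewrite /psi3.
apply: le_trans (ler_normD _ _) _; apply: lerD; last first.
  rewrite normrM mulrC (ger0_norm (sqr_ge0 b)) ler_wpM2r ?sqr_ge0//.
  by apply: (mulM) => //; apply: (mul1) => //; apply: (mul1).
apply: le_trans (ler_normD _ _) _; apply: lerD; first by apply: (mulM).
have b30 : 0 <= 3 * b by rewrite mulr_ge0// ltW.
rewrite normrM mulrC (ger0_norm b30) ler_wpM2r//.
by apply: (mulM) => //; apply: (mul1).
Qed.

(** The coefficients [q] and [r] depend on [a] and [c], the remainder bound does not: it can be
    averaged over random [a] and [c]. *)
Lemma soft_flow_taylor : exists q r, forall u,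
  `|f (g u) - (f (g 0) + q * u + r * u ^+ 2)| <= M * (1 + 3 * b + b ^+ 2) * `|u| ^+ 3.
Proof.
exists (psi1 0), (psi2 0 / 2) => u.
exact: (taylor_remainder3 dpsi dpsi1 dpsi2 psi3M).
Qed.

End log_affine_exp.

Section moment_matching.
Context (R : realType) (psi : R -> R) (q r C : R).
Hypothesis psi_bmf : bmf psi.
Hypothesis psi_taylor :
  forall u, `|psi u - (psi 0 + q * u + r * u ^+ 2)| <= C * `|u| ^+ 3.

(* For two laws with the same mean and second moment the three polynomial terms
   agree, so that only the third absolute moments enter Lindeberg's exchange. *)
Lemma moment_expansion d (U : measurableType d) (mu : probability U R) (xi : U -> R)
    (k : R) :
  mu.-integrable [set: U] (EFin \o xi) ->
  mu.-integrable [set: U] (EFin \o (fun z => xi z ^+ 2)) ->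
  (\int[mu]_z (`|xi z| ^+ 3)%:E <= k%:E)%E -> 0 <= C ->
  `|\int[mu]_z psi (xi z) - (psi 0 + q * \int[mu]_z xi z + r * \int[mu]_z xi z ^+ 2)|
  <= C * k.
Proof.
move=> ixi ixi2 xi3 C0.
have mxi : measurable_fun [set: U] xi by apply/measurable_EFinP/(measurable_int mu).
have bp : bmf (fun z => psi (xi z)).
  by case: psi_bmf => mp [B pB]; split; [exact: measurableT_comp|exists B => z].
have ip := bmf_integrable mu bp.
have iq : mu.-integrable [set: U] (EFin \o (fun z => q * xi z)).
  by have := integrableZl measurableT q ixi; apply: eq_integrable.
have ir : mu.-integrable [set: U] (EFin \o (fun z => r * xi z ^+ 2)).
  by have := integrableZl measurableT r ixi2; apply: eq_integrable.
have i0 : mu.-integrable [set: U] (EFin \o (fun z => psi 0 + q * xi z)).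
  by have := integrableD measurableT (prob_integrable_cst mu (psi 0)) iq; apply: eq_integrable.
have i1 : mu.-integrable [set: U] (EFin \o (fun z => psi 0 + q * xi z + r * xi z ^+ 2)).
  by have := integrableD measurableT i0 ir; apply: eq_integrable.
have i3 : mu.-integrable [set: U] (EFin \o (fun z => `|xi z| ^+ 3)).
  apply/integrableP; split.
    by apply/measurable_EFinP; apply: measurable_funX; exact: measurableT_comp.
  under eq_integral do rewrite gee0_abs ?lee_fin ?exprn_ge0//.
  exact: le_lt_trans xi3 (ltry _).
have -> : psi 0 + q * \int[mu]_z xi z + r * \int[mu]_z xi z ^+ 2 =
    \int[mu]_z (psi 0 + q * xi z + r * xi z ^+ 2).
  rewrite RintegralD// RintegralD//; last exact: prob_integrable_cst.
  by rewrite prob_Rintegral_cst !RintegralZl.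
rewrite -RintegralB//.
apply: le_trans (le_normr_Rintegral _ _) _ => //.
  by have := integrableB measurableT ip i1; apply: eq_integrable.
apply: (@le_trans _ _ (\int[mu]_z (C * `|xi z| ^+ 3))).
  apply: le_Rintegral => //.
  - by have := integrable_norm (integrableB measurableT ip i1); apply: eq_integrable.
  - by have := integrableZl measurableT C i3; apply: eq_integrable.
rewrite RintegralZl// ler_wpM2l//.
rewrite -lee_fin; apply: le_trans xi3.
by rewrite /Rintegral fineK//; exact: integrable_fin_num.
Qed.

End moment_matching.

(* y |-> ln (1 + exp (b y)) / b is a smooth version of max(., 0); the chain it
   drives has the closed form [soft_chainE]. *)
Definition soft_step (R : realType) (b : R) (U : Type) (xi : U -> R) (p : R * U) : R :=
  ln (1 + expR (b * (p.1 + xi p.2))) / b.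

Lemma measurable_soft_step (R : realType) (b : R) d (U : measurableType d) (xi : U -> R) :
  measurable_fun [set: U] xi -> measurable_fun [set: R * U] (soft_step b xi).
Proof.
move=> mxi; apply: measurable_funM => //; apply: measurableT_comp => //.
apply: measurable_funD => //; apply: measurableT_comp => //.
apply: measurable_funM => //.
by apply: measurable_funD => //; exact: measurableT_comp.
Qed.

Section soft_chain.
Context (R : realType) (b : R) (b0 : 0 < b).
Context d (T : measurableType d) d' (U : measurableType d').
Context (Z : nat -> T -> U) (xi : U -> R).
Hypothesis mZ : forall k, measurable_fun [set: T] (Z k).
Hypothesis mxi : measurable_fun [set: U] xi.

(** In terms of exp (b X) a soft step is the affine map v |-> 1 + exp (b xi) v; the composition of n
    of them is v |-> offset + gain v. *)
Fixpoint soft_gain (n : nat) (w : T) : R :=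
  if n is m.+1 then soft_gain m w * expR (b * xi (Z m w)) else 1.

Fixpoint soft_offset (n : nat) (w : T) : R :=
  if n is m.+1 then 1 + soft_offset m w * expR (b * xi (Z m w)) else 0.

Lemma soft_gain_gt0 n w : 0 < soft_gain n w.
Proof. by elim: n => //= n ih; rewrite mulr_gt0// expR_gt0. Qed.

Lemma soft_offset_ge0 n w : 0 <= soft_offset n w.
Proof. by elim: n => //= n ih; rewrite addr_ge0// mulr_ge0// expR_ge0. Qed.

Let mexp n : measurable_fun [set: T] (fun w => expR (b * xi (Z n w))).
Proof.
apply: measurableT_comp => //; apply: measurable_funM => //.
by apply: measurableT_comp.
Qed.

Lemma measurable_soft_gain n : measurable_fun [set: T] (soft_gain n).
Proof. by elim: n => [|n ih] //=; exact: measurable_funM. Qed.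

Lemma measurable_soft_offset n : measurable_fun [set: T] (soft_offset n).
Proof. by elim: n => [|n ih] //=; apply: measurable_funD => //; exact: measurable_funM. Qed.

Lemma soft_chainE n y w :
  chain (soft_step b xi) Z y n w = soft_flow b (soft_offset n w) (soft_gain n w) y.
Proof.
rewrite /soft_flow; elim: n => [|n ih] /=.
  by rewrite add0r mul1r expRK mulrAC divff ?mul1r// gt_eqF.
rewrite /soft_step/= ih; congr (ln _ / b).
rewrite mulrDr mulrCA divff ?gt_eqF// mulr1 expRD lnK; first by ring.
rewrite posrE ltr_wpDl ?soft_offset_ge0// mulr_gt0 ?expR_gt0//.
exact: soft_gain_gt0.
Qed.

End soft_chain.

(** Prepending a soft step stays in the family: the state after one exchanged increment and all
    later steps is again a single [soft_flow] in that increment. *)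
Lemma soft_flow_step (R : realType) (b a c y u : R) : 0 < b ->
  soft_flow b a c (ln (1 + expR (b * (y + u))) / b) =
  soft_flow b (a + c) (c * expR (b * y)) u.
Proof.
move=> b0; rewrite /soft_flow; congr (ln _ / b).
rewrite mulrCA divff ?gt_eqF// mulr1 lnK ?posrE ?addr_gt0 ?expR_gt0//.
by rewrite (mulrDr b) expRD; ring.
Qed.

Section lindeberg.
Context (R : realType) (b : R) (b0 : 0 < b).
Variables (f f1 f2 f3 : R -> R) (M : R).
Hypotheses (df : forall x : R, is_derive x 1 f (f1 x))
  (df1 : forall x : R, is_derive x 1 f1 (f2 x))
  (df2 : forall x : R, is_derive x 1 f2 (f3 x)).
Hypotheses (fM : forall x, `|f x| <= M) (f1M : forall x, `|f1 x| <= M)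
  (f2M : forall x, `|f2 x| <= M) (f3M : forall x, `|f3 x| <= M).

Let bf : bmf f.
Proof.
split; last by exists M.
apply: continuous_measurable_fun => x.
apply: differentiable_continuous; apply/derivable1_diffP; exact: ex_derive.
Qed.

Let C := M * (1 + 3 * b + b ^+ 2).

Let M0 : 0 <= M. Proof. exact: le_trans (fM 0). Qed.

Let C0 : 0 <= C.
Proof. by rewrite mulr_ge0// !addr_ge0 ?sqr_ge0// mulr_ge0// ltW. Qed.

Context dT1 (T1 : measurableType dT1) (P1 : probability T1 R).
Context dU1 (U1 : measurableType dU1) (Z1 : nat -> T1 -> U1) (mu1 : probability U1 R).
Hypothesis mZ1 : forall k, measurable_fun [set: T1] (Z1 k).
Hypothesis Z1_law : forall k A, measurable A -> P1 (Z1 k @^-1` A) = mu1 A.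
Hypothesis Z1_indep : mutually_independent P1 Z1.
Variable xi1 : U1 -> R.

Context dT2 (T2 : measurableType dT2) (P2 : probability T2 R).
Context dU2 (U2 : measurableType dU2) (Z2 : nat -> T2 -> U2) (mu2 : probability U2 R).
Hypothesis mZ2 : forall k, measurable_fun [set: T2] (Z2 k).
Hypothesis Z2_law : forall k A, measurable A -> P2 (Z2 k @^-1` A) = mu2 A.
Hypothesis Z2_indep : mutually_independent P2 Z2.
Variable xi2 : U2 -> R.

Hypotheses (ixi1 : mu1.-integrable [set: U1] (EFin \o xi1))
  (ixi1s : mu1.-integrable [set: U1] (EFin \o (fun z => xi1 z ^+ 2)))
  (ixi2 : mu2.-integrable [set: U2] (EFin \o xi2))
  (ixi2s : mu2.-integrable [set: U2] (EFin \o (fun z => xi2 z ^+ 2))).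
Hypothesis same_mean : \int[mu1]_z xi1 z = \int[mu2]_z xi2 z.
Hypothesis same_square : \int[mu1]_z xi1 z ^+ 2 = \int[mu2]_z xi2 z ^+ 2.
Variable k : R.
Hypotheses (cube1 : (\int[mu1]_z (`|xi1 z| ^+ 3)%:E <= k%:E)%E)
  (cube2 : (\int[mu2]_z (`|xi2 z| ^+ 3)%:E <= k%:E)%E).

Let mxi1 : measurable_fun [set: U1] xi1.
Proof. by apply/measurable_EFinP/(measurable_int mu1). Qed.
Let mxi2 : measurable_fun [set: U2] xi2.
Proof. by apply/measurable_EFinP/(measurable_int mu2). Qed.

Let A := chain_op mu1 (soft_step b xi1).
Let G := chain_op mu2 (soft_step b xi2).

Let ms1 := measurable_soft_step b mxi1.
Let ms2 := measurable_soft_step b mxi2.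

(** The test function after one exchanged step from [y] with increment [u], followed by [n] steps of
    the second chain frozen at [w]. *)
Let h (y : R) n (w : T2) (u : R) :=
  f (soft_flow b (soft_offset b Z2 xi2 n w + soft_gain b Z2 xi2 n w)
       (soft_gain b Z2 xi2 n w * expR (b * y)) u).

Let bh y n dU (U : measurableType dU) (xi : U -> R) : measurable_fun [set: U] xi ->
  bmf (fun p : U * T2 => h y n p.2 (xi p.1)).
Proof.
move=> mxi; split; last by exists M => p; exact: fM.
apply: measurableT_comp; first by case: bf.
apply: measurable_funM => //; apply: measurableT_comp => //.
have mg : measurable_fun [set: U * T2] (fun p => soft_gain b Z2 xi2 n p.2).
  by apply: measurableT_comp => //; exact: measurable_soft_gain.
apply: measurable_funD.
  apply: measurable_funD => //.
  by apply: measurableT_comp => //; exact: measurable_soft_offset.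
apply: measurable_funM; first exact: measurable_funM.
apply: measurableT_comp => //; apply: measurable_funM => //.
exact: measurableT_comp.
Qed.

Let iterGE n u : iter n G f u =
  \int[P2]_w f (soft_flow b (soft_offset b Z2 xi2 n w) (soft_gain b Z2 xi2 n w) u).
Proof.
rewrite -(Rintegral_chain mZ2 Z2_law Z2_indep ms2)//.
by apply: eq_Rintegral => w _; rewrite soft_chainE.
Qed.

(** Fubini puts the exchanged increment inside, so that for each fixed [w] the integrand is one
    smooth function of it. *)
Let opE n dU (U : measurableType dU) (mu : probability U R) (xi : U -> R) y :
  measurable_fun [set: U] xi ->
  chain_op mu (soft_step b xi) (iter n G f) y = \int[P2]_w \int[mu]_z h y n w (xi z).
Proof.
move=> mxi; rewrite -(bounded_Fubini mu P2 (bh y n mxi)) /chain_op.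
apply: eq_Rintegral => z _; rewrite iterGE.
by apply: eq_Rintegral => w _; rewrite /soft_step soft_flow_step.
Qed.

Let one_step n y : `|A (iter n G f) y - G (iter n G f) y| <= 2 * (C * k).
Proof.
have b1 := bmf_Rintegral2 mu1 P2 (bh y n mxi1).
have b2 := bmf_Rintegral2 mu2 P2 (bh y n mxi2).
rewrite /A /G !opE// -RintegralB//; [|exact: bmf_integrable b1|exact: bmf_integrable b2].
have mb : measurable_fun [set: T2]
  (fun w => \int[mu1]_z h y n w (xi1 z) - \int[mu2]_z h y n w (xi2 z)).
  by apply: measurable_funB; [case: b1|case: b2].
apply: le_norm_prob_Rintegral => // w.
have g0 : 0 < soft_gain b Z2 xi2 n w * expR (b * y).
  by rewrite mulr_gt0 ?expR_gt0//; exact: soft_gain_gt0.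
have a0 : 0 <= soft_offset b Z2 xi2 n w + soft_gain b Z2 xi2 n w.
  by rewrite addr_ge0 ?soft_offset_ge0// ltW//; exact: soft_gain_gt0.
have [q [r hqr]] := soft_flow_taylor b0 a0 g0 df df1 df2 f1M f2M f3M.
have bhw : bmf (h y n w).
  split; last by exists M => u; exact: fM.
  have [mh _] := bh y n (@measurable_id _ R setT).
  exact: measurableT_comp mh (pair2_measurable w).
have e1 := moment_expansion bhw hqr ixi1 ixi1s cube1 C0.
have e2 := moment_expansion bhw hqr ixi2 ixi2s cube2 C0.
rewrite same_mean same_square in e1.
(* [E0] is the common second-order expansion; each of the two integrals lies within [C * k] of
   it. *)
set E0 := (_ + _ + _) in e1 e2.
rewrite -(subrK E0 (\int[mu1]_z _)) -addrA.
apply: le_trans (ler_normD _ _) _; rewrite mulr2n mulrDl mul1r lerD//.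
by rewrite distrC.
Qed.

(** A^(n+1) - G^(n+1) = A (A^n - G^n) + (A - G) G^n. Averaging by [A] does not increase the sup
    norm, and smoothness is asked only of the iterates of [G], which [soft_flow] describes. *)
Lemma lindeberg_soft_chain n y :
  `|\int[P1]_w f (chain (soft_step b xi1) Z1 y n w) -
    \int[P2]_w f (chain (soft_step b xi2) Z2 y n w)| <= n%:R * (2 * (C * k)).
Proof.
rewrite (Rintegral_chain mZ1 Z1_law Z1_indep ms1)//.
rewrite (Rintegral_chain mZ2 Z2_law Z2_indep ms2)//.
rewrite -/A -/G; elim: n y => [|n ih] y /=; first by rewrite subrr normr0 mul0r.
rewrite -(subrK (A (iter n G f) y) (A (iter n A f) y)) -addrA -natr1 mulrDl mul1r.
apply: le_trans (ler_normD _ _) _; apply: lerD => //.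
have bA := bmf_step ms1 (bmf_iter_chain_op mu1 ms1 (0 : R) n bf).
have bG := bmf_step ms1 (bmf_iter_chain_op mu2 ms2 (0 : R) n bf).
rewrite /A /chain_op -RintegralB//; last 2 first.
- exact: bmf_integrable (bmf_section1 bA y).
- exact: bmf_integrable (bmf_section1 bG y).
apply: le_norm_prob_Rintegral => [|z]; last exact: ih.
by apply: measurable_funB; [case: (bmf_section1 bA y)|case: (bmf_section1 bG y)].
Qed.

End lindeberg.

Section soft_vs_hard.
Context (R : realType) (b : R) (b0 : 0 < b) (T U : Type) (Z : nat -> T -> U) (xi : U -> R).
Variable y : R.

Local Notation X := (chain (reflect_step xi) Z y).
Local Notation Xs := (chain (soft_step b xi) Z y).

Lemma le_reflect_soft n w : X n w <= Xs n w.
Proof.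
elim: n => //= n ih; rewrite /reflect_step /soft_step/= ge_max; apply/andP; split.
  rewrite ler_pdivlMr// mulrC -ler_expR lnK; last first.
    by rewrite posrE addr_gt0// expR_gt0.
  by rewrite ler_wpDl// ler_expR ler_pM2l// lerD2r.
by apply: divr_ge0; [rewrite ln_ge0// lerDl expR_ge0|exact: ltW].
Qed.

(** After exponentiation the soft maximum of z and 0 is a sum 1 + exp (b z) in place of a maximum.
    As 1 <= exp (b X), every step adds at most one more multiple of exp (b X), hence the factor n +
    1. *)
Lemma soft_le_reflect n w : Xs n w <= X n w + ln n.+1%:R / b.
Proof.
suff h : expR (b * Xs n w) <= n.+1%:R * expR (b * X n w).
  rewrite -(ler_pM2l b0) mulrDr mulrCA divff ?gt_eqF// mulr1.
  by rewrite -ler_expR expRD lnK ?posrE// [leRHS]mulrC.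
elim: n => [|n ih] /=; first by rewrite mul1r.
rewrite /reflect_step /soft_step/= mulrCA divff ?gt_eqF// mulr1.
rewrite lnK; last by rewrite posrE addr_gt0// expR_gt0.
rewrite -[n.+2%:R]nat1r mulrDl mul1r; apply: lerD.
  by rewrite -[leLHS]expR0 ler_expR mulr_ge0 ?le_max ?lexx ?orbT// ltW.
rewrite mulrDr expRD; apply: le_trans (ler_wpM2r (expR_ge0 _) ih) _.
by rewrite -mulrA -expRD -mulrDr ler_pM2l// ler_expR ler_pM2l// le_max lexx.
Qed.

Lemma soft_reflect_dist n w : `|Xs n w - X n w| <= ln n.+1%:R / b.
Proof.
rewrite ger0_norm ?subr_ge0 ?le_reflect_soft//.
by rewrite lerBlDl soft_le_reflect.
Qed.

End soft_vs_hard.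

Lemma Rintegral_dist d (T : measurableType d) (R : realType) (P : probability T R)
    (f g : T -> R) (e : R) : bmf f -> bmf g -> (forall w, `|f w - g w| <= e) ->
  `|\int[P]_w f w - \int[P]_w g w| <= e.
Proof.
move=> bf bg fg; rewrite -RintegralB//; [|exact: bmf_integrable..].
by apply: le_norm_prob_Rintegral => //; case: bf bg => mf _ [mg _]; exact: measurable_funB.
Qed.

(** * Smooth test functions *)

Section positive_part_power.
Context (R : realType).
Implicit Types u v : R.

Definition pospow (k : nat) (u : R) : R := Num.max u 0 ^+ k.

Lemma pospow_ge0 k u : 0 <= pospow k u.
Proof. by rewrite exprn_ge0// le_max lexx orbT. Qed.

Lemma pospow_le0 k u : u <= 0 -> pospow k.+1 u = 0.
Proof. by move=> u0; rewrite /pospow (max_idPr u0) expr0n. Qed.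

Lemma pospow_pos k u : 0 <= u -> pospow k u = u ^+ k.
Proof. by move=> u0; rewrite /pospow (max_idPl u0). Qed.

Lemma pospow_le1 k u : u <= 1 -> pospow k u <= 1.
Proof.
by move=> u1; rewrite exprn_ile1// ?ge_max ?u1 ?ler01// le_max lexx orbT.
Qed.

Lemma pospow_le k : {homo pospow k : u v / u <= v}.
Proof.
move=> u v uv; apply: lerXn2r; rewrite ?nnegrE.
- by rewrite le_max lexx orbT.
- by rewrite le_max lexx orbT.
- by rewrite ge_max !le_max uv lexx orbT.
Qed.

(** From exponent 2 on, the difference quotient at the kink is h^(k+1) or 0, and tends to 0. *)
Lemma is_derive_pospow k u :
  is_derive u 1 (pospow k.+2) (k.+2%:R * pospow k.+1 u).
Proof.
have [u0|u0|->] := ltgtP u 0.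
- rewrite pospow_le0 ?ltW// mulr0.
  apply: (@near_eq_is_derive _ _ _ (cst 0)).
  near=> v; rewrite /= pospow_le0//.
  by near: v; exact: lt_le_nbhsl.
- rewrite pospow_pos ?ltW//.
  have dX : is_derive u 1 ((id : R -> R) ^+ k.+2) ((k.+2%:R * u ^+ k.+1) *: 1).
    exact: is_deriveX.
  rewrite /GRing.scale/= mulr1 in dX; apply: near_eq_is_derive dX.
  near=> v; rewrite pospow_pos; first by rewrite exprfctE.
  by apply: ltW; near: v; apply: (cvgr_gt u).
- have dq : h^-1 *: (pospow k.+2 (h *: 1 + 0) - pospow k.+2 0) @[h --> (0:R)^'] --> (0 : R).
    apply/cvgrPdist_le => e e0; near=> h.
    rewrite sub0r normrN (pospow_le0 k.+1 (lexx 0)) subr0 addr0 /GRing.scale/= mulr1.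
    have h0 : h != 0 by near: h; exact: nbhs_dnbhs_neq.
    have he : `|h| <= e by near: h; exact: dnbhs0_le.
    have h1 : `|h| <= 1 by near: h; exact: dnbhs0_le.
    have [hn|hp] := leP h 0; first by rewrite pospow_le0// mulr0 normr0 ltW.
    rewrite pospow_pos; last exact: ltW.
    rewrite exprS mulrA mulVf// mul1r normrX.
    by apply: le_trans he; rewrite exprS ler_piMr// exprn_ile1.
  apply: DeriveDef; first by apply/cvg_ex; exists 0.
  by rewrite (pospow_le0 k (lexx 0)) mulr0; apply/cvg_lim.
Unshelve. all: by end_near. Qed.

End positive_part_power.

Section smooth_tests.
Context (R : realType).

(** A single bound for all orders keeps the later error terms proportional to [M]. Boundedness of
    the third derivative is enough for a Taylor remainder obtained from the mean value theorem. *)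
Definition smooth_test (f : R -> R) := exists f1 f2 f3 M,
  [/\ forall x : R, is_derive x 1 f (f1 x),
      forall x : R, is_derive x 1 f1 (f2 x),
      forall x : R, is_derive x 1 f2 (f3 x) &
      forall x, [/\ `|f x| <= M, `|f1 x| <= M, `|f2 x| <= M & `|f3 x| <= M]].

Lemma smooth_test_cst c : smooth_test (cst c).
Proof.
exists (cst 0), (cst 0), (cst 0), `|c|.
by split=> *; first [exact: is_derive_cst|rewrite normr0].
Qed.

Lemma smooth_testD f g : smooth_test f -> smooth_test g ->
  smooth_test (fun x => f x + g x).
Proof.
move=> [f1 [f2 [f3 [M [df df1 df2 fM]]]]] [g1 [g2 [g3 [N [dg dg1 dg2 gN]]]]].
exists (fun x => f1 x + g1 x), (fun x => f2 x + g2 x), (fun x => f3 x + g3 x), (M + N).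
split=> x; [exact: is_deriveD|exact: is_deriveD|exact: is_deriveD|].
have [? ? ? ?] := fM x; have [? ? ? ?] := gN x.
by split; apply: (le_trans (ler_normD _ _)); apply: lerD.
Qed.

Lemma smooth_testZ c f : smooth_test f -> smooth_test (fun x => c * f x).
Proof.
move=> [f1 [f2 [f3 [M [df df1 df2 fM]]]]].
exists (fun x => c * f1 x), (fun x => c * f2 x), (fun x => c * f3 x), (`|c| * M).
split=> x; [exact: is_deriveZ|exact: is_deriveZ|exact: is_deriveZ|].
by have [? ? ? ?] := fM x; split; rewrite normrM ler_wpM2l.
Qed.

Lemma smooth_test_sum (I : Type) (s : seq I) (F : I -> R -> R) :
  (forall i, smooth_test (F i)) -> smooth_test (fun x => \sum_(i <- s) F i x).
Proof.
move=> sF; elim: s => [|i s ih].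
  rewrite (_ : (fun _ => _) = cst 0); first exact: smooth_test_cst.
  by apply/funext => x; rewrite big_nil.
rewrite (_ : (fun _ => _) = (fun x => F i x + \sum_(j <- s) F j x)).
  exact: smooth_testD.
by apply/funext => x; rewrite big_cons.
Qed.

Lemma smooth_test_affine a c f : smooth_test f -> smooth_test (fun x => f (a * x + c)).
Proof.
move=> [f1 [f2 [f3 [M [df df1 df2 fM]]]]].
have daff (h h1 : R -> R) : (forall x : R, is_derive x 1 h (h1 x)) ->
    forall x : R, is_derive x 1 (fun y => h (a * y + c)) (a * h1 (a * x + c)).
  move=> dh x.
  have dl : is_derive x 1 (fun y => a * y + c) a.
    by apply: is_derive_eq; rewrite /GRing.scale/=; ring.
  rewrite mulrC.
  exact: (@is_derive1_comp _ h (fun y => a * y + c) _ _ _ (dh _) dl).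
exists (fun x => a * f1 (a * x + c)), (fun x => a * (a * f2 (a * x + c))),
  (fun x => a * (a * (a * f3 (a * x + c)))), (M * (1 + `|a| + `|a| ^+ 2 + `|a| ^+ 3)).
split=> x; [exact: daff|exact: (is_deriveZ _ (daff _ _ df1 x))|
  exact: (is_deriveZ _ (is_deriveZ _ (daff _ _ df2 x)))|].
have [fx f1x f2x f3x] := fM (a * x + c).
have M0 : 0 <= M by exact: le_trans fx.
have a0 := normr_ge0 a.
have a2 : 0 <= `|a| ^+ 2 by exact: exprn_ge0.
have a3 : 0 <= `|a| ^+ 3 by exact: exprn_ge0.
rewrite !normrM; split.
- by apply: le_trans fx _; nra.
- by apply: le_trans (ler_wpM2l a0 f1x) _; nra.
- by apply: le_trans (ler_wpM2l a0 (ler_wpM2l a0 f2x)) _; nra.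
- by apply: le_trans (ler_wpM2l a0 (ler_wpM2l a0 (ler_wpM2l a0 f3x))) _; nra.
Qed.

(** A step from 0 to 1 glued by fourth powers at both ends: the inner power is flat at 0 and the
    outer one flattens the joint at 1, so that three derivatives exist and stay bounded. *)
Definition smoothstep (u : R) : R := 1 - pospow 4 (1 - pospow 4 u).

Lemma smoothstep_le0 u : u <= 0 -> smoothstep u = 0.
Proof.
by move=> u0; rewrite /smoothstep (pospow_le0 _ u0) subr0 pospow_pos// expr1n subrr.
Qed.

Lemma smoothstep_ge1 u : 1 <= u -> smoothstep u = 1.
Proof.
move=> u1; rewrite /smoothstep (pospow_le0 3) ?subr0// subr_le0.
by rewrite pospow_pos ?(le_trans ler01)// exprn_ege1.
Qed.

Lemma smoothstep_le : {homo smoothstep : u v / u <= v}.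
Proof.
by move=> u v uv; rewrite /smoothstep lerB// pospow_le// lerB// pospow_le.
Qed.

Lemma smooth_test_smoothstep : smooth_test smoothstep.
Proof.
pose v u : R := 1 - pospow 4 u.
have dpow := @is_derive_pospow R.
have dv (u : R) : is_derive u 1 v (- (4 * pospow 3 u)).
  rewrite /v; have := dpow 2%N u => h; apply: is_derive_eq.
  by rewrite /GRing.scale/=; ring.
have dpv k (u : R) : is_derive u 1 (fun y => pospow k.+2 (v y))
    (k.+2%:R * pospow k.+1 (v u) * (- (4 * pospow 3 u))).
  exact: (@is_derive1_comp _ (pospow k.+2) v _ _ _ (dpow k _) (dv u)).
pose s1 u := 16 * (pospow 3 (v u) * pospow 3 u).
pose s2 u := 48 * (pospow 3 (v u) * pospow 2 u) - 192 * (pospow 2 (v u) * pospow 3 u ^+ 2).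
pose s3 u := 96 * (pospow 3 (v u) * pospow 1 u)
  - 576 * (pospow 2 (v u) * pospow 3 u * pospow 2 u)
  - 1152 * (pospow 2 (v u) * (pospow 3 u * pospow 2 u))
  + 1536 * (pospow 1 (v u) * pospow 3 u ^+ 3).
(* The coefficients of [s3] add up to 3360 in absolute value, those of [s2] to 240. *)
exists s1, s2, s3, 4000; split=> u.
- rewrite /smoothstep /s1; have := dpv 2%N u => h; apply: is_derive_eq.
  by rewrite /GRing.scale/=; ring.
- rewrite /s1 /s2; have := dpv 1%N u; have := dpow 1%N u => h1 h2.
  apply: is_derive_eq; rewrite /GRing.scale/=; ring.
- rewrite /s2 /s3; have := dpv 1%N u; have := dpv 0%N u; have := dpow 0%N u.
  have := dpow 1%N u => h1 h2 h3 h4.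
  apply: is_derive_eq; rewrite /GRing.scale/=; ring.
(* Beyond 1 the positive part of [v u] is 0 and all derivatives vanish; up to 1 every factor lies in
   [0, 1]. *)
have [u1|u1] := leP u 1; last first.
  have v0 : v u <= 0 by rewrite subr_le0 pospow_pos ?exprn_ege1 ?ltW// (lt_trans ltr01).
  have [[e1 e2] e3] := (pospow_le0 0 v0, pospow_le0 1 v0, pospow_le0 2 v0).
  rewrite (smoothstep_ge1 (ltW u1)) /s1 /s2 /s3 e1 e2 e3 !(mul0r, mulr0, subr0, addr0).
  by rewrite normr0 normr1; split; lra.
have v1 : v u <= 1 by rewrite gerBl pospow_ge0.
have [a0 a1] := (pospow_ge0 1 u, pospow_le1 1 u1).
have [b0 b1] := (pospow_ge0 2 u, pospow_le1 2 u1).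
have [c0 c1] := (pospow_ge0 3 u, pospow_le1 3 u1).
have [d0 d1] := (pospow_ge0 1 (v u), pospow_le1 1 v1).
have [e0 e1] := (pospow_ge0 2 (v u), pospow_le1 2 v1).
have [f0 f1] := (pospow_ge0 3 (v u), pospow_le1 3 v1).
have mle (y z : R) : 0 <= y <= 1 -> 0 <= z <= 1 -> 0 <= y * z <= 1.
  by move=> /andP[y0 y1] /andP[z0 z1]; rewrite mulr_ge0//= mulr_ile1.
have A : 0 <= pospow 1 u <= 1 by rewrite a0.
have B : 0 <= pospow 2 u <= 1 by rewrite b0.
have CC : 0 <= pospow 3 u <= 1 by rewrite c0.
have D : 0 <= pospow 1 (v u) <= 1 by rewrite d0.
have E : 0 <= pospow 2 (v u) <= 1 by rewrite e0.
have F : 0 <= pospow 3 (v u) <= 1 by rewrite f0.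
have C2 : 0 <= pospow 3 u ^+ 2 <= 1 by rewrite expr2 mle.
have C3 : 0 <= pospow 3 u ^+ 3 <= 1 by rewrite exprS mle.
split.
- have [? ?] := (pospow_ge0 4 (v u), pospow_le1 4 v1).
  by rewrite /smoothstep ler_norml; apply/andP; split; rewrite -/(v u); lra.
- have /andP[? ?] := mle _ _ F CC.
  by rewrite /s1 ler_norml; apply/andP; split; lra.
- have /andP[? ?] := mle _ _ F B; have /andP[? ?] := mle _ _ E C2.
  by rewrite /s2 ler_norml; apply/andP; split; lra.
- have /andP[? ?] := mle _ _ F A; have /andP[? ?] := mle _ _ (mle _ _ E CC) B.
  have /andP[? ?] := mle _ _ E (mle _ _ CC B); have /andP[? ?] := mle _ _ D C3.
  by rewrite /s3 ler_norml; apply/andP; split; lra.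
Qed.

End smooth_tests.

Lemma bounded_convergence d (T : measurableType d) (R : realType) (P : probability T R)
    (g : nat -> T -> R) (g0 : T -> R) (M : R) :
  (forall n, measurable_fun [set: T] (g n)) -> (forall n w, `|g n w| <= M) ->
  (forall w, g n w @[n --> \oo] --> g0 w) ->
  measurable_fun [set: T] g0 /\
  \int[P]_w g n w @[n --> \oo] --> \int[P]_w g0 w.
Proof.
move=> mg gM gg0.
have mg0 : measurable_fun [set: T] g0.
  by apply: (measurable_fun_cvg mg) => w _; exact: gg0.
split=> //.
have ge w : (g n w)%:E @[n --> \oo] --> (g0 w)%:E.
  by apply: cvg_EFin; [exact: nearW|exact: gg0].
have [_ _] := @dominated_convergence _ _ _ P _ measurableT
  (fun n w => (g n w)%:E) (fun w => (g0 w)%:E) (EFin \o cst M)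
  (fun n => (measurable_EFinP _ _).2 (mg n)) ((measurable_EFinP _ _).2 mg0)
  (aeW P (fun w _ => ge w)) (prob_integrable_cst P M)
  (aeW P (fun w n _ => gM n w)).
move=> h; apply: fine_cvg.
rewrite fineK; first exact: h.
apply: integrable_fin_num => //; apply: bmf_integrable.
split=> //; exists M => w.
apply: (cvgr_to_le (cvg_norm (gg0 w))); exact: nearW.
Qed.

Section lower_approximation.
Context (R : realType) (f : R -> R).
Hypotheses (cf : continuous f) (f0 : forall y, 0 <= f y).

(** Bump [i] is centred at (i - K) / (m + 1) and lives where [shift] is at most 1 in absolute value.
    With K = (m + 1)^2 the centres start at - (m + 1) and stop just below m + 1, which leaves a
    margin around [- m, m]. *)
Let K (m : nat) : nat := (m.+1 * m.+1)%N.
Let mesh (m : nat) : R := m.+1%:R.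
Let shift m (i : nat) (y : R) : R := mesh m * y + ((K m)%:R - i%:R).
Let bump m i y := smoothstep (shift m i y + 1) - smoothstep (shift m i y).
Let low m i : R := inf [set f z | z in [set z | `|shift m i z| <= 1]].

(* The bumps form a partition of unity on [-m, m] with mesh 1/(m+1); as [low]
   is the infimum of f over the support of the bump, the sum stays below f. *)
Definition lower_smooth m y := \sum_(i < (K m).*2) low m i * bump m i y.

Let bump_ge0 m i y : 0 <= bump m i y.
Proof. by rewrite subr_ge0 smoothstep_le// lerDl. Qed.

Let bump_eq0 m i y : 1 < `|shift m i y| -> bump m i y = 0.
Proof.
rewrite /bump lter_normr => /orP[h|h].
  by rewrite !smoothstep_ge1 ?subrr//; lra.
by rewrite !smoothstep_le0 ?subrr//; lra.
Qed.

(** Since [shift] drops by 1 from [i] to [i + 1], the bumps are consecutive differences of one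
    sequence and their sum telescopes. *)
Let sum_bump m y : \sum_(i < (K m).*2) bump m i y =
  smoothstep (mesh m * y + (K m)%:R + 1) -
  smoothstep (mesh m * y + (K m)%:R - (K m).*2%:R + 1).
Proof.
rewrite /bump /shift; move: (mesh m * y) (K m) => c k.
elim: (k.*2) => [|n ih]; first by rewrite big_ord0 subr0 subrr.
rewrite big_ord_recr/= ih -natr1.
rewrite (_ : c + (k%:R - n%:R) = c + k%:R - (n%:R + 1) + 1); last by ring.
rewrite (_ : c + k%:R - n%:R + 1 = c + k%:R - (n%:R + 1) + 1 + 1); last by ring.
ring.
Qed.

Let smoothstep01 (u : R) : 0 <= smoothstep u <= 1.
Proof.
apply/andP; split.
  have [u0|u0] := leP u 0; first by rewrite smoothstep_le0.
  by rewrite -(smoothstep_le0 (lexx 0)) smoothstep_le// ltW.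
have [u1|u1] := leP u 1; last by rewrite smoothstep_ge1// ltW.
by rewrite -(smoothstep_ge1 (lexx 1)) smoothstep_le.
Qed.

Let sum_bump_le1 m y : \sum_(i < (K m).*2) bump m i y <= 1.
Proof.
rewrite sum_bump; set u := (X in smoothstep X - _); set v := (X in _ - smoothstep X).
have /andP[_ u1] := smoothstep01 u; have /andP[v0 _] := smoothstep01 v; lra.
Qed.

Let sum_bump1 m y : `|y| <= m%:R -> \sum_(i < (K m).*2) bump m i y = 1.
Proof.
rewrite ler_norml => /andP[y1 y2]; rewrite sum_bump /mesh -natr1.
have m0 : 0 <= m%:R :> R by [].
rewrite smoothstep_ge1; last by rewrite /K natrM -natr1; nra.
by rewrite smoothstep_le0 ?subr0// -addnn natrD /K natrM -natr1; nra.
Qed.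

Let low_le m i z : `|shift m i z| <= 1 -> low m i <= f z.
Proof.
move=> hz; apply: ge_inf; last by exists z.
by exists 0 => _ [y _ <-].
Qed.

Let low_ge m i e : (forall z, `|shift m i z| <= 1 -> e <= f z) -> e <= low m i.
Proof.
move=> he; apply: lb_le_inf; last by move=> _ [z hz <-]; exact: he.
(* The centre of the bump shows that the infimum is over a nonempty set, on which [inf] is not a
   default value. *)
exists (f (- ((K m)%:R - i%:R) / mesh m)); exists (- ((K m)%:R - i%:R) / mesh m) => //=.
rewrite /shift mulrC divfK; last by rewrite pnatr_eq0.
by rewrite addNr normr0.
Qed.

Lemma lower_smooth_ge0 m y : 0 <= lower_smooth m y.
Proof.
apply: sumr_ge0 => i _; rewrite mulr_ge0//.
by apply: low_ge => z _.
Qed.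

Lemma lower_smooth_le m y : lower_smooth m y <= f y.
Proof.
apply: (@le_trans _ _ (\sum_(i < (K m).*2) f y * bump m i y)).
  apply: ler_sum => i _; have [h|h] := leP `|shift m i y| 1.
    by rewrite ler_wpM2r// low_le.
  by rewrite bump_eq0// !mulr0.
by rewrite -mulr_sumr ler_piMr.
Qed.

Lemma smooth_test_lower_smooth m : smooth_test (lower_smooth m).
Proof.
apply: smooth_test_sum => i; apply: smooth_testZ.
rewrite (_ : bump m i = fun y =>
    smoothstep (mesh m * y + ((K m)%:R - i%:R + 1)) +
    (-1) * smoothstep (mesh m * y + ((K m)%:R - i%:R))).
  apply: smooth_testD; first exact: (smooth_test_affine _ _ (smooth_test_smoothstep R)).
  by apply: smooth_testZ; exact: (smooth_test_affine _ _ (smooth_test_smoothstep R)).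
by apply/funext => y; rewrite /bump /shift mulN1r -(addrA (mesh m * y)).
Qed.

Lemma cvg_lower_smooth y : lower_smooth m y @[m --> \oo] --> f y.
Proof.
apply/cvgrPdist_le => e e0.
have cfy : f z @[z --> y] --> f y by exact: cf.
have /cvgrPdist_le/(_ _ e0)[eta /= eta0 heta] := cfy.
near=> m.
have my : `|y| <= m%:R by near: m; exact: nbhs_infty_ger.
(* Two points in the support of one bump are at distance at most 2 / (m + 1), hence less than
   [eta]. *)
have meta : 2 / eta < m%:R by near: m; exact: nbhs_infty_gtr.
rewrite ger0_norm; last by rewrite subr_ge0 lower_smooth_le.
rewrite lerBlDr -lerBlDl -[leLHS]mulr1 -(sum_bump1 my) mulr_sumr.
apply: ler_sum => i _; have [h|h] := leP `|shift m i y| 1; last first.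
  by rewrite bump_eq0// !mulr0.
rewrite ler_wpM2r//; apply: low_ge => z hz.
have : `|f y - f z| <= e.
  apply: heta => /=.
  have -> : y - z = (shift m i y - shift m i z) / mesh m.
    by rewrite /shift; field; rewrite nat1r pnatr_eq0.
  rewrite normrM normfV (@ger0_norm _ (mesh m)) ?ler0n// ltr_pdivrMr ?ltr0n//.
  apply: le_lt_trans (ler_normB _ _) _; apply: le_lt_trans (lerD h hz) _.
  by move: meta; rewrite ltr_pdivrMr// /mesh -natr1 => meta; nra.
by rewrite ler_norml => /andP[_]; rewrite lerBlDr -lerBlDl; lra.
Unshelve. all: by end_near. Qed.

End lower_approximation.

(** * From smooth test functions to weak convergence *)

Section weak_convergence.
Context (R : realType) (d : nat -> measure_display) (T : forall k, measurableType (d k))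
  (P : forall k, probability (T k) R) (X : forall k, T k -> R).
Hypothesis mX : forall k, measurable_fun [set: T k] (@X k).
Context dQ (TQ : measurableType dQ) (Q : probability TQ R) (Y : TQ -> R).
Hypothesis mY : measurable_fun [set: TQ] Y.
Hypothesis cvg_smooth : forall f : R -> R, smooth_test f ->
  \int[P k]_w f (X w) @[k --> \oo] --> \int[Q]_w f (Y w).

Let bmf_comp d' (T' : measurableType d') (Z : T' -> R) (f : R -> R) :
  measurable_fun [set: T'] Z -> bmf f -> bmf (fun w => f (Z w)).
Proof. by move=> mZ [mf [M fM]]; split; [exact: measurableT_comp|exists M => w]. Qed.

Let bmf_smooth (f : R -> R) : smooth_test f -> bmf f.
Proof.
move=> [f1 [f2 [f3 [M [df _ _ fM]]]]]; split; last by exists M => x; have [] := fM x.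
apply: continuous_measurable_fun => x.
by apply: differentiable_continuous; apply/derivable1_diffP; exact: ex_derive.
Qed.

(** One-sided approximation replaces a tightness argument: the level [m] is fixed under the limit
    law alone, and far out the values of [f] along [X k] are simply bounded below by 0. *)
Let liminf_ge (f : R -> R) (C : R) : continuous f -> (forall y, 0 <= f y <= C) ->
  forall e, 0 < e -> \forall k \near \oo,
    \int[Q]_w f (Y w) - e <= \int[P k]_w f (X w).
Proof.
move=> cf fC e e0.
have f0 y : 0 <= f y by have /andP[] := fC y.
have fC' y : f y <= C by have /andP[] := fC y.
have bf : bmf f.
  split; first exact: continuous_measurable_fun.
  by exists C => y; rewrite ger0_norm.
have e20 : 0 < e / 2 by rewrite divr_gt0.
pose g m := lower_smooth f m.
have gC m w : `|g m (Y w)| <= C.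
  rewrite ger0_norm ?lower_smooth_ge0// (le_trans _ (fC' (Y w)))//.
  exact: lower_smooth_le.
have [_ /cvgrPdist_le/(_ _ e20)] := @bounded_convergence _ _ _ Q
  (fun m w => g m (Y w)) (fun w => f (Y w)) C
  (fun m => (bmf_comp mY (bmf_smooth (smooth_test_lower_smooth f m))).1)
  gC (fun w => @cvg_lower_smooth _ _ cf f0 (Y w)).
move=> [] m _ /(_ m (leqnn m)) hm.
have /cvgrPdist_le/(_ _ e20) := cvg_smooth (smooth_test_lower_smooth f m).
apply: filterS => k hk.
have : \int[P k]_w g m (X w) <= \int[P k]_w f (X w).
  apply: le_Rintegral => //.
  - apply: bmf_integrable; apply: bmf_comp => //.
    exact: bmf_smooth (smooth_test_lower_smooth f m).
  - by apply: bmf_integrable; exact: bmf_comp.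
  - by move=> w _; exact: lower_smooth_le.
move: hm hk; rewrite !ler_norml => /andP[_ h1] /andP[_ h2]; lra.
Qed.

(* If |f| <= C, lower approximations of C + f and of C - f bound the liminf and the
   limsup. *)
Lemma weak_cvg_of_smooth (f : R -> R) : continuous f -> bounded_fun f ->
  \int[P k]_w f (X w) @[k --> \oo] --> \int[Q]_w f (Y w).
Proof.
move=> cf [C0 [_ hC]]; have [C fC] : exists C, forall y, `|f y| <= C.
  by exists (`|C0| + 1) => y; apply: hC => //; rewrite ltr_pwDr// ler_norm.
have bf : bmf f by split; [exact: continuous_measurable_fun|exists C].
have bX k : (P k).-integrable [set: T k] (EFin \o (fun w => f (X w))).
  by apply: bmf_integrable; exact: bmf_comp.
have bY : Q.-integrable [set: TQ] (EFin \o (fun w => f (Y w))).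
  by apply: bmf_integrable; exact: bmf_comp.
apply/cvgrPdist_le => e e0.
have lo := @liminf_ge (fun y => C + f y) (C + C) _ _ e e0.
have hi := @liminf_ge (fun y => C - f y) (C + C) _ _ e e0.
have {}lo : \forall k \near \oo, \int[Q]_w f (Y w) - e <= \int[P k]_w f (X w).
  apply: filterS (lo _ _).
  - move=> k; rewrite !RintegralD ?prob_Rintegral_cst//; last 2 first.
    + exact: prob_integrable_cst.
    + exact: prob_integrable_cst.
    by lra.
  - by move=> y; apply: cvgD; [exact: cvg_cst|exact: cf].
  - by move=> y; have := fC y; rewrite ler_norml => /andP[? ?]; apply/andP; split; lra.
have {}hi : \forall k \near \oo, \int[P k]_w f (X w) <= \int[Q]_w f (Y w) + e.
  apply: filterS (hi _ _).
  - move=> k; rewrite !RintegralB ?prob_Rintegral_cst//; last 2 first.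
    + exact: prob_integrable_cst.
    + exact: prob_integrable_cst.
    by lra.
  - by move=> y; apply: cvgB; [exact: cvg_cst|exact: cf].
  - by move=> y; have := fC y; rewrite ler_norml => /andP[? ?]; apply/andP; split; lra.
apply: filterS2 lo hi => k lo hi.
by rewrite ler_norml; apply/andP; split; lra.
Qed.

End weak_convergence.

(** * Normal and mixed Poisson moments *)

Section normal_integrals.
Context (R : realType) (s : R).
Local Notation mu := (@lebesgue_measure R).
Local Notation nu := (normal_prob 0 s).

(** The Radon-Nikodym derivative agrees almost everywhere with the explicit density. The nonnegative
    version is what shows that moments are finite; the integrable one below computes signed
    integrals. *)
Lemma ge0_integral_normal_prob (f : R -> \bar R) :
  measurable_fun [set: R] f -> (forall x, 0 <= f x)%E ->
  (\int[nu]_x f x = \int[mu]_x (f x * (normal_pdf 0 s x)%:E))%E.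
Proof.
move=> mf f0; have dom := normal_prob_dominates 0 s.
rewrite -(Radon_Nikodym_SigmaFinite.change_of_variables dom f0 measurableT mf).
have iRN := Radon_Nikodym_SigmaFinite.f_integrable dom.
apply: ae_eq_integral => //.
- by apply: emeasurable_funM => //; exact: (measurable_int mu).
- apply: emeasurable_funM => //; apply/measurable_EFinP.
  exact: measurable_normal_pdf.
apply: ae_eqe_mul2l; apply: integral_ae_eq => //.
- by apply/measurable_EFinP; exact: measurable_normal_pdf.
- by move=> E _ mE; rewrite -Radon_Nikodym_SigmaFinite.f_integral.
Qed.

Lemma integral_normal_prob (f : R -> \bar R) : nu.-integrable [set: R] f ->
  (\int[nu]_x f x = \int[mu]_x (f x * (normal_pdf 0 s x)%:E))%E.
Proof.
move=> intf; have dom := normal_prob_dominates 0 s.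
have mf : measurable_fun [set: R] f by exact: measurable_int intf.
rewrite -(Radon_Nikodym_change_of_variables dom)//.
apply: ae_eq_integral => //.
- by apply: emeasurable_funM => //; apply: (measurable_int mu); exact: Radon_Nikodym_integrable.
- apply: emeasurable_funM => //; apply/measurable_EFinP.
  exact: measurable_normal_pdf.
apply: ae_eqe_mul2l; apply: integral_ae_eq => //.
- exact: Radon_Nikodym_integrable.
- by apply/measurable_EFinP; exact: measurable_normal_pdf.
- by move=> E _ mE; rewrite -Radon_Nikodym_integral.
Qed.

End normal_integrals.

(** exp (u^2 / 4) >= (1 + u^2 / 8)^2 >= u^2 / 4 + u^4 / 64, while u^3 <= (u^2 + u^4) / 2, so any
    factor from 32 on works. *)
Lemma cube_le_expR (R : realType) (u : R) : 0 <= u -> u ^+ 3 <= 33 * expR (u ^+ 2 / 4).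
Proof.
move=> u0; have y0 : 0 <= u ^+ 2 / 8 by rewrite divr_ge0// sqr_ge0.
have h : 1 + u ^+ 2 / 8 <= expR (u ^+ 2 / 8) by exact: expR_ge1Dx.
have -> : u ^+ 2 / 4 = u ^+ 2 / 8 + u ^+ 2 / 8 by field.
rewrite expRD; set e := expR _ in h *.
apply: (@le_trans _ _ (33 * ((1 + u ^+ 2 / 8) * (1 + u ^+ 2 / 8)))).
  have := sqr_ge0 (u - 1); have := sqr_ge0 (u ^+ 2 - u); nra.
rewrite ler_pM2l// ler_pM//; lra.
Qed.

Section normal_moments.
Context (R : realType) (s : R) (s0 : 0 < s).
Local Notation mu := (@lebesgue_measure R).
Local Notation nu := (normal_prob 0 s).
Local Notation pdf := (normal_pdf 0 s).

Let sn0 : s != 0. Proof. by rewrite gt_eqF. Qed.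

Let s2n0 : Num.sqrt 2 * s != 0 :> R.
Proof. by rewrite mulf_neq0// gt_eqF// sqrtr_gt0. Qed.

(* |x|^3 is absorbed by doubling the variance. *)
Let pdf_widen x : pdf x * (`|x| ^+ 3) <= 66 * s ^+ 3 * normal_pdf 0 (Num.sqrt 2 * s) x.
Proof.
rewrite !normal_pdfE// /normal_peak /normal_fun subr0.
have -> : (Num.sqrt 2 * s) ^+ 2 = 2 * s ^+ 2 by rewrite exprMn sqr_sqrtr.
have -> : Num.sqrt (2 * s ^+ 2 * pi *+ 2) = Num.sqrt 2 * Num.sqrt (s ^+ 2 * pi *+ 2).
  by rewrite -mulrnAr -mulrA sqrtrM// mulrnAr.
have p0 : 0 < Num.sqrt (s ^+ 2 * pi *+ 2) :> R.
  by rewrite sqrtr_gt0 mulrn_wgt0// mulr_gt0 ?pi_gt0// exprn_gt0.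
set p := Num.sqrt (s ^+ 2 * pi *+ 2) in p0 *.
have r0 : 0 < Num.sqrt 2 :> R by rewrite sqrtr_gt0.
(* The ratio of the two normalisations is the square root of 2; bounding it by 2 turns 33 into
   66. *)
have r2 : Num.sqrt 2 <= 2 :> R.
  by rewrite -[leRHS]ger0_norm// -sqrtr_sqr ler_wsqrtr// expr2; lra.
set r := Num.sqrt 2 in r0 r2 *.
have e1 : - x ^+ 2 / (s ^+ 2 *+ 2) = - ((`|x| / s) ^+ 2 / 4 + (`|x| / s) ^+ 2 / 4).
  by rewrite expr_div_n real_normK ?num_real// -mulr_natl; field.
have e2 : - x ^+ 2 / (2 * s ^+ 2 *+ 2) = - ((`|x| / s) ^+ 2 / 4).
  by rewrite expr_div_n real_normK ?num_real// -mulr_natl; field.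
rewrite e1 e2 (_ : `|x| ^+ 3 = (`|x| / s) ^+ 3 * s ^+ 3); last first.
  by rewrite -exprMn divfK.
set u := `|x| / s.
have u0 : 0 <= u by rewrite divr_ge0// ltW.
have := cube_le_expR u0.
rewrite opprD expRD; set E := expR (- (u ^+ 2 / 4)) => h.
have E0 : 0 < E by exact: expR_gt0.
have h' : u ^+ 3 * E <= 33.
  apply: le_trans (ler_wpM2r (ltW E0) h) _.
  by rewrite -mulrA -expRD subrr expR0 mulr1.
rewrite invfM.
rewrite [leLHS](_ : _ = (p^-1 * E * s ^+ 3) * (u ^+ 3 * E)); last by ring.
rewrite [leRHS](_ : _ = (p^-1 * E * s ^+ 3) * (66 / r)); last by ring.
apply: ler_wpM2l; first by rewrite !mulr_ge0// ?invr_ge0 ?exprn_ge0// ltW.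
by apply: le_trans h' _; rewrite ler_pdivlMr//; lra.
Qed.

Lemma normal_third_moment :
  (\int[nu]_x (`|x| ^+ 3)%:E <= (66 * s ^+ 3)%:E)%E.
Proof.
rewrite ge0_integral_normal_prob; last 2 first.
- by apply/measurable_EFinP; apply: measurable_funX; exact: normr_measurable.
- by move=> x; rewrite lee_fin exprn_ge0.
have c0 : 0 <= 66 * s ^+ 3 by rewrite mulr_ge0// exprn_ge0// ltW.
have mp := measurable_normal_pdf (0 : R).
apply: (@le_trans _ _ (\int[mu]_x ((66 * s ^+ 3)%:E * (normal_pdf 0 (Num.sqrt 2 * s) x)%:E))%E).
  apply: ge0_le_integral => //.
  - by move=> x _; rewrite -EFinM lee_fin mulr_ge0 ?exprn_ge0 ?normal_pdf_ge0.
  - apply/measurable_EFinP; apply: measurable_funM; last exact: mp.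
    by apply: measurable_funX; exact: normr_measurable.
  - by apply/measurable_EFinP; apply: measurable_funM => //; exact: mp.
  - by move=> x _; rewrite -!EFinM lee_fin mulrC pdf_widen.
rewrite ge0_integralZl//; last 2 first.
- by apply/measurable_EFinP; exact: mp.
- by move=> x _; rewrite lee_fin normal_pdf_ge0.
by rewrite integral_normal_pdf mule1.
Qed.

Let int3 : nu.-integrable [set: R] (EFin \o (fun x => 1 + `|x| ^+ 3)).
Proof.
have i3 : nu.-integrable [set: R] (EFin \o (fun x : R => `|x| ^+ 3)).
  apply/integrableP; split.
    by apply/measurable_EFinP; apply: measurable_funX; exact: normr_measurable.
  under eq_integral do rewrite gee0_abs ?lee_fin ?exprn_ge0//.
  exact: le_lt_trans normal_third_moment (ltry _).
have := integrableD measurableT (prob_integrable_cst (normal_prob 0 s) 1) i3.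
exact: eq_integrable.
Qed.

Lemma normal_integrable_id : nu.-integrable [set: R] (EFin \o (fun x : R => x)).
Proof.
apply: le_integrable int3 => //; first exact/measurable_EFinP.
move=> x _ /=; rewrite lee_fin [leRHS]ger0_norm ?addr_ge0 ?exprn_ge0//.
have := normr_ge0 x; set u := `|x| => u0; have := sqr_ge0 (u - 1); nra.
Qed.

Lemma normal_integrable_sqr : nu.-integrable [set: R] (EFin \o (fun x : R => x ^+ 2)).
Proof.
apply: le_integrable int3 => //.
  by apply/measurable_EFinP; exact: measurable_funX.
move=> x _ /=; rewrite lee_fin [leRHS]ger0_norm ?addr_ge0 ?exprn_ge0//.
rewrite normrX; have := normr_ge0 x; set u := `|x| => u0.
have [h|h] := leP u 1; first by rewrite (le_trans (exprn_ile1 _ _ h))// lerDl exprn_ge0.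
by rewrite [u ^+ 3]exprS ler_wpDl// ler_peMl ?exprn_ge0// ltW.
Qed.

Let pdf_expE x : pdf x = normal_peak s * expR (- x ^+ 2 / (s ^+ 2 *+ 2)).
Proof. by rewrite normal_pdfE// /normal_fun subr0. Qed.

Let is_derive_pdf (x : R) : is_derive x 1 pdf (- (x / s ^+ 2) * pdf x).
Proof.
rewrite (_ : pdf = fun y => normal_peak s * expR (- y ^+ 2 / (s ^+ 2 *+ 2))); last first.
  by apply/funext => y; rewrite pdf_expE.
have d1 : is_derive x 1 (fun y : R => - y ^+ 2 / (s ^+ 2 *+ 2)) (- (x / s ^+ 2)).
  rewrite (_ : (fun y => _) = (fun y => - (s ^+ 2 *+ 2)^-1 * (y * y))); last first.
    by apply/funext => y; rewrite expr2 !mulNr mulrC.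
  apply: is_derive_eq; rewrite /GRing.scale/= -mulr_natl; field.
  by rewrite sn0.
have d2 := @is_derive1_comp _ expR (fun y => - y ^+ 2 / (s ^+ 2 *+ 2)) _ _ _ (is_derive_expR _) d1.
have d3 := is_deriveZ (normal_peak s) d2.
apply: (is_derive_eq d3).
by rewrite /GRing.scale/=; ring.
Qed.

(** Mean and variance are read off from total derivatives: x pdf and (x^2 - s^2) pdf are the
    derivatives of - s^2 pdf and - s^2 x pdf. Integrating over [- n - 1, n + 1] leaves boundary
    terms, and dominated convergence gives the integral over the line. *)
Let vanishing_integral (F g : R -> R) : continuous g ->
  (forall x : R, is_derive x 1 F (g x)) -> mu.-integrable [set: R] (EFin \o g) ->
  F n.+1%:R - F (- n.+1%:R) @[n --> \oo] --> (0 : R) ->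
  (\int[mu]_x (g x)%:E = 0)%E.
Proof.
move=> cg dF ig F0.
pose D n := `[- n.+1%:R, n.+1%:R : R]%classic.
have FTC n : (\int[mu]_(x in D n) (g x)%:E = (F n.+1%:R - F (- n.+1%:R))%:E)%E.
  have cF : continuous F.
    by move=> y; apply: differentiable_continuous; apply/derivable1_diffP; exact: ex_derive.
  rewrite /D (@continuous_FTC2 _ g F)// ?EFinB//.
  - by rewrite gtrN// ltr0n.
  - exact: continuous_subspaceT.
  - split.
    + by move=> y _; exact: ex_derive.
    + by apply: cvg_at_right_filter; exact: cF.
    + by apply: cvg_at_left_filter; exact: cF.
  - by move=> y _; rewrite derive1E; exact: derive_val.
have mg : measurable_fun [set: R] (EFin \o g) by exact: measurable_int ig.
have mD n : measurable (D n) by exact: measurable_itv.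
have gcv x : ((EFin \o g) \_ (D n)) x @[n --> \oo] --> (EFin \o g) x.
  apply: cvg_near_cst; near=> n; rewrite patchE mem_set// /D /= in_itv/= -ler_norml.
  apply: (@le_trans _ _ n%:R); last by rewrite ler_nat.
  by near: n; exact: nbhs_infty_ger.
have gle x n : (`|((EFin \o g) \_ (D n)) x| <= (abse \o (EFin \o g)) x)%E.
  by rewrite patchE; case: ifP => //= _; rewrite normr0 lee_fin.
have [_ _] := @dominated_convergence _ _ _ mu _ measurableT
  (fun n x => ((EFin \o g) \_ (D n)) x) (EFin \o g) (abse \o (EFin \o g))
  (fun n => (measurable_restrictT _ (mD n)).1 (measurable_funTS mg)) mg
  (aeW mu (fun x _ => gcv x)) (integrable_abse ig) (aeW mu (fun x n _ => gle x n)).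
under eq_fun do rewrite -integral_mkcond FTC.
move=> h.
have h0 : (F n.+1%:R - F (- n.+1%:R))%:E @[n --> \oo] --> (0%:E : \bar R).
  by apply: cvg_EFin => //; exact: nearW.
exact: cvg_unique h h0.
Unshelve. all: by end_near. Qed.

Let integrable_mul_pdf (f : R -> R) : nu.-integrable [set: R] (EFin \o f) ->
  mu.-integrable [set: R] (EFin \o (fun x => f x * pdf x)).
Proof.
move=> /integrableP[/measurable_EFinP mf ifin]; apply/integrableP; split.
  by apply/measurable_EFinP; apply: measurable_funM => //; exact: measurable_normal_pdf.
move: ifin; rewrite ge0_integral_normal_prob//; last first.
  by apply: measurableT_comp => //; exact/measurable_EFinP.
apply: le_lt_trans; rewrite le_eqVlt; apply/orP; left; apply/eqP.
apply: eq_integral => x _ /=; rewrite normrM EFinM (ger0_norm (normal_pdf_ge0 _ _ _))//.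
Qed.

Lemma normal_mean : \int[nu]_x x = 0.
Proof.
have cg : continuous (fun x : R => x * pdf x).
  by move=> x; apply: cvgM; [exact: cvg_id|exact: continuous_normal_pdf].
have dF (x : R) : is_derive x 1 (fun x => - s ^+ 2 * pdf x) (x * pdf x).
  have := is_derive_pdf x => h; apply: is_derive_eq.
  by rewrite /GRing.scale/=; field.
have ig := integrable_mul_pdf normal_integrable_id.
have F0 : (fun n => - s ^+ 2 * pdf n.+1%:R - (- s ^+ 2 * pdf (- n.+1%:R))) @ \oo --> (0 : R).
  rewrite (_ : (fun n => _) = cst 0); first exact: cvg_cst.
  by apply/funext => n; rewrite /= !pdf_expE sqrrN subrr.
rewrite /Rintegral (integral_normal_prob normal_integrable_id).
under eq_integral do rewrite /= -EFinM.
by rewrite (vanishing_integral cg dF ig F0).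
Qed.

Lemma normal_second_moment : \int[nu]_x x ^+ 2 = s ^+ 2.
Proof.
have cg : continuous (fun x : R => (x ^+ 2 - s ^+ 2) * pdf x).
  move=> x; apply: cvgM; last exact: continuous_normal_pdf.
  by apply: cvgB; [exact: sqr_continuous|exact: cvg_cst].
have dF (x : R) : is_derive x 1 (fun x => - s ^+ 2 * (x * pdf x)) ((x ^+ 2 - s ^+ 2) * pdf x).
  have := is_derive_pdf x => h; apply: is_derive_eq.
  by rewrite /GRing.scale/=; field.
have inu : nu.-integrable [set: R] (EFin \o (fun x : R => x ^+ 2 - s ^+ 2)).
  have := integrableB measurableT normal_integrable_sqr
    (prob_integrable_cst (normal_prob 0 s) (s ^+ 2)).
  exact: eq_integrable.
have ig := integrable_mul_pdf inu.
have F0 : (fun n => - s ^+ 2 * (n.+1%:R * pdf n.+1%:R) -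
    (- s ^+ 2 * (- n.+1%:R * pdf (- n.+1%:R)))) @ \oo --> (0 : R).
  have peak0 := normal_peak_ge0 s.
  (* The boundary term is - 2 s^2 x pdf(x) at x = n + 1, and y exp (- y) <= 1 with y = x^2 / (2 s^2)
     bounds its size by [C / x]. *)
  pose C := 4 * s ^+ 4 * normal_peak s.
  have hC : (fun n : nat => C * n.+1%:R^-1) @ \oo --> (0 : R).
    by rewrite -(mulr0 C); apply: cvgMr; exact: cvg_harmonic.
  have hNC : (fun n : nat => - (C * n.+1%:R^-1)) @ \oo --> (0 : R).
    by rewrite -oppr0; exact: cvgN.
  apply: (squeeze_cvgr _ hNC (@cvg_cst _ (0:R) _ _ _)).
  apply: nearW => n /=; rewrite !pdf_expE sqrrN.
  set x := n.+1%:R; have x0 : 0 < x by rewrite ltr0n.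
  set E := expR _.
  have hE : E * (x ^+ 2 / (s ^+ 2 *+ 2)) <= 1.
    have := expR_ge1Dx (x ^+ 2 / (s ^+ 2 *+ 2)) => h.
    rewrite /E mulNr expRN mulrC ler_pdivrMr ?expR_gt0// mul1r.
    by apply: le_trans h; rewrite lerDr.
  have E0 : 0 <= E by exact: expR_ge0.
  have key : x * E <= 2 * s ^+ 2 / x.
    rewrite ler_pdivlMr// -(ler_pM2r (_ : 0 < (s ^+ 2 *+ 2)^-1)); last first.
      by rewrite invr_gt0 mulrn_wgt0// exprn_gt0.
    rewrite [leRHS](_ : _ = 1); last by rewrite -mulr_natl; field.
    by apply: le_trans hE; rewrite le_eqVlt; apply/orP; left; apply/eqP; ring.
  have s20 : 0 <= s ^+ 2 by exact: sqr_ge0.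
  have ks : (2 * s ^+ 2 * normal_peak s) * (x * E) <=
      (2 * s ^+ 2 * normal_peak s) * (2 * s ^+ 2 / x).
    by apply: ler_wpM2l => //; apply: mulr_ge0 => //; exact: mulr_ge0.
  apply/andP; split.
    rewrite -/x [leRHS](_ : _ = - ((2 * s ^+ 2 * normal_peak s) * (x * E))); last by ring.
    rewrite lerN2; apply: le_trans ks _.
    by rewrite /C le_eqVlt; apply/orP; left; apply/eqP; ring.
  rewrite [leLHS](_ : _ = - ((2 * s ^+ 2 * normal_peak s) * (x * E))); last by ring.
  by rewrite oppr_le0 !mulr_ge0// ltW.
have : \int[nu]_x (x ^+ 2 - s ^+ 2) = 0.
  rewrite /Rintegral (integral_normal_prob inu).
  under eq_integral do rewrite /= -EFinM.
  by rewrite (vanishing_integral cg dF ig F0).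
rewrite RintegralB ?prob_Rintegral_cst//; last 2 first.
- exact: normal_integrable_sqr.
- exact: prob_integrable_cst.
by move/eqP; rewrite subr_eq0 => /eqP.
Qed.

End normal_moments.

Lemma cvg_pow (R : realType) (u : nat -> R) (l : R) (k : nat) :
  u @ \oo --> l -> u n ^+ k @[n --> \oo] --> l ^+ k.
Proof.
move=> ul; elim: k => [|k ih].
  by under eq_fun do rewrite expr0; rewrite expr0; exact: cvg_cst.
by under eq_fun do rewrite exprS; rewrite exprS; exact: cvgM.
Qed.

(** * Poisson weights and their mixtures *)

Section poisson_weights.
Context (R : realType).
Implicit Types lam : R.

(** As 0 ^+ 0 = 1, rate 0 gives the point mass at 0, in agreement with [poisson_prob], and no case
    distinction on the rate remains. *)
Definition poisson_weight lam (k : nat) : R := lam ^+ k / k`!%:R * expR (- lam).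

Lemma poisson_weight_ge0 lam k : 0 <= lam -> 0 <= poisson_weight lam k.
Proof. by move=> l0; rewrite mulr_ge0 ?expR_ge0// divr_ge0// exprn_ge0. Qed.

Lemma poisson_prob_set1 lam k : 0 <= lam ->
  poisson_prob lam 0 [set k] = (poisson_weight lam k)%:E.
Proof.
rewrite le_eqVlt => /predU1P[<-|l0].
  rewrite /poisson_prob ltxx diracE /poisson_weight oppr0 expR0 mulr1.
  case: k => [|k]; first by rewrite mem_set// fact0 expr0 divr1.
  by rewrite memNset//= expr0n mul0r.
rewrite /poisson_prob l0 esum_set1; last by rewrite lee_fin poisson_pmf_ge0.
by rewrite /poisson_pmf l0.
Qed.

(** This index shift reduces the first two moments to the total mass 1. *)
Let weightS lam k : k.+1%:R * poisson_weight lam k.+1 = lam * poisson_weight lam k.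
Proof.
rewrite /poisson_weight factS exprS natrM.
by field; rewrite pnatr_eq0 -lt0n fact_gt0 nat1r pnatr_eq0.
Qed.

Let cvg_weight lam : series (poisson_weight lam) @ \oo --> (1 : R).
Proof.
have -> : series (poisson_weight lam) = (fun n => expR (- lam) * series (exp_coeff lam) n).
  apply/funext => n; rewrite /series/= mulr_sumr; apply: eq_bigr => k _.
  by rewrite /poisson_weight exp_coeffE mulrC (mulrC (lam ^+ k)).
rewrite -[1](mulVf (_ : expR lam != 0)) ?gt_eqF ?expR_gt0// -expRN.
by apply: cvgMr; exact: is_cvg_series_exp_coeff.
Qed.

Let cvg_weight1 lam : series (fun k => k%:R * poisson_weight lam k) @ \oo --> lam.
Proof.
rewrite -cvg_shiftS.
rewrite (_ : (fun n => _) = (fun n => lam * series (poisson_weight lam) n)).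
  have : (fun n => lam * series (poisson_weight lam) n) @ \oo --> lam * 1.
    by apply: cvgMr; exact: cvg_weight.
  by rewrite mulr1.
apply/funext => n; rewrite /series/= big_nat_recl// mul0r add0r mulr_sumr.
by apply: eq_bigr => k _; exact: weightS.
Qed.

Let cvg_weight2 lam : series (fun k => k%:R ^+ 2 * poisson_weight lam k) @ \oo -->
  lam ^+ 2 + lam.
Proof.
rewrite -cvg_shiftS.
rewrite (_ : (fun n => _) = (fun n => lam * (series (fun k => k%:R * poisson_weight lam k) n +
  series (poisson_weight lam) n))).
  have -> : lam ^+ 2 + lam = lam * (lam + 1) by ring.
  by apply: cvgMr; apply: cvgD; [exact: cvg_weight1|exact: cvg_weight].
apply/funext => n; rewrite /series/= big_nat_recl// expr0n mul0r add0r.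
rewrite -big_split/= mulr_sumr.
apply: eq_bigr => k _; rewrite expr2 -mulrA weightS -natr1; ring.
Qed.

Lemma nneseries_cvg (u : nat -> R) (l : R) : series u @ \oo --> l ->
  (\sum_(k <oo) (u k)%:E = l%:E)%E.
Proof.
move=> ul; apply/cvg_lim => //.
rewrite (_ : (fun n => _) = (fun n => (series u n)%:E)); last first.
  by apply/funext => n; rewrite /series/= sumEFin.
by apply: cvg_EFin; [exact: nearW|exact: ul].
Qed.

Lemma poisson_first_moment lam :
  (\sum_(k <oo) (k%:R * poisson_weight lam k)%:E = lam%:E)%E.
Proof. exact/nneseries_cvg/cvg_weight1. Qed.

Lemma poisson_second_moment lam :
  (\sum_(k <oo) (k%:R ^+ 2 * poisson_weight lam k)%:E = (lam ^+ 2 + lam)%:E)%E.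
Proof. exact/nneseries_cvg/cvg_weight2. Qed.

End poisson_weights.

Lemma ge0_integral_nat (R : realType) (mu : {measure set nat -> \bar R})
    (g : nat -> \bar R) : (forall k, 0 <= g k)%E ->
  (\int[mu]_k g k = \sum_(k <oo) g k * mu [set k])%E.
Proof.
move=> g0.
have UT : \bigcup_k [set k] = [set: nat] by apply/seteqP; split => // k _; exists k.
rewrite -UT ge0_integral_bigcup//; last first.
  by apply/trivIsetP => i j _ _ ij; apply/seteqP; split => k //= [-> ji]; rewrite ji eqxx in ij.
apply: eq_eseriesr => k _.
transitivity (\int[mu]_(x in [set k]) (cst (g k) x))%E.
  by apply: eq_integral => x; rewrite inE/= => ->.
by rewrite integral_cst.
Qed.

Section mixed_poisson.
Context (R : realType) d (T : measurableType d) (PP : probability T R) (c : T -> R).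
Hypotheses (mc : measurable_fun [set: T] c) (c0 : forall w, 0 <= c w).
Variable mu : R -> probability nat R.
Hypothesis mu_law : forall rho, 0 < rho < 1 -> forall k,
  mu rho [set k] = (\int[PP]_w (poisson_weight (rho * c w) k)%:E)%E.
Variable m2 : R.
Hypotheses (c_mean : (\int[PP]_w (c w)%:E = 1)%E)
  (c_sqr : (\int[PP]_w (c w ^+ 2)%:E = m2%:E)%E).

Let mweight rho k : measurable_fun [set: T] (fun w => poisson_weight (rho * c w) k).
Proof.
have mrc : measurable_fun [set: T] (fun w => rho * c w) by exact: measurable_funM.
apply: measurable_funM; first by apply: measurable_funM => //; exact: measurable_funX.
by apply: measurableT_comp => //; exact: measurableT_comp.
Qed.

Let rc0 rho w : 0 <= rho -> 0 <= rho * c w. Proof. by move=> r0; rewrite mulr_ge0. Qed.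

Lemma mixed_poisson_integral rho (g : nat -> R) : 0 < rho < 1 -> (forall k, 0 <= g k) ->
  (\int[mu rho]_k (g k)%:E =
   \int[PP]_w \sum_(k <oo) (g k * poisson_weight (rho * c w) k)%:E)%E.
Proof.
move=> rho01 g0; have /andP[/ltW r0 _] := rho01.
rewrite ge0_integral_nat; last by move=> k; rewrite lee_fin.
rewrite integral_nneseries//; last 2 first.
- by move=> k; apply/measurable_EFinP; apply: measurable_funM => //; exact: mweight.
- by move=> k w _; rewrite lee_fin mulr_ge0// poisson_weight_ge0// rc0.
apply: eq_eseriesr => k _; rewrite [X in (_ * X)%E](mu_law rho01 k).
under [RHS]eq_integral do rewrite EFinM.
rewrite ge0_integralZl//.
- by apply/measurable_EFinP; exact: mweight.
- by move=> w _; rewrite lee_fin poisson_weight_ge0// rc0.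
- by rewrite lee_fin.
Qed.

Lemma mixed_poisson_mean rho : 0 < rho < 1 -> (\int[mu rho]_k (k%:R)%:E = rho%:E)%E.
Proof.
move=> rho01; have /andP[/ltW r0 _] := rho01.
rewrite mixed_poisson_integral//.
under eq_integral do rewrite poisson_first_moment EFinM.
rewrite ge0_integralZl//; last 2 first.
- exact/measurable_EFinP.
- by move=> w _; rewrite lee_fin.
by rewrite c_mean mule1.
Qed.

Lemma mixed_poisson_sqr rho : 0 < rho < 1 ->
  (\int[mu rho]_k (k%:R ^+ 2)%:E = (rho ^+ 2 * m2 + rho)%:E)%E.
Proof.
move=> rho01; have /andP[/ltW r0 _] := rho01.
rewrite mixed_poisson_integral; [|by []|by move=> k; exact: sqr_ge0].
have E w : (((rho * c w) ^+ 2 + rho * c w)%:E =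
    (rho ^+ 2)%:E * (c w ^+ 2)%:E + rho%:E * (c w)%:E)%E by rewrite exprMn.
under eq_integral do rewrite poisson_second_moment E.
rewrite ge0_integralD//; last 4 first.
- by move=> w _; rewrite -EFinM lee_fin mulr_ge0 ?sqr_ge0.
- by apply: emeasurable_funM => //; apply/measurable_EFinP; exact: measurable_funX.
- by move=> w _; rewrite -EFinM lee_fin mulr_ge0.
- by apply: emeasurable_funM => //; exact/measurable_EFinP.
rewrite ge0_integralZl//; last 3 first.
- by apply/measurable_EFinP; exact: measurable_funX.
- by move=> w _; rewrite lee_fin sqr_ge0.
- by rewrite lee_fin sqr_ge0.
rewrite ge0_integralZl//; last 2 first.
- exact/measurable_EFinP.
- by move=> w _; rewrite lee_fin.
by rewrite c_mean c_sqr mule1.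
Qed.

Let weight_le1 (lam : R) k : 0 <= lam -> poisson_weight lam k <= 1.
Proof.
by move=> l0; rewrite -lee_fin -poisson_prob_set1//; exact: probability_le1.
Qed.

Let bmf_weight (rho : R) k : 0 <= rho -> bmf (fun w => poisson_weight (rho * c w) k).
Proof.
move=> r0; split; first exact: mweight.
exists 1 => w; rewrite ger0_norm ?weight_le1 ?poisson_weight_ge0//; exact: rc0.
Qed.

Let p rho k := \int[PP]_w poisson_weight (rho * c w) k.

Let p_ge0 rho k : 0 <= rho -> 0 <= p rho k.
Proof. by move=> r0; apply: Rintegral_ge0 => w _; rewrite poisson_weight_ge0// rc0. Qed.

Let mu_p rho k : 0 < rho < 1 -> mu rho [set k] = (p rho k)%:E.
Proof.
move=> rho01; have /andP[/ltW r0 _] := rho01.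
by rewrite mu_law// (EFin_Rintegral PP (bmf_weight k r0)).
Qed.

(** The hypotheses constrain [mu rho] only for loads below 1, so the limiting weights [p 1] are
    summed directly from the mixture. *)
Let second_moment_series : series (fun k => k%:R ^+ 2 * p 1 k) @ \oo --> m2 + 1.
Proof.
have h : (\sum_(k <oo) (k%:R ^+ 2 * p 1 k)%:E = (m2 + 1)%:E)%E.
  transitivity (\int[PP]_w \sum_(k <oo) (k%:R ^+ 2 * poisson_weight (1 * c w) k)%:E)%E.
    rewrite integral_nneseries//; last 2 first.
    - by move=> k; apply/measurable_EFinP; apply: measurable_funM => //; exact: mweight.
    - by move=> k w _; rewrite lee_fin mulr_ge0 ?sqr_ge0// poisson_weight_ge0// rc0.
    apply: eq_eseriesr => k _.
    rewrite EFinM (EFin_Rintegral PP (bmf_weight k ler01)).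
    under [RHS]eq_integral do rewrite EFinM.
    rewrite ge0_integralZl//.
    - by apply/measurable_EFinP; exact: mweight.
    - by move=> w _; rewrite lee_fin poisson_weight_ge0// rc0.
  under eq_integral do rewrite poisson_second_moment mul1r EFinD.
  rewrite ge0_integralD//; last 4 first.
  - by move=> w _; rewrite lee_fin sqr_ge0.
  - by apply/measurable_EFinP; exact: measurable_funX.
  - by move=> w _; rewrite lee_fin.
  - exact/measurable_EFinP.
  by rewrite c_mean c_sqr.
have p20 k : (0 <= (k%:R ^+ 2 * p 1 k)%:E)%E.
  by rewrite lee_fin mulr_ge0 ?sqr_ge0 ?p_ge0.
have /cvg_ex[l hl] : cvgn (fun n => \sum_(0 <= k < n) (k%:R ^+ 2 * p 1 k)%:E)%E.
  by apply: is_cvg_nneseries => k _ _; exact: p20.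
have le : l = (m2 + 1)%:E by rewrite -h; apply/esym/cvg_lim.
rewrite le in hl.
move/fine_cvg : hl; apply: cvg_trans; apply: near_eq_cvg; apply: nearW => n /=.
by rewrite /series/= sumEFin.
Qed.

Let tail_eq rho K : 0 < rho < 1 ->
  (\int[mu rho]_k (k%:R ^+ 2 * (K < k)%N%:R)%:E =
   (rho ^+ 2 * m2 + rho - series (fun k => k%:R ^+ 2 * p rho k) K.+1)%:E)%E.
Proof.
move=> rho01; have /andP[/ltW r0 _] := rho01.
have trunc : (\int[mu rho]_k (k%:R ^+ 2 * (k <= K)%N%:R)%:E =
   (series (fun k => k%:R ^+ 2 * p rho k) K.+1)%:E)%E.
  rewrite ge0_integral_nat; last by move=> k; rewrite lee_fin mulr_ge0 ?sqr_ge0.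
  rewrite (@nneseries_split _ _ 0 K.+1); last first.
    by move=> k _; rewrite mule_ge0// lee_fin mulr_ge0 ?sqr_ge0.
  rewrite add0n [X in (_ + X)%E]eseries0 ?adde0; last first.
    by move=> k Kk _; rewrite leqNgt Kk mulr0 mul0e.
  rewrite /series/= -sumEFin; apply: eq_big_nat => k /andP[_ kK].
  by rewrite [X in (_ * X)%E](mu_p k rho01) -ltnS kK mulr1 -EFinM.
have h := mixed_poisson_sqr rho01.
have : (\int[mu rho]_k (k%:R ^+ 2)%:E = \int[mu rho]_k (k%:R ^+ 2 * (k <= K)%N%:R)%:E +
    \int[mu rho]_k (k%:R ^+ 2 * (K < k)%N%:R)%:E)%E.
  rewrite -ge0_integralD//.
  apply: eq_integral => k _; rewrite -EFinD -mulrDr; congr (_ %:E).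
  by case: leqP; rewrite ?addr0 ?add0r mulr1.
rewrite h trunc => e; by rewrite EFinB e [X in (X - _)%E]addeC addeK.
Qed.

(** [K] is chosen at the limiting load. The tail is the full second moment minus finitely many
    terms, and all of these converge as the load tends to 1, so the same [K] works for all late
    [n]. *)
Lemma mixed_poisson_tail (u : nat -> R) (eps : R) : (forall n, 0 < u n < 1) ->
  u @ \oo --> (1 : R) -> 0 < eps -> exists K, \forall n \near \oo,
  (\int[mu (u n)]_k (k%:R ^+ 2 * (K < k)%N%:R)%:E <= eps%:E)%E.
Proof.
move=> u01 u1 eps0; have e20 : 0 < eps / 2 by rewrite divr_gt0.
have u0 n : 0 <= u n by have /andP[/ltW] := u01 n.
have [K _ /(_ K.+1 (leqnSn _)) hK] : \forall n \near \oo,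
    m2 + 1 - series (fun k => k%:R ^+ 2 * p 1 k) n <= eps / 2.
  move/cvgrPdist_le : second_moment_series => /(_ _ e20).
  by apply: filterS => n; apply: le_trans; exact: ler_norm.
exists K.
have cp k : p (u n) k @[n --> \oo] --> p 1 k.
  have mw n : measurable_fun [set: T] (fun w => poisson_weight (u n * c w) k).
    by case: (bmf_weight k (u0 n)).
  have w1 n w : `|poisson_weight (u n * c w) k| <= 1.
    by rewrite ger0_norm ?weight_le1 ?poisson_weight_ge0//; exact: rc0.
  have cw w : poisson_weight (u n * c w) k @[n --> \oo] --> poisson_weight (1 * c w) k.
    have cl : u n * c w @[n --> \oo] --> 1 * c w by apply: cvgMl.
    apply: cvgM; last first.
      by apply: continuous_cvg; [exact: continuous_expR|exact: cvgN].
    by apply: cvgMl; exact: cvg_pow.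
  by have [] := bounded_convergence PP mw w1 cw.
have ctail : (fun n => u n ^+ 2 * m2 + u n - series (fun k => k%:R ^+ 2 * p (u n) k) K.+1) @ \oo
    --> (1 : R) ^+ 2 * m2 + 1 - series (fun k => k%:R ^+ 2 * p 1 k) K.+1.
  apply: cvgB.
    by apply: cvgD => //; apply: cvgMl; exact: cvg_pow.
  rewrite /series/=; elim: (K.+1) => [|m ih].
    by under eq_fun do rewrite big_geq//; rewrite big_geq//; exact: cvg_cst.
  under eq_fun do rewrite big_nat_recr//; rewrite big_nat_recr//.
  by apply: cvgD => //; exact: cvgMr.
have := @cvgr_le _ _ _ _ _ _ ctail eps; rewrite expr1n mul1r.
have : m2 + 1 - series (fun k => k%:R ^+ 2 * p 1 k) K.+1 < eps by lra.
move=> /[swap] /[apply]; apply: filterS => n hn.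
by rewrite tail_eq// lee_fin.
Qed.

End mixed_poisson.

(** * The Gaussian walk and reflected Brownian motion *)

Section reflected_path.
Context (R : realType) (b : R -> R) (t : R).
Hypothesis cb : {within `[0, +oo[, continuous b}.
Hypothesis t0 : 0 < t.

(** Heine's theorem on [0, t]: compactness makes the local moduli uniform, with continuity taken
    within [0, +oo[ so that nothing is asked to the left of 0. *)
Lemma path_modulus (e : R) : 0 < e -> exists2 eta, 0 < eta &
  forall u v, u \in `[0, t] -> v \in `[0, t] -> `|u - v| < eta -> `|b u - b v| <= e.
Proof.
move=> e0; pose P (eta u : R) := u \in `[0, t] -> forall v, v \in `[0, t] ->
  `|u - v| < eta -> `|b u - b v| <= e.
have /compact_near_coveringP cov := @segment_compact R 0 t.
have : \forall eta \near 0^'+, `[0, t]%classic `<=` P eta.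
  apply: (cov _ (0 : R)^'+ P _) => x /= x0t.
  have : b @ within `[0, +oo[ (nbhs x) --> b x.
    move/subspace_continuousP : cb; apply.
    by move: x0t; rewrite /= !in_itv/= andbT => /andP[].
  move=> /cvgrPdist_le/(_ (e / 2)) [|r /= r0 hr]; first by rewrite divr_gt0.
  exists (ball x (r / 2), [set eta | eta < r / 2]).
    split=> /=; first by apply: nbhsx_ballx; rewrite divr_gt0.
    by apply: nbhs_right_lt; rewrite divr_gt0.
  move=> [u eta] /= [xu etar] u0t v v0t uv.
  have inA z : z \in `[0, t] -> `[0, +oo[%classic z.
    by rewrite /= !in_itv/= andbT => /andP[].
  have hu : `|b x - b u| <= e / 2.
    apply: (hr u) (inA _ u0t) => /=.
    by apply: lt_trans xu _; rewrite ltr_pdivrMr//; lra.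
  have hv : `|b x - b v| <= e / 2.
    apply: (hr v) (inA _ v0t) => /=.
    have : `|x - v| <= `|x - u| + `|u - v| by exact: ler_distD.
    move=> /le_lt_trans; apply; rewrite (splitr r); apply: ltrD; first exact: xu.
    exact: lt_trans uv etar.
  have := ler_distD (b x) (b u) (b v); rewrite (distrC (b u) (b x)); lra.
move=> [r /= r0 hr]; exists (r / 2); first by rewrite divr_gt0.
move=> u v u0t v0t uv; apply: (hr (r / 2)) => //=.
  by rewrite sub0r normrN gtr0_norm ?divr_gt0// ltr_pdivrMr//; lra.
by rewrite divr_gt0.
Qed.

Section discretized.
Context (T U : Type) (Z : nat -> T -> U) (xi : U -> R) (w : T) (del : R) (y : R).
Hypothesis xiZ : forall k, xi (Z k w) = b (k.+1%:R * del) - b (k%:R * del).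
Hypothesis y0 : 0 <= y.
Hypothesis b0 : b 0 = 0.

Local Notation X n := (chain (reflect_step xi) Z y n w).

(** Lindley's formula: unrolled, the reflected walk is the maximum of y + b(n del) and of b(n del) -
    b(j del) over j <= n. Splitting it into a lower bound and its attainment avoids maxima over
    index ranges. *)
Lemma reflect_chain_lower n : y + b (n%:R * del) <= X n /\
  forall j, (j <= n)%N -> b (n%:R * del) - b (j%:R * del) <= X n.
Proof.
elim: n => [|n [ih1 ih2]] /=.
  rewrite mul0r b0 addr0; split=> // j.
  by rewrite leqn0 => /eqP ->; rewrite mul0r b0 subrr.
rewrite /reflect_step/= xiZ; split=> [|j].
  by rewrite le_max; apply/orP; left; lra.
rewrite leq_eqVlt => /predU1P[->|]; first by rewrite subrr le_max lexx orbT.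
rewrite ltnS => /ih2 h; rewrite le_max; apply/orP; left; lra.
Qed.

Lemma reflect_chain_attained n : X n = y + b (n%:R * del) \/
  exists2 j, (j <= n)%N & X n = b (n%:R * del) - b (j%:R * del).
Proof.
elim: n => [|n ih] /=; first by left; rewrite mul0r b0 addr0.
rewrite /reflect_step/= xiZ; case: leP => _.
  by right; exists n.+1 => //; rewrite subrr.
case: ih => [->|[j jn ->]]; first by left; ring.
by right; exists j; [exact: leqW|ring].
Qed.

End discretized.

(** The walk maximises over the grid what the reflection maximises over [0, t]. One [e] pays for
    moving the end point [n * del] to [t], the other for moving a time [s] to the grid point on its
    left; the starting points contribute their distance. *)
Lemma reflection_dist (T U : Type) (Z : nat -> T -> U) (xi : U -> R) (w : T) (del x y e : R) :
  (forall k, xi (Z k w) = b (k.+1%:R * del) - b (k%:R * del)) ->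
  0 <= y -> b 0 = 0 -> 0 < del ->
  (forall u v, u \in `[0, t] -> v \in `[0, t] -> `|u - v| <= del -> `|b u - b v| <= e) ->
  `|chain (reflect_step xi) Z y (Num.truncn (t / del)) w - reflection x b t|
    <= `|y - x| + 2 * e.
Proof.
move=> xiZ y0 b0 del0 he; set n := Num.truncn _.
have low := @reflect_chain_lower T U Z xi w del y xiZ y0 b0 n.
have att := @reflect_chain_attained T U Z xi w del y xiZ b0 n.
move: low att; set X := chain (reflect_step xi) Z y n w.
move=> [low1 low2] att.
have td0 : 0 <= t / del by rewrite divr_ge0// ltW.
have /andP[nt tn] := truncn_itv td0; rewrite -/n in nt tn.
rewrite ler_pdivlMr// in nt; rewrite ltr_pdivrMr// in tn.
have inj j : (j <= n)%N -> j%:R * del \in `[0, t].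
  move=> jn; rewrite in_itv/=; apply/andP; split; first by rewrite mulr_ge0// ltW.
  by apply: le_trans nt; rewrite ler_pM2r// ler_nat.
have tt : t \in `[0, t] by rewrite in_itv/= lexx ltW.
have bn : `|b (n%:R * del) - b t| <= e.
  apply: he => //; first exact: inj.
  rewrite distrC ger0_norm ?subr_ge0// lerBlDr ltW//.
  by move: tn; rewrite -natr1 mulrDl mul1r addrC.
have e0 : 0 <= e by exact: le_trans bn.
set S := [set - x - b s | s in `[0, t]].
have Sle z : S z -> z <= X + 2 * e - x - b t.
  move=> [s /= s0t <-].
  pose j := Num.truncn (s / del).
  move: (s0t); rewrite in_itv/= => /andP[s0 st].
  have sd0 : 0 <= s / del by rewrite divr_ge0// ltW.
  have /andP[js sj] := truncn_itv sd0; rewrite -/j in js sj.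
  rewrite ler_pdivlMr// in js; rewrite ltr_pdivrMr// in sj.
  have jn : (j <= n)%N.
    by rewrite truncn_ge_nat// ler_pdivlMr// (le_trans js).
  have bs : `|b (j%:R * del) - b s| <= e.
    apply: he => //; first exact: inj.
    rewrite distrC ger0_norm ?subr_ge0// lerBlDr ltW//.
    by move: sj; rewrite -natr1 mulrDl mul1r addrC.
  have := low2 j jn; move: bs bn; rewrite !ler_norml => /andP[? ?] /andP[? ?]; lra.
have Sub : has_ubound S by exists (X + 2 * e - x - b t).
have S0 : S !=set0 by exists (- x - b t); exists t.
have Xub : sup S <= X + 2 * e - x - b t by exact: ge_sup.
have supj j : (j <= n)%N -> - x - b (j%:R * del) <= sup S.
  by move=> jn; apply: ub_le_sup => //; exists (j%:R * del) => //; exact: inj.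
have xy : x - y <= `|y - x| by rewrite distrC ler_norm.
have yx : y - x <= `|y - x| by exact: ler_norm.
move: bn; rewrite /reflection -/S !ler_norml => /andP[bn1 bn2].
have [M0 MS] : 0 <= Num.max 0 (sup S) /\ sup S <= Num.max 0 (sup S).
  by rewrite !le_max !lexx orbT.
have Mcase : Num.max 0 (sup S) = 0 \/ Num.max 0 (sup S) = sup S.
  by case: leP; [right|left].
set M := Num.max _ _ in M0 MS Mcase *.
apply/andP; split.
- by case: Mcase => ->; lra.
- by case: att => [->|[j jn ->]]; [lra|have := supj j jn; lra].
Qed.

End reflected_path.

Section brownian_chain.
Context (R : realType) (d : measure_display) (T : measurableType d).
Context (P : probability T R) (W : R -> {RV P >-> R}).
Hypothesis W_bm : standard_brownian_motion W.

Definition bm_increment (del : R) (k : nat) (w : T) : R :=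
  W (k.+1%:R * del) w - W (k%:R * del) w.

(** The variable [z] is an increment of [W] over a time [del]. Keeping the scale [s] outside lets
    walks of different variances share the same noise. *)
Definition gauss_drift (del s : R) (z : R) : R := - del + s * z.

Lemma measurable_bm_increment del k : measurable_fun [set: T] (bm_increment del k).
Proof. exact: measurable_funB. Qed.

Lemma measurable_gauss_drift del s : measurable_fun [set: R] (gauss_drift del s).
Proof. by apply: measurable_funD => //; exact: measurable_funM. Qed.

Lemma bm_increment_law del k (A : set R) : 0 < del -> measurable A ->
  P (bm_increment del k @^-1` A) = normal_prob 0 (Num.sqrt del) A.
Proof.
move=> del0 mA; have u0 : 0 <= k%:R * del by rewrite mulr_ge0// ltW.
have uv : k%:R * del < k.+1%:R * del by rewrite ltr_pM2r// ltr_nat.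
have := @sbm_normal _ _ _ _ _ W_bm _ _ u0 uv A mA.
rewrite [X in Num.sqrt X](_ : _ = del)//.
by rewrite -natr1; ring.
Qed.

Lemma bm_increment_indep del : 0 < del -> mutually_independent P (bm_increment del).
Proof.
move=> del0; apply: (sbm_indep W_bm (t := fun n => n%:R * del)).
  by rewrite mul0r.
by move=> m n mn; rewrite ler_pM2r// ler_nat.
Qed.

Variables (sig x t : R).
Hypotheses (x0 : 0 <= x) (t0 : 0 < t).

Let B (w : T) (s : R) := - s + sig * W s w.

Let gauss_chain (del y : R) (w : T) : R :=
  chain (reflect_step (gauss_drift del sig)) (bm_increment del) y
    (Num.truncn (t / del)) w.

Lemma cvg_gauss_chain (del y : nat -> R) (w : T) :
  (forall k, 0 < del k) -> del @ \oo --> 0 -> (forall k, 0 <= y k) -> y @ \oo --> x ->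
  gauss_chain (del k) (y k) w @[k --> \oo] --> reflection x (B w) t.
Proof.
move=> del0 cdel y0 cy.
have cB : {within `[0, +oo[, continuous (B w)}.
  apply/subspace_continuousP => u u0; apply: cvgD.
    by apply: cvgN; apply: cvg_within_filter; exact: cvg_id.
  apply: cvgMr.
  by have /subspace_continuousP := @sbm_continuous _ _ _ _ _ W_bm w; exact.
apply/cvgrPdist_le => e e0.
have e4 : 0 < e / 4 by rewrite divr_gt0.
have [eta eta0 heta] := @path_modulus _ _ t cB _ e4.
near=> k; rewrite distrC.
apply: (@le_trans _ _ (`|y k - x| + 2 * (e / 4))).
  apply: (@reflection_dist _ _ _ t0 _ _ (bm_increment (del k)) (gauss_drift (del k) sig)
    w (del k) x (y k) (e / 4)) => //.
  - by move=> j; rewrite /gauss_drift /bm_increment /B -natr1; ring.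
  - by rewrite /B (sbm_start W_bm) mulr0 oppr0 addr0.
  - move=> u v u0 v0 uv; apply: heta => //; apply: le_lt_trans uv _.
    by near: k; apply: (cvgr_lt 0).
have : `|y k - x| <= e / 2.
  by rewrite distrC; near: k; move/cvgrPdist_le : cy; apply; rewrite divr_gt0.
lra.
Unshelve. all: by end_near. Qed.

Lemma measurable_gauss_chain del y : measurable_fun [set: T] (gauss_chain del y).
Proof.
apply: measurable_chain; first by move=> k; exact: measurable_bm_increment.
by apply: measurable_reflect_step; exact: measurable_gauss_drift.
Qed.

(** The supremum over uncountably many times is reached as the pointwise limit of the measurable
    walks with mesh 1 / (k + 1). *)
Lemma measurable_reflection : measurable_fun [set: T] (fun w => reflection x (B w) t).
Proof.
apply: (measurable_fun_cvg (fun k => measurable_gauss_chain k.+1%:R^-1 x)) => w _.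
apply: (cvg_gauss_chain (del := fun k => k.+1%:R^-1) (y := fun=> x)) => //.
- exact: cvg_harmonic.
- exact: cvg_cst.
Qed.

Lemma cvg_Rintegral_gauss_chain (f : R -> R) (del y : nat -> R) :
  continuous f -> bmf f ->
  (forall k, 0 < del k) -> del @ \oo --> 0 -> (forall k, 0 <= y k) -> y @ \oo --> x ->
  \int[P]_w f (gauss_chain (del k) (y k) w) @[k --> \oo] -->
  \int[P]_w f (reflection x (B w) t).
Proof.
move=> cf [mf [M fM]] del0 cdel y0 cy.
have [//|//|w|//] := @bounded_convergence _ _ _ P
  (fun k w => f (gauss_chain (del k) (y k) w)) (fun w => f (reflection x (B w) t)) M.
- by move=> k; apply: measurableT_comp => //; exact: measurable_gauss_chain.
- apply: continuous_cvg; first exact: cf.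
  exact: cvg_gauss_chain.
Qed.

End brownian_chain.

Section gauss_drift_moments.
Context (R : realType) (del s : R).
Hypotheses (del0 : 0 < del) (s0 : 0 <= s).
Local Notation mu := (normal_prob (0 : R) (Num.sqrt del)).

Let r0 : 0 < Num.sqrt del. Proof. by rewrite sqrtr_gt0. Qed.

Let iZ : mu.-integrable [set: R] (EFin \o (fun z => s * z)).
Proof.
have := integrableZl measurableT s (normal_integrable_id r0).
exact: eq_integrable.
Qed.

Lemma gauss_drift_integrable : mu.-integrable [set: R] (EFin \o gauss_drift del s).
Proof.
have := integrableD measurableT (prob_integrable_cst mu (- del)) iZ.
exact: eq_integrable.
Qed.

Let iZ2 : mu.-integrable [set: R] (EFin \o (fun z => (s * z) ^+ 2)).
Proof.
have := integrableZl measurableT (s ^+ 2) (normal_integrable_sqr r0).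
by apply: eq_integrable => // z _ /=; rewrite exprMn.
Qed.

Let Z0 : \int[mu]_z (s * z) = 0.
Proof.
rewrite RintegralZl//; last exact: normal_integrable_id.
by rewrite normal_mean// mulr0.
Qed.

Lemma gauss_drift_integrable_sqr :
  mu.-integrable [set: R] (EFin \o (fun z => gauss_drift del s z ^+ 2)).
Proof. exact: integrable_shift_sqr. Qed.

Lemma gauss_drift_mean : \int[mu]_z gauss_drift del s z = - del.
Proof.
rewrite RintegralD//; last exact: prob_integrable_cst.
by rewrite prob_Rintegral_cst Z0 addr0.
Qed.

Lemma gauss_drift_sqr : \int[mu]_z gauss_drift del s z ^+ 2 = del ^+ 2 + s ^+ 2 * del.
Proof.
rewrite Rintegral_shift_sqr// sqrrN; congr (_ + _).
under eq_Rintegral do rewrite exprMn.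
rewrite RintegralZl//; last exact: normal_integrable_sqr.
by rewrite normal_second_moment// sqr_sqrtr// ltW.
Qed.

(** (a + b)^3 <= 4 (a^3 + b^3) for nonnegative a and b; 264 is 4 times the 66 of
    [normal_third_moment]. *)
Lemma gauss_drift_cube :
  (\int[mu]_z (`|gauss_drift del s z| ^+ 3)%:E <=
     (4 * del ^+ 3 + 264 * s ^+ 3 * Num.sqrt del ^+ 3)%:E)%E.
Proof.
apply: (@le_trans _ _ (\int[mu]_z ((4 * del ^+ 3)%:E + (4 * s ^+ 3)%:E * (`|z| ^+ 3)%:E))%E).
  apply: ge0_le_integral => //.
  - apply/measurable_EFinP; apply: measurable_funX; apply: measurableT_comp => //.
    exact: measurable_gauss_drift.
  - apply/measurable_EFinP; apply: measurable_funD => //; apply: measurable_funM => //.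
    by apply: measurable_funX; exact: normr_measurable.
  - move=> z _; rewrite -EFinM -EFinD lee_fin.
    have h : `|gauss_drift del s z| <= del + s * `|z|.
      by rewrite (le_trans (ler_normD _ _))// normrN gtr0_norm// normrM (ger0_norm s0).
    have u0 : 0 <= s * `|z| by rewrite mulr_ge0.
    apply: (@le_trans _ _ ((del + s * `|z|) ^+ 3)).
      by rewrite lerXn2r ?nnegrE// addr_ge0// ltW.
    rewrite -mulrA -exprMn; set u := s * _ in u0 *.
    have := mulr_ge0 (addr_ge0 (ltW del0) u0) (sqr_ge0 (del - u)); nra.
have c0 : 0 <= 4 * s ^+ 3 by rewrite mulr_ge0// exprn_ge0.
rewrite ge0_integralD//; last 3 first.
- by move=> z _; rewrite lee_fin mulr_ge0// exprn_ge0// ltW.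
- by move=> z _; rewrite -EFinM lee_fin mulr_ge0// exprn_ge0.
- apply/measurable_EFinP; apply: measurable_funM => //.
  by apply: measurable_funX; exact: normr_measurable.
rewrite integral_cst//= probability_setT mule1 EFinD leeD2l//.
rewrite ge0_integralZl//; last first.
  by apply/measurable_EFinP; apply: measurable_funX; exact: normr_measurable.
apply: le_trans (lee_wpmul2l _ (normal_third_moment r0)) _; first by rewrite lee_fin.
by rewrite -EFinM lee_fin le_eqVlt; apply/orP; left; apply/eqP; ring.
Qed.

End gauss_drift_moments.

(** * Arrivals of the queue *)

Section product_integral.
Context d1 d2 (T1 : measurableType d1) (T2 : measurableType d2) (R : realType).
Context (P1 : probability T1 R) (P2 : probability T2 R).

Lemma integral_product_factor (f : T1 -> R) (g : T2 -> R) :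
  measurable_fun [set: T1] f -> measurable_fun [set: T2] g ->
  (forall x, 0 <= f x) -> (forall y, 0 <= g y) ->
  (\int[(P1 \x P2)%E]_p (f p.1 * g p.2)%:E =
   \int[P1]_x (f x)%:E * \int[P2]_y (g y)%:E)%E.
Proof.
move=> mf mg f0 g0.
rewrite (fubini_tonelli1 (fun p => (f p.1 * g p.2)%:E)); last 2 first.
- apply/measurable_EFinP; apply: measurable_funM; exact: measurableT_comp.
- by move=> p; rewrite lee_fin mulr_ge0.
rewrite -ge0_integralZr//; last 3 first.
- exact/measurable_EFinP.
- by move=> x _; rewrite lee_fin.
- by apply: integral_ge0 => y _; rewrite lee_fin.
apply: eq_integral => x _; rewrite /fubini_F/=.
under eq_integral do rewrite EFinM.
rewrite ge0_integralZl//.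
- exact/measurable_EFinP.
- by move=> y _; rewrite lee_fin.
- by rewrite lee_fin.
Qed.

End product_integral.

Section queue_arrivals.
Context (R : realType) d0 (T0 : measurableType d0) (P0 : probability T0 R).
Context (Lam S : T0 -> R) (mLam : measurable_fun [set: T0] Lam)
  (mS : measurable_fun [set: T0] S).
Hypotheses (Lam_ge0 : forall w, 0 <= Lam w) (S_ge0 : forall w, 0 <= S w).
Context d (T : measurableType d) (P : probability T R).
Context (L V : nat -> {RV P >-> R}) (N : nat -> {RV P >-> nat}).
Hypothesis queue : resampled_MG1 P0 Lam S L V N.

Let PP := (P0 \x P0)%E.

(** Only the marginal laws of [Lam] and [S] on [T0] are prescribed, not their joint law. Evaluating
    them at the two coordinates of the product space restores the independence of rate and
    service. *)
Lemma rate_service_integral n (h : R * R -> \bar R) :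
  measurable_fun [set: R * R] h -> (forall z, 0 <= h z)%E ->
  (\int[P]_w h (L n w, V n w) = \int[PP]_p h (Lam p.1, S p.2))%E.
Proof.
move=> mh h0.
have mLV : measurable_fun [set: T] (fun w => (L n w, V n w)).
  exact/measurable_fun_pair.
have mLS : measurable_fun [set: T0 * T0] (fun p => (Lam p.1, S p.2)).
  by apply/measurable_fun_pair; exact: measurableT_comp.
pose LV : {mfun T >-> (R * R)%type} := mfun_Sub (mem_set mLV).
pose LS : {mfun (T0 * T0)%type >-> (R * R)%type} := mfun_Sub (mem_set mLS).
have := @ge0_integral_distribution _ _ _ _ _ P LV _ mh h0; rewrite /= => <-.
have := @ge0_integral_distribution _ _ _ _ _ PP LS _ mh h0; rewrite /= => <-.
apply: eq_measure_integral => C mC _.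
apply: rectangles_unique => //.
  by rewrite (@le_lt_trans _ _ 1%E) ?ltry//; exact: probability_le1.
move=> A B mA mB; rewrite /= /distribution /pushforward.
have -> : LS @^-1` (A `*` B) = (Lam @^-1` A) `*` (S @^-1` B) by [].
rewrite [RHS]product_measure1E; last 2 first.
- by rewrite -[X in measurable X]setTI; exact: mLam.
- by rewrite -[X in measurable X]setTI; exact: mS.
have := mg1_rate_service_indep queue (s := [:: inl n; inr n])
  (A := fun i => if i is inl _ then A else B).
rewrite !big_cons big_nil mule1 => /(_ isT) LVindep.
transitivity (P (L n @^-1` A) * P (V n @^-1` B))%E; last first.
  by congr (_ * _)%E; [exact: (mg1_rate_law queue n mA)|exact: (mg1_service_law queue n mB)].
rewrite -LVindep; last by case.
congr (P _); apply/seteqP; split => w /=.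
  by move=> [Aw Bw] i /=; rewrite !inE => /orP[] /eqP ->.
by move=> h'; split; [apply: (h' (inl n))|apply: (h' (inr n))]; rewrite /= !inE eqxx ?orbT.
Qed.

Lemma arrivals_law n k :
  P (N n @^-1` [set k]) = (\int[PP]_p (poisson_weight (Lam p.1 * S p.2) k)%:E)%E.
Proof.
have := mg1_arrivals_poisson queue n [set k] (@measurableT _ (R * R)%type).
rewrite (_ : [set w | _ /\ _] = N n @^-1` [set k]); last first.
  by apply/seteqP; split => w /= => [[]|].
move=> ->; rewrite (_ : [set w | _] = setT); last by apply/seteqP; split.
pose h (z : R * R) := poisson_prob (z.1 * z.2) 0 [set k].
have mh : measurable_fun [set: R * R] h.
  rewrite /h /poisson_prob; apply: measurable_fun_if => //=.
  - by apply: measurable_fun_ltr => //; exact: measurable_funM.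
  - apply: (eq_measurable_fun (fun z : R * R => (poisson_pmf (z.1 * z.2) k)%:E)).
      by move=> z _; rewrite esum_set1// lee_fin poisson_pmf_ge0.
    apply/measurable_EFinP; apply: measurable_funTS.
    have mp : measurable_fun [set: R] (@poisson_pmf R ^~ k) by exact: measurable_poisson_pmf.
    by apply: measurableT_comp mp _; exact: measurable_funM.
have h0 z : (0 <= h z)%E by exact: measure_ge0.
rewrite (rate_service_integral n mh h0).
by apply: eq_integral => p _; rewrite /h/= poisson_prob_set1// mulr_ge0.
Qed.

End queue_arrivals.

(** * The second derivative of the generating function at 1 *)

Section exponential_transform.
Context (R : realType) d (T : measurableType d) (P : probability T R) (X : T -> R).
Hypotheses (mX : measurable_fun [set: T] X) (X0 : forall w, 0 <= X w).
Hypothesis iX2 : P.-integrable [set: T] (EFin \o (fun w => X w ^+ 2)).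

Let F k (z : R) := \int[P]_w (X w ^+ k * expR (- (X w * (1 - z)))).

Let term_le k z w : z < 1 -> `|X w ^+ k * expR (- (X w * (1 - z)))| <= X w ^+ k.
Proof.
move=> z1; rewrite normrM [X in X * _]ger0_norm ?exprn_ge0// ler_piMr ?exprn_ge0//.
by rewrite gtr0_norm ?expR_gt0// -[leRHS]expR0 ler_expR oppr_le0 mulr_ge0// subr_ge0 ltW.
Qed.

Let mterm k z : measurable_fun [set: T] (fun w => X w ^+ k * expR (- (X w * (1 - z)))).
Proof.
apply: measurable_funM; first exact: measurable_funX.
by apply: measurableT_comp => //; apply: measurableT_comp => //; exact: measurable_funM.
Qed.

Let iX k : (k <= 2)%N -> P.-integrable [set: T] (EFin \o (fun w => X w ^+ k)).
Proof.
move=> k2; have i12 : P.-integrable [set: T] (EFin \o (fun w => 1 + X w ^+ 2)).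
  by have := integrableD measurableT (prob_integrable_cst P 1) iX2; apply: eq_integrable.
apply: le_integrable i12 => //.
  by apply/measurable_EFinP; exact: measurable_funX.
move=> w _ /=; rewrite lee_fin !ger0_norm ?addr_ge0 ?exprn_ge0//.
have := sqr_ge0 (X w - 1); have := X0 w; have := sqr_ge0 (X w).
by move: k2; case: k => [|[|[|k]]] // _; rewrite ?expr0 ?expr1; nra.
Qed.

Let iterm k z : (k <= 2)%N -> z < 1 ->
  P.-integrable [set: T] (EFin \o (fun w => X w ^+ k * expR (- (X w * (1 - z))))).
Proof.
move=> k2 z1; apply: le_integrable (iX k2) => //; first exact/measurable_EFinP.
by move=> w _ /=; rewrite lee_fin [leRHS]ger0_norm ?exprn_ge0// term_le.
Qed.

Let dterm k w (z : R) : is_derive z 1 (fun z => X w ^+ k * expR (- (X w * (1 - z))))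
  (X w ^+ k.+1 * expR (- (X w * (1 - z)))).
Proof.
have dl : is_derive z 1 (fun y => - (X w * (1 - y))) (X w).
  by apply: is_derive_eq; rewrite /GRing.scale/=; ring.
have de := @is_derive1_comp _ expR (fun y => - (X w * (1 - y))) _ _ _
  (is_derive_expR (- (X w * (1 - z)))) dl.
apply: (is_derive_eq (is_deriveZ (X w ^+ k) de)).
by rewrite /GRing.scale/= exprS; ring.
Qed.

(** To the left of 1 the exponential is at most 1, so [X w ^+ k.+1] dominates the derivative; it is
    integrable because k + 1 <= 2. *)
Let deriveF k (z : R) : (k < 2)%N -> z < 1 -> derive1 (F k) z = F k.+1 z.
Proof.
move=> k2 z1; have za : z \in `]z - 1, 1[ by rewrite in_itv/= z1 andbT; lra.
have lt1 y : y \in `]z - 1, 1[ -> y < 1 by rewrite in_itv/= => /andP[].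
have d1 y w : partial1of2 (fun z w => X w ^+ k * expR (- (X w * (1 - z)))) y w =
    X w ^+ k.+1 * expR (- (X w * (1 - y))).
  by rewrite partial1of2E; have h := dterm k w y; exact: derive_val.
rewrite /F (@differentiation_under_integral _ _ _ P
  (fun z w => X w ^+ k * expR (- (X w * (1 - z)))) setT measurableT z (z - 1) 1 za
  _ _ (fun w => X w ^+ k.+1)).
- by apply: eq_Rintegral => w _; rewrite d1.
- by move=> y /lt1 y1; apply: iterm => //; exact: ltnW.
- by move=> y w _ _; have h := dterm k w y; exact: ex_derive.
- by move=> w; rewrite exprn_ge0.
- exact: iX.
- by move=> y w /lt1 y1 _; rewrite d1 term_le.
Qed.

Lemma exponential_transform_derive2 (nu : R -> R) :
  (forall z, z < 1 -> nu z = \int[P]_w expR (- (X w * (1 - z)))) ->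
  (nu^`(2))%classic z @[z --> 1^'-] --> \int[P]_w X w ^+ 2.
Proof.
move=> nuE.
have nu1 z : z < 1 -> derive1 nu z = F 1 z.
  move=> z1; rewrite -deriveF// !derive1E; apply: near_eq_derive.
  near=> y; rewrite nuE; first by apply: eq_Rintegral => w _; rewrite expr0 mul1r.
  by near: y; exact: lt_nbhsl.
have nu2 z : z < 1 -> (nu^`(2))%classic z = F 2 z.
  move=> z1; rewrite /= -deriveF// !derive1E; apply: near_eq_derive.
  near=> y; rewrite nu1//.
  by near: y; exact: lt_nbhsl.
(* The left limit is taken along sequences, the form that dominated convergence handles. *)
apply/cvg_at_leftP => u [u1 cu].
rewrite (_ : (fun n => _) = (fun n => F 2 (u n))); last first.
  by apply/funext => n; rewrite nu2.
have cw w : (X w ^+ 2 * expR (- (X w * (1 - u n))))%:E @[n --> \oo] --> (X w ^+ 2)%:E.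
  apply: cvg_EFin; first exact: nearW.
  have : X w ^+ 2 * expR (- (X w * (1 - u n))) @[n --> \oo] -->
      X w ^+ 2 * expR (- (X w * (1 - 1))).
    apply: cvgMr; apply: continuous_cvg; first exact: continuous_expR.
    by apply: cvgN; apply: cvgMr; apply: cvgB => //; exact: cvg_cst.
  by rewrite subrr mulr0 oppr0 expR0 mulr1.
have [_ _] := @dominated_convergence _ _ _ P _ measurableT
  (fun n w => (X w ^+ 2 * expR (- (X w * (1 - u n))))%:E) (fun w => (X w ^+ 2)%:E)
  (fun w => (X w ^+ 2)%:E)
  (fun n => (measurable_EFinP _ _).2 (mterm 2 (u n))) (measurable_int P iX2)
  (aeW P (fun w _ => cw w)) iX2
  (aeW P (fun w n _ => term_le 2 w (u1 n))).
move=> h; apply: fine_cvg; rewrite fineK; first exact: h.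
exact: integrable_fin_num.
Unshelve. all: by end_near. Qed.

End exponential_transform.

Lemma arrivals_pgfE (R : realType) d (T : measurableType d) (P : probability T R)
    (Lam S : T -> R) (z : R) :
  measurable_fun [set: T] Lam -> measurable_fun [set: T] S ->
  (forall w, 0 <= Lam w) -> (forall w, 0 <= S w) -> z <= 1 ->
  arrivals_pgf P Lam S z =
  \int[(P \x P)%E]_p expR (- (Lam p.1 * S p.2 * (1 - z))).
Proof.
move=> mL mS L0 S0 z1.
have bf : bmf (fun p : T * T => expR (- (Lam p.1 * S p.2 * (1 - z)))).
  split.
    apply: measurableT_comp => //; apply: measurableT_comp => //.
    apply: measurable_funM => //; apply: measurable_funM; exact: measurableT_comp.
  exists 1 => p; rewrite gtr0_norm ?expR_gt0// -[leRHS]expR0 ler_expR oppr_le0.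
  by rewrite !mulr_ge0// subr_ge0.
rewrite (bounded_Fubini1 P P bf) /arrivals_pgf unlock.
apply: eq_Rintegral => w _; rewrite /laplace_stieltjes unlock.
by apply: eq_Rintegral => w' _ /=; congr (expR (- _)); ring.
Qed.

(** The queue takes the positive part before adding the arrivals, the walk afterwards. The sandwich
    X <= h Q <= X + h is preserved by every step, so the discrepancy does not accumulate. *)
Lemma queue_reflect_dist (R : realType) (Omega : Type) (q0 : nat) (N : nat -> Omega -> nat)
    (h : R) n w : 0 <= h ->
  `|h * (queue_length q0 N n w)%:R -
    chain (reflect_step (fun k : nat => h * (k%:R - 1))) (fun k => N k.+1) (h * q0%:R) n w|
  <= h.
Proof.
move=> h0.
suff /andP[lo up] : chain (reflect_step (fun k : nat => h * (k%:R - 1))) (fun k => N k.+1)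
    (h * q0%:R) n w <= h * (queue_length q0 N n w)%:R <=
    chain (reflect_step (fun k : nat => h * (k%:R - 1))) (fun k => N k.+1) (h * q0%:R) n w + h.
  by rewrite ler_norml; apply/andP; split; lra.
have X0 m : 0 <= chain (reflect_step (fun k : nat => h * (k%:R - 1))) (fun k => N k.+1)
    (h * q0%:R) m w.
  by case: m => [|m] /=; [rewrite mulr_ge0|rewrite le_max lexx orbT].
elim: n => [|n /andP[lo up]] /=; first by rewrite lexx lerDl.
have := X0 n; set X := chain _ _ _ n w in lo up * => {}X0.
set Q := queue_length q0 N n w in lo up *.
rewrite /reflect_step/=; set k := N n.+1 w.
have k0 : 0 <= h * k%:R by rewrite mulr_ge0.
have -> : h * (k%:R - 1) = h * k%:R - h by ring.
rewrite natrD mulrDr.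
(* At an empty queue the truncated subtraction of naturals acts as the positive part; otherwise it
   is the true subtraction. *)
case: (posnP Q) => [Q0|Q1].
  rewrite Q0 sub0n mulr0 add0r; rewrite Q0 mulr0 in lo up.
  rewrite ge_max; apply/andP; split; first by apply/andP; split; lra.
  by rewrite -lerBlDr le_max; apply/orP; left; lra.
rewrite natrB// mulrBr mulr1; have hQ : h <= h * Q%:R by rewrite ler_peMr// ler1n.
rewrite ge_max; apply/andP; split; first by apply/andP; split; lra.
by rewrite -lerBlDr le_max; apply/orP; left; lra.
Qed.

(** * Truncated arrivals and heavy traffic *)

Section truncation.
Context (R : realType) (mu : probability nat R) (rho m2 : R) (K : nat) (tau : R).
Hypotheses (rho01 : 0 < rho < 1).
Hypotheses (mean : (\int[mu]_k (k%:R)%:E = rho%:E)%E)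
  (square : (\int[mu]_k (k%:R ^+ 2)%:E = (rho ^+ 2 * m2 + rho)%:E)%E)
  (tail : (\int[mu]_k (k%:R ^+ 2 * (K < k)%N%:R)%:E <= tau%:E)%E).
Hypotheses (tau01 : 0 <= tau <= 1) (m20 : 0 <= m2).

Definition below (k : nat) : R := if (k <= K)%N then k%:R else 0.
Definition above (k : nat) : R := if (k <= K)%N then 0 else k%:R.

Let belowDabove k : k%:R = below k + above k.
Proof. by rewrite /below /above; case: ifP; rewrite ?addr0 ?add0r. Qed.

Lemma bmf_below : bmf below.
Proof.
split => //; exists K%:R => k; rewrite /below; case: ifP => [kK|_]; rewrite ?normr0//.
by rewrite ger0_norm// ler_nat.
Qed.

Let i1 : mu.-integrable [set: nat] (EFin \o (fun k : nat => k%:R)).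
Proof.
apply/integrableP; split => //.
under eq_integral do rewrite gee0_abs ?lee_fin//.
by rewrite mean ltry.
Qed.

Let i2 : mu.-integrable [set: nat] (EFin \o (fun k : nat => k%:R ^+ 2)).
Proof.
apply/integrableP; split => //.
under eq_integral do rewrite gee0_abs ?lee_fin ?sqr_ge0//.
by rewrite square ltry.
Qed.

Let iabove : mu.-integrable [set: nat] (EFin \o above).
Proof.
apply: le_integrable i1 => //; move=> k _ /=; rewrite lee_fin /above.
by case: ifP; rewrite ?normr0.
Qed.

Let iabove2 : mu.-integrable [set: nat] (EFin \o (fun k => above k ^+ 2)).
Proof.
apply: le_integrable i2 => //; move=> k _ /=; rewrite lee_fin /above.
by case: ifP; rewrite ?expr0n ?normr0.
Qed.

Let ibelow : mu.-integrable [set: nat] (EFin \o below).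
Proof. by apply: bmf_integrable; exact: bmf_below. Qed.

Let ibelow2 : mu.-integrable [set: nat] (EFin \o (fun k => below k ^+ 2)).
Proof.
apply: le_integrable i2 => //; move=> k _ /=; rewrite lee_fin /below.
by case: ifP; rewrite ?expr0n ?normr0.
Qed.

Definition below_mean := \int[mu]_k below k.
Definition below_var := \int[mu]_k below k ^+ 2 - below_mean ^+ 2.
Let above_mean := \int[mu]_k above k.
Let above_sqr := \int[mu]_k above k ^+ 2.

Let mean_split : rho = below_mean + above_mean.
Proof.
have <- : \int[mu]_k (k%:R : R) = rho by rewrite /Rintegral mean.
by rewrite -RintegralD//; apply: eq_Rintegral => k _; exact: belowDabove.
Qed.

Let sqr_split : rho ^+ 2 * m2 + rho = \int[mu]_k below k ^+ 2 + above_sqr.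
Proof.
have <- : \int[mu]_k ((k%:R : R) ^+ 2) = rho ^+ 2 * m2 + rho by rewrite /Rintegral square.
rewrite -RintegralD//; apply: eq_Rintegral => k _.
by rewrite /below /above; case: ifP; rewrite expr0n ?addr0 ?add0r.
Qed.

Let above_sqr_le : above_sqr <= tau.
Proof.
rewrite -lee_fin /above_sqr /Rintegral fineK; last exact: integrable_fin_num.
apply: le_trans tail; rewrite le_eqVlt; apply/orP; left; apply/eqP.
apply: eq_integral => k _; rewrite /above; congr (_%:E).
by case: leqP => _ /=; rewrite ?mulr0 ?mulr1 ?expr0n.
Qed.

(** The values are natural numbers, so [above k <= above k ^+ 2] and the tail of the second moment
    controls the discarded mean as well. *)
Let above_mean_bounds : 0 <= above_mean <= above_sqr.
Proof.
apply/andP; split.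
  by apply: Rintegral_ge0 => k _; rewrite /above; case: ifP.
apply: le_Rintegral => // k _; rewrite /above; case: ifP; rewrite ?expr0n//.
by case: k => [|k] _; rewrite ?expr0n// expr2 ler_peMr// ler1n.
Qed.

Lemma below_mean_bounds : 0 <= below_mean <= 1.
Proof.
have /andP[a0 _] := above_mean_bounds; have /andP[_ r1] := rho01.
apply/andP; split; last by move: mean_split; lra.
by apply: Rintegral_ge0 => k _; rewrite /below; case: ifP.
Qed.

Lemma below_var_ge0 : 0 <= below_var.
Proof.
have ib : mu.-integrable [set: nat] (EFin \o (fun k => below k - below_mean)).
  have := integrableB measurableT ibelow (prob_integrable_cst mu below_mean).
  exact: eq_integrable.
have ib2 : mu.-integrable [set: nat] (EFin \o (fun k => (below k - below_mean) ^+ 2)).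
  rewrite (_ : (fun k => _) = (fun k => (- below_mean + below k) ^+ 2)); last first.
    by apply/funext => k; rewrite addrC.
  exact: integrable_shift_sqr.
have b0 : \int[mu]_k (below k - below_mean) = 0.
  by rewrite RintegralB ?prob_Rintegral_cst ?subrr//; exact: prob_integrable_cst.
have := Rintegral_shift_sqr ib ib2 below_mean b0.
under eq_Rintegral do rewrite addrC subrK.
rewrite /below_var => ->; rewrite addrC addKr.
by apply: Rintegral_ge0 => k _; exact: sqr_ge0.
Qed.

Lemma below_var_le : below_var <= m2 + 1.
Proof.
have /andP[r0 r1] := rho01; have := sqr_ge0 below_mean.
have : 0 <= above_sqr by apply: Rintegral_ge0 => k _; exact: sqr_ge0.
move: sqr_split; rewrite /below_var => e; have : rho ^+ 2 * m2 <= m2.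
  by rewrite ler_piMl// exprn_ile1// ltW.
lra.
Qed.

(** Without truncation the variance is rho^2 m2 + rho (1 - rho), whose last term vanishes at load 1;
    this is why the factorial moment [m2] becomes the diffusion coefficient. Truncation changes it
    by - [above_sqr] + 2 rho [above_mean] - [above_mean]^2, which stays within 3 tau. *)
Lemma below_var_dist : `|below_var - m2| <= (1 - rho) * (2 * m2 + 1) + 3 * tau.
Proof.
have /andP[r0 r1] := rho01; have /andP[a0 a1] := above_mean_bounds.
have /andP[t0 t1] := tau01.
rewrite /below_var (_ : \int[mu]_k below k ^+ 2 = rho ^+ 2 * m2 + rho - above_sqr); last first.
  by rewrite sqr_split addrK.
rewrite (_ : below_mean = rho - above_mean); last by rewrite mean_split addrK.
have at0 := le_trans a1 above_sqr_le; have q := above_sqr_le.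
have h1 : 0 <= (1 - rho) * m2 by rewrite mulr_ge0// subr_ge0 ltW.
have h2 : (1 - rho) * m2 * rho <= (1 - rho) * m2 by rewrite ler_piMr// ltW.
have h3 : 0 <= (1 - rho) * rho by apply: mulr_ge0; lra.
have h4 : (1 - rho) * rho <= 1 - rho by nra.
have h5 : 0 <= rho * above_mean by rewrite mulr_ge0// ltW.
have h6 : rho * above_mean <= above_mean by rewrite ler_piMl// ltW.
have h7 : 0 <= above_mean ^+ 2 by exact: sqr_ge0.
have h8 : above_mean ^+ 2 <= above_mean by rewrite expr2 ler_piMr// (le_trans at0).
rewrite ler_norml; apply/andP; split; nra.
Qed.

Variable h : R.
Hypothesis h_rho : h = 1 - rho.

Let h01 : 0 < h <= 1.
Proof. by have /andP[? ?] := rho01; rewrite h_rho; apply/andP; split; lra. Qed.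

Definition increment (k : nat) : R := h * (k%:R - 1).
(** Recentring puts the mean at - h^2 = h (rho - 1), that of the full increment: the discarded part
    is centred, and the drift is that of the Brownian motion over a time h^2. *)
Definition below_increment (k : nat) : R := - h ^+ 2 + h * (below k - below_mean).

Let diffE k : increment k - below_increment k = h * (above k - above_mean).
Proof.
rewrite /increment /below_increment belowDabove.
have -> : above_mean = rho - below_mean by rewrite mean_split addrC addKr.
by rewrite h_rho; ring.
Qed.

Let iab : mu.-integrable [set: nat] (EFin \o (fun k => above k - above_mean)).
Proof.
have := integrableB measurableT iabove (prob_integrable_cst mu above_mean).
by apply: eq_integrable.
Qed.

Let iab2 : mu.-integrable [set: nat] (EFin \o (fun k => (above k - above_mean) ^+ 2)).
Proof.
rewrite (_ : (fun k => _) = (fun k => (- above_mean + above k) ^+ 2)); last first.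
  by apply/funext => k; rewrite addrC.
exact: integrable_shift_sqr.
Qed.

Lemma diff_integrable : mu.-integrable [set: nat]
  (EFin \o (fun k => increment k - below_increment k)).
Proof.
under eq_fun do rewrite diffE.
by have := integrableZl measurableT h iab; apply: eq_integrable.
Qed.

Lemma diff_integrable_sqr : mu.-integrable [set: nat]
  (EFin \o (fun k => (increment k - below_increment k) ^+ 2)).
Proof.
under eq_fun do rewrite diffE exprMn.
by have := integrableZl measurableT (h ^+ 2) iab2; apply: eq_integrable.
Qed.

Let ab0 : \int[mu]_k (above k - above_mean) = 0.
Proof. by rewrite RintegralB ?prob_Rintegral_cst ?subrr//; exact: prob_integrable_cst. Qed.

Lemma diff_mean : \int[mu]_k (increment k - below_increment k) = 0.
Proof. by under eq_Rintegral do rewrite diffE; rewrite RintegralZl// ab0 mulr0. Qed.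

Lemma diff_sqr_le : \int[mu]_k (increment k - below_increment k) ^+ 2 <= h ^+ 2 * tau.
Proof.
under eq_Rintegral do rewrite diffE exprMn.
rewrite RintegralZl// ler_wpM2l ?sqr_ge0//; apply: le_trans above_sqr_le.
have := Rintegral_shift_sqr iab iab2 above_mean ab0.
under eq_Rintegral do rewrite addrC subrK.
rewrite -/above_sqr => ->; by rewrite lerDr sqr_ge0.
Qed.

Lemma below_increment_le k : `|below_increment k| <= h * (K%:R + 2).
Proof.
have /andP[h0 h1] := h01; have /andP[b0 b1] := below_mean_bounds.
have -> : below_increment k = h * (below k - below_mean - h) by rewrite /below_increment; ring.
rewrite normrM gtr0_norm// ler_pM2l// ler_norml.
have K0 : 0 <= K%:R :> R by [].
have [c0 c1] : 0 <= below k /\ below k <= K%:R.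
  by rewrite /below; case: ifP => kK; split; rewrite ?ler_nat.
by apply/andP; split; lra.
Qed.

Let bmf_below_increment : bmf below_increment.
Proof. by split => //; exists (h * (K%:R + 2)) => k; exact: below_increment_le. Qed.

Lemma below_increment_integrable : mu.-integrable [set: nat] (EFin \o below_increment).
Proof. exact: bmf_integrable. Qed.

Lemma below_increment_integrable_sqr :
  mu.-integrable [set: nat] (EFin \o (fun k => below_increment k ^+ 2)).
Proof.
apply: bmf_integrable; split => //; exists ((h * (K%:R + 2)) ^+ 2) => k.
by rewrite normrX lerXn2r ?nnegrE ?below_increment_le// (le_trans _ (below_increment_le 0)).
Qed.

Let ibm : mu.-integrable [set: nat] (EFin \o (fun k => below k - below_mean)).
Proof.
have := integrableB measurableT ibelow (prob_integrable_cst mu below_mean).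
by apply: eq_integrable.
Qed.

Let ihbm : mu.-integrable [set: nat] (EFin \o (fun k => h * (below k - below_mean))).
Proof. by have := integrableZl measurableT h ibm; apply: eq_integrable. Qed.

Let bm0 : \int[mu]_k (below k - below_mean) = 0.
Proof. by rewrite RintegralB ?prob_Rintegral_cst ?subrr//; exact: prob_integrable_cst. Qed.

Let ibm2 : mu.-integrable [set: nat] (EFin \o (fun k => (below k - below_mean) ^+ 2)).
Proof.
rewrite (_ : (fun k => _) = (fun k => (- below_mean + below k) ^+ 2)); last first.
  by apply/funext => k; rewrite addrC.
exact: integrable_shift_sqr.
Qed.

Let ihbm2 : mu.-integrable [set: nat] (EFin \o (fun k => (h * (below k - below_mean)) ^+ 2)).
Proof.
under eq_fun do rewrite exprMn.
by have := integrableZl measurableT (h ^+ 2) ibm2; apply: eq_integrable.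
Qed.

Let hbm0 : \int[mu]_k (h * (below k - below_mean)) = 0.
Proof. by rewrite RintegralZl// bm0 mulr0. Qed.

Lemma below_increment_mean : \int[mu]_k below_increment k = - h ^+ 2.
Proof.
rewrite RintegralD//; last exact: prob_integrable_cst.
by rewrite prob_Rintegral_cst hbm0 addr0.
Qed.

Lemma below_increment_sqr :
  \int[mu]_k below_increment k ^+ 2 = (h ^+ 2) ^+ 2 + below_var * h ^+ 2.
Proof.
rewrite (Rintegral_shift_sqr ihbm ihbm2 _ hbm0) sqrrN; congr (_ + _).
under eq_Rintegral do rewrite exprMn.
rewrite RintegralZl// mulrC; congr (_ * _).
have := Rintegral_shift_sqr ibm ibm2 below_mean bm0.
under eq_Rintegral do rewrite addrC subrK.
by rewrite /below_var => ->; rewrite addrC addKr.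
Qed.

Lemma below_increment_cube :
  (\int[mu]_k (`|below_increment k| ^+ 3)%:E <= ((h * (K%:R + 2)) ^+ 3)%:E)%E.
Proof.
apply: (@le_trans _ _ (\int[mu]_k ((h * (K%:R + 2)) ^+ 3)%:E)%E); last first.
  by rewrite integral_cst//= probability_setT mule1.
apply: ge0_le_integral => // k _.
by rewrite lee_fin lerXn2r ?nnegrE ?below_increment_le// (le_trans _ (below_increment_le 0)).
Qed.

End truncation.

Lemma derive_lipschitz (R : realType) (f f1 : R -> R) (M : R) :
  (forall x : R, is_derive x 1 f (f1 x)) -> (forall x, `|f1 x| <= M) ->
  forall u v, `|f u - f v| <= M * `|u - v|.
Proof.
move=> df f1M.
have main u v : u < v -> `|f v - f u| <= M * `|v - u|.
  move=> uv.
  have cf : {within `[u, v], continuous f}.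
    by apply: derivable_within_continuous => y _; exact: ex_derive.
  have [c _ ->] := MVT uv (fun y _ => df y) cf.
  by rewrite normrM ler_wpM2r.
move=> u v; have [uv|vu|->] := ltgtP u v.
- by rewrite distrC (distrC u); exact: main.
- exact: main.
- by rewrite !subrr normr0 mulr0.
Qed.

Lemma nat_measure_eq (R : realType) (m1 m2 : {measure set nat -> \bar R}) :
  (forall k, m1 [set k] = m2 [set k]) -> forall A, m1 A = m2 A.
Proof.
move=> m12 A; have mA : measurable A by [].
have := integral_indic m1 measurableT mA; have := integral_indic m2 measurableT mA.
rewrite !setIT => <- <-.
rewrite !ge0_integral_nat//.
by apply: eq_eseriesr => k _; congr (_ * _)%E; exact: m12.
Qed.

Lemma mutually_independent_shift (R : realType) d (T : measurableType d)
    (P : probability T R) d' (T' : measurableType d') (X : nat -> T -> T') :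
  mutually_independent P X -> mutually_independent P (fun k => X k.+1).
Proof.
move=> Xi s A us mA.
have := Xi (map succn s) (fun i => A i.-1); rewrite (map_inj_uniq succn_inj) => /(_ us).
rewrite big_map => <-; last by move=> i; exact: mA.
congr (P _); apply/seteqP; split => w h i /=.
  by move=> /mapP[j sj ->]; exact: h.
by move=> si; exact: (h i.+1 (map_f _ si)).
Qed.

(** With q^8 = 1 - rho = h the hypothesis reads n h^2 <= t. Applying ln z <= z - 1 to q^-1 instead
    of its 16th power loses only one of the two factors q. *)
Lemma ln_steps_le (R : realType) (q t : R) (n : nat) : 0 < q -> q <= 1 -> 0 < t ->
  n%:R * q ^+ 16 <= t -> ln n.+1%:R * q ^+ 2 <= q * (t + 16).
Proof.
move=> q0 q1 t0 nt.
have q16 : 0 < q ^+ 16 by rewrite exprn_gt0.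
have l1 : ln n.+1%:R <= ln ((1 + t) * (q^-1) ^+ 16).
  rewrite ler_ln ?posrE//; last by rewrite mulr_gt0 ?exprn_gt0 ?invr_gt0// addr_gt0.
  rewrite exprVn ler_pdivlMr// -natr1 mulrDl mul1r [leRHS]addrC.
  by apply: lerD => //; rewrite exprn_ile1// ltW.
have l2 : ln ((1 + t) * (q^-1) ^+ 16) <= t + 16 * (q^-1 - 1).
  rewrite lnM ?posrE ?exprn_gt0 ?invr_gt0 ?addr_gt0// lnXn ?invr_gt0//.
  apply: lerD; first by apply: le_ln1Dx; rewrite (lt_trans _ t0)// ltrN10.
  rewrite -[ln _ *+ _]mulr_natl ler_pM2l//.
  have := @le_ln1Dx _ (q^-1 - 1); rewrite addrCA subrr addr0; apply.
  by rewrite ltrBrDl subrr invr_gt0.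
have q2 : 0 <= q ^+ 2 by exact: sqr_ge0.
apply: le_trans (ler_wpM2r q2 (le_trans l1 l2)) _.
have -> : (t + 16 * (q^-1 - 1)) * q ^+ 2 = q * (t * q + 16 - 16 * q) by field; rewrite gt_eqF.
rewrite ler_pM2l//; nra.
Qed.

Lemma measurable_queue_length (R : realType) d (T : measurableType d) (q0 : nat)
    (N : nat -> T -> nat) n : (forall k, measurable_fun [set: T] (N k)) ->
  measurable_fun [set: T] (fun w => (queue_length q0 N n w)%:R : R).
Proof.
move=> mN; apply: (@measurableT_comp _ _ _ _ _ _ (fun k : nat => k%:R : R)) => //.
elim: n => [|n ih] //=.
by apply: measurable_fun_addn => //; exact: measurable_fun_subn.
Qed.

(** * Queue and Gaussian walk compared at one load *)

Section comparison.
Context (R : realType) (f f1 f2 f3 : R -> R) (M : R).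
Hypotheses (df : forall x : R, is_derive x 1 f (f1 x))
  (df1 : forall x : R, is_derive x 1 f1 (f2 x))
  (df2 : forall x : R, is_derive x 1 f2 (f3 x)).
Hypotheses (fM : forall x, `|f x| <= M) (f1M : forall x, `|f1 x| <= M)
  (f2M : forall x, `|f2 x| <= M) (f3M : forall x, `|f3 x| <= M).

Context d (T : measurableType d) (P : probability T R) (N : nat -> {RV P >-> nat}).
Hypothesis N_indep : mutually_independent P (fun (n : nat) (w : T) => N n w).
Variable mu : probability nat R.
Hypothesis N_law : forall n A, P (N n @^-1` A) = mu A.

Variables (rho m2 : R) (K : nat) (tau : R).
Hypotheses (rho01 : 0 < rho < 1).
Hypotheses (mean : (\int[mu]_k (k%:R)%:E = rho%:E)%E)
  (square : (\int[mu]_k (k%:R ^+ 2)%:E = (rho ^+ 2 * m2 + rho)%:E)%E)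
  (tail : (\int[mu]_k (k%:R ^+ 2 * (K < k)%N%:R)%:E <= tau%:E)%E).
Hypotheses (tau01 : 0 <= tau <= 1) (m20 : 0 <= m2).

Context dW (TW : measurableType dW) (PW : probability TW R) (W : R -> {RV PW >-> R}).
Hypothesis W_bm : standard_brownian_motion W.

Variables (q t del : R) (q0 : nat).
Hypotheses (qgt0 : 0 < q) (q_le1 : q <= 1) (hq : 1 - rho = q ^+ 8).
Hypotheses (t0 : 0 < t) (del0 : 0 < del).

Let h := 1 - rho.
Let n := Num.truncn (t / h ^+ 2).
Let Z k w := N k.+1 w.
Let y := h * q0%:R.
Let b := (q ^+ 2)^-1.
Let s := Num.sqrt (below_var mu K).
(** A common bound for third moments in units of h^3: (K + 2)^3 for the truncated increments, 4 +
    264 (m2 + 1)^3 for the Gaussian ones, whose scale satisfies s <= m2 + 1. *)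
Let C := (K%:R + 2) ^+ 3 + 4 + 264 * (m2 + 1) ^+ 3.
Let nu : probability (measurableTypeR R) R := normal_prob (0 : R) (Num.sqrt (h ^+ 2)).

Let M0 : 0 <= M. Proof. exact: le_trans (fM 0). Qed.

Let h_gt0 : 0 < h. Proof. by rewrite /h hq exprn_gt0. Qed.

Let h_le1 : h <= 1. Proof. by rewrite /h hq exprn_ile1// ltW. Qed.

Let h2_gt0 : 0 < h ^+ 2. Proof. by rewrite exprn_gt0. Qed.

Let sqrt_h2 : Num.sqrt (h ^+ 2) = h. Proof. by rewrite sqrtr_sqr gtr0_norm. Qed.

Let b_gt0 : 0 < b. Proof. by rewrite invr_gt0 exprn_gt0. Qed.

Let nh2 : n%:R * h ^+ 2 <= t.
Proof.
have th : 0 <= t / h ^+ 2 by rewrite divr_ge0// ltW.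
by have /andP[] := truncn_itv th; rewrite ler_pdivlMr.
Qed.

Let bf : bmf f.
Proof.
split; last by exists M.
apply: continuous_measurable_fun => x.
by apply: differentiable_continuous; apply/derivable1_diffP; exact: ex_derive.
Qed.

Let f_lip := derive_lipschitz df f1M.

Let mZ k : measurable_fun [set: T] (Z k). Proof. by []. Qed.
Let Z_law k A : measurable A -> P (Z k @^-1` A) = mu A.
Proof. by move=> _; exact: N_law. Qed.
Let Z_indep : mutually_independent P Z.
Proof. exact: mutually_independent_shift N_indep. Qed.

Let V := bm_increment W (h ^+ 2).
Let mV k : measurable_fun [set: TW] (V k). Proof. exact: measurable_bm_increment. Qed.
Let V_law k A : measurable A -> PW (V k @^-1` A) = nu A.
Proof. by move=> mA; rewrite (bm_increment_law W_bm). Qed.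
Let V_indep : mutually_independent PW V. Proof. exact: bm_increment_indep. Qed.

Let s0 : 0 <= s. Proof. exact: sqrtr_ge0. Qed.

Let var0 : 0 <= below_var mu K. Proof. exact: (below_var_ge0 K square). Qed.

Let s2 : s ^+ 2 = below_var mu K. Proof. by rewrite sqr_sqrtr. Qed.

Let s_le : s <= m2 + 1.
Proof.
have m1 : 0 <= m2 + 1 by rewrite addr_ge0.
rewrite -(ger0_norm m1) -sqrtr_sqr ler_wsqrtr//.
apply: le_trans (below_var_le K rho01 square m20) _.
by rewrite expr2 ler_peMr// lerDr.
Qed.

Let xi := increment h.
Let xi' := below_increment mu K h.
Let gs := gauss_drift (h ^+ 2) s.
Let gsig := gauss_drift (h ^+ 2) (Num.sqrt m2).

Let mxi : measurable_fun [set: nat] xi. Proof. by []. Qed.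
Let mxi' : measurable_fun [set: nat] xi'. Proof. by []. Qed.

Let step0 : `|\int[P]_w f (h * (queue_length q0 N n w)%:R) -
  \int[P]_w f (chain (reflect_step xi) Z y n w)| <= M * h.
Proof.
apply: Rintegral_dist.
- split; last by exists M.
  apply: measurableT_comp; first by case: bf.
  apply: measurable_funM => //.
  exact: measurable_queue_length.
- by apply: bmf_chain => //; exact: measurable_reflect_step.
- move=> w; apply: le_trans (f_lip _ _) _; rewrite ler_wpM2l//.
  by apply: queue_reflect_dist; exact: ltW.
Qed.

Let step1 : `|\int[P]_w f (chain (reflect_step xi) Z y n w) -
  \int[P]_w f (chain (reflect_step xi') Z y n w)| <= M * (del + t * tau / del).
Proof.
apply: le_trans (reflect_coupling_lipschitz mZ Z_law Z_indep mxi mxi' _ _ _ _ n bf M0 f_lip del0) _.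
- exact: (diff_integrable K mean (erefl h)).
- exact: (diff_integrable_sqr K mean square (erefl h)).
- exact: (diff_mean K mean (erefl h)).
rewrite ler_wpM2l// lerD2l// ler_pM2r ?invr_gt0//.
have t01 : 0 <= tau by case/andP: tau01.
apply: (@le_trans _ _ (n%:R * (h ^+ 2 * tau))).
  by rewrite ler_wpM2l//; exact: (diff_sqr_le mean square tail (erefl h)).
by rewrite mulrA ler_wpM2r.
Qed.

Let log_term : ln n.+1%:R / b <= q * (t + 16).
Proof.
rewrite /b invrK; apply: ln_steps_le => //.
by move: nh2; rewrite /h hq -exprM.
Qed.

Let soft_step_dist dO (O : measurableType dO) (PO : probability O R)
    dU (U : measurableType dU) (Y : nat -> O -> U) (g : U -> R) :
  (forall k, measurable_fun [set: O] (Y k)) -> measurable_fun [set: U] g ->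
  `|\int[PO]_w f (chain (reflect_step g) Y y n w) -
    \int[PO]_w f (chain (soft_step b g) Y y n w)| <= M * (q * (t + 16)).
Proof.
move=> mY mg; apply: Rintegral_dist.
- by apply: bmf_chain => //; exact: measurable_reflect_step.
- by apply: bmf_chain => //; exact: measurable_soft_step.
- move=> w; apply: le_trans (f_lip _ _) _; rewrite ler_wpM2l//.
  by rewrite distrC; apply: le_trans log_term; exact: soft_reflect_dist.
Qed.

Let kappa := h ^+ 3 * C.

Let C_parts : [/\ 0 <= (K%:R + 2 : R) ^+ 3, s ^+ 3 <= (m2 + 1) ^+ 3 & 0 <= C].
Proof.
have a1 : 0 <= (K%:R + 2 : R) ^+ 3 by rewrite exprn_ge0// addr_ge0.
have a2 : 0 <= (m2 + 1) ^+ 3 by rewrite exprn_ge0// addr_ge0.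
split=> //; last by rewrite /C; lra.
by rewrite lerXn2r ?nnegrE// addr_ge0.
Qed.

Let cube_below : (\int[mu]_k (`|xi' k| ^+ 3)%:E <= kappa%:E)%E.
Proof.
apply: le_trans (below_increment_cube K rho01 mean square (erefl h)) _.
have [a1 a2 a3] := C_parts.
rewrite lee_fin exprMn ler_wpM2l ?exprn_ge0 ?ltW// /C.
have : 0 <= (m2 + 1) ^+ 3 by rewrite exprn_ge0// addr_ge0.
lra.
Qed.

Let cube_gauss : (\int[nu]_z (`|gs z| ^+ 3)%:E <= kappa%:E)%E.
Proof.
apply: le_trans (gauss_drift_cube h2_gt0 s0) _.
have [a1 a2 a3] := C_parts; rewrite lee_fin sqrt_h2.
have h3 : 0 <= h ^+ 3 by rewrite exprn_ge0// ltW.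
have h6 : (h ^+ 2) ^+ 3 <= h ^+ 3.
  by rewrite -exprM (exprD h 3 3) ler_piMr// exprn_ile1// ltW.
have : h ^+ 3 * s ^+ 3 <= h ^+ 3 * (m2 + 1) ^+ 3 by rewrite ler_wpM2l.
have : 0 <= h ^+ 3 * (K%:R + 2) ^+ 3 by rewrite mulr_ge0.
by rewrite /kappa /C; nra.
Qed.

Let step3 : `|\int[P]_w f (chain (soft_step b xi') Z y n w) -
  \int[PW]_w f (chain (soft_step b gs) V y n w)| <= M * (q * (10 * t * C)).
Proof.
have i1 := below_increment_integrable K rho01 mean square (erefl h).
have i1s := below_increment_integrable_sqr K rho01 mean square (erefl h).
have i2 := gauss_drift_integrable s h2_gt0.
have i2s := gauss_drift_integrable_sqr s h2_gt0.
have em : \int[mu]_k below_increment mu K h k = \int[nu]_z gauss_drift (h ^+ 2) s z.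
  by rewrite below_increment_mean gauss_drift_mean.
have es : \int[mu]_k below_increment mu K h k ^+ 2 =
    \int[nu]_z gauss_drift (h ^+ 2) s z ^+ 2.
  by rewrite (below_increment_sqr K square h) gauss_drift_sqr// s2.
have := lindeberg_soft_chain (mu2 := nu) b_gt0 df df1 df2 fM f1M f2M f3M mZ Z_law Z_indep
  mV V_law V_indep i1 i1s i2 i2s em es cube_below cube_gauss n y.
move=> /le_trans; apply.
have [_ _ C0] := C_parts.
(* Two of the three factors h in [kappa] are used up by n h^2 <= t; the third pays for the b^2
   caused by the softening. *)
have -> : n%:R * (2 * (M * (1 + 3 * b + b ^+ 2) * kappa)) =
    M * (2 * (n%:R * h ^+ 2) * ((1 + 3 * b + b ^+ 2) * h) * C) by rewrite /kappa; ring.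
rewrite ler_wpM2l//.
have hb : (1 + 3 * b + b ^+ 2) * h <= 5 * q.
  have -> : (1 + 3 * b + b ^+ 2) * h = q * (q ^+ 7 + 3 * q ^+ 5 + q ^+ 3).
    by rewrite /b /h hq; field; rewrite gt_eqF.
  have q1 k : q ^+ k <= 1 by rewrite exprn_ile1// ltW.
  by rewrite [leRHS]mulrC ler_pM2l//; have := q1 7%N; have := q1 5%N; have := q1 3%N; lra.
have hb0 : 0 <= (1 + 3 * b + b ^+ 2) * h.
  by rewrite mulr_ge0 ?(ltW h_gt0)// !addr_ge0 ?sqr_ge0 ?mulr_ge0// ltW.
have -> : q * (10 * t * C) = 2 * t * (5 * q) * C by ring.
rewrite ler_wpM2r//; apply: ler_pM => //.
  by apply: mulr_ge0 => //; apply: mulr_ge0 => //; exact: sqr_ge0.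
by rewrite ler_pM2l.
Qed.

(** The arrivals were exchanged for a Gaussian walk with their truncated variance. Both walks here
    use the same Brownian increments, so only the distance of the two standard deviations enters. *)
Let step5 : `|\int[PW]_w f (chain (reflect_step gs) V y n w) -
  \int[PW]_w f (chain (reflect_step gsig) V y n w)| <=
  M * (del + t * (q * (2 * m2 + 1) + 3 * tau) / del).
Proof.
have sh : 0 < Num.sqrt (h ^+ 2) by rewrite sqrt_h2.
have etaE : (fun z => gs z - gsig z) = (fun z => (s - Num.sqrt m2) * z).
  by apply/funext => z; rewrite /gs /gsig /gauss_drift; ring.
have i1 : nu.-integrable [set: R] (EFin \o (fun z => gs z - gsig z)).
  rewrite etaE; have := integrableZl measurableT (s - Num.sqrt m2) (normal_integrable_id sh).
  exact: eq_integrable.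
have i2 : nu.-integrable [set: R] (EFin \o (fun z => (gs z - gsig z) ^+ 2)).
  have := integrableZl measurableT ((s - Num.sqrt m2) ^+ 2) (normal_integrable_sqr sh).
  apply: eq_integrable => // z _ /=.
  by rewrite (_ : gs z - gsig z = (s - Num.sqrt m2) * z) ?exprMn// /gs /gsig /gauss_drift; ring.
have eta0 : \int[nu]_z (gs z - gsig z) = 0.
  rewrite etaE RintegralZl//; last exact: normal_integrable_id.
  by rewrite normal_mean// mulr0.
have eta2 : \int[nu]_z (gs z - gsig z) ^+ 2 = (s - Num.sqrt m2) ^+ 2 * h ^+ 2.
  under eq_Rintegral => z _.
    rewrite (_ : gs z - gsig z = (s - Num.sqrt m2) * z); last first.
      by rewrite /gs /gsig /gauss_drift; ring.
    rewrite exprMn; over.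
  rewrite RintegralZl//; last exact: normal_integrable_sqr.
  by rewrite normal_second_moment// sqrt_h2.
have mg u : measurable_fun [set: R] (gauss_drift (h ^+ 2) u) by exact: measurable_gauss_drift.
have := reflect_coupling_lipschitz (mu := nu) mV V_law V_indep (mg s) (mg (Num.sqrt m2)) i1 i2 eta0
  y n bf M0 f_lip del0.
move=> /le_trans; apply.
rewrite eta2 ler_wpM2l// lerD2l// ler_pM2r ?invr_gt0//.
have m2s : Num.sqrt m2 ^+ 2 = m2 by rewrite sqr_sqrtr.
have sm : 0 <= Num.sqrt m2 by exact: sqrtr_ge0.
(* For nonnegative s and r, (s - r)^2 <= |s^2 - r^2|, so that variances are compared instead of
   their roots. *)
have dist : (s - Num.sqrt m2) ^+ 2 <= q * (2 * m2 + 1) + 3 * tau.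
  apply: (@le_trans _ _ `|below_var mu K - m2|).
    rewrite -s2 -[in leRHS]m2s subr_sqr normrM (ger0_norm (addr_ge0 s0 sm)).
    rewrite -real_normK ?num_real// expr2 ler_wpM2l//.
    rewrite ler_norml opprD lerD2r lerD2l; apply/andP; split.
      by rewrite (le_trans _ s0)// oppr_le0.
    by rewrite (le_trans _ sm)// oppr_le0.
  apply: le_trans (below_var_dist rho01 mean square tail tau01 m20) _.
  rewrite lerD2r ler_wpM2r ?addr_ge0 ?mulr_ge0// hq exprS ler_piMr ?exprn_ile1// ltW//.
rewrite mulrCA mulrC; apply: ler_pM => //; first by rewrite mulr_ge0 ?sqr_ge0.
exact: sqr_ge0.
Qed.

(* In the section, h = q^8 is 1 - rho and the smoothing parameter is b = q^-2: the
   softening costs ln n / b and the exchange n h^3 b^2, both of order q. *)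
Definition comparison_const : R :=
  1 + t * (2 * m2 + 1) / del + 2 * (t + 16) +
  10 * t * ((K%:R + 2) ^+ 3 + 4 + 264 * (m2 + 1) ^+ 3).

Lemma queue_gauss_comparison :
  `|\int[P]_w f (h * (queue_length q0 N n w)%:R) -
    \int[PW]_w f (chain (reflect_step gsig) V y n w)| <=
  M * (2 * del + 4 * t * tau / del + q * comparison_const).
Proof.
have s2' := soft_step_dist P mZ mxi'.
have s4 := soft_step_dist PW mV (measurable_gauss_drift (h ^+ 2) s).
have a0 := step0; have a1 := step1; have a3 := step3; have a5 := step5.
have hq1 : h <= q by rewrite /h hq exprS ler_piMr ?exprn_ile1// ltW.
have a0' := le_trans a0 (ler_wpM2l M0 hq1).
set E0 := \int[P]_w f (h * _) in a0' *.
set E1 := \int[P]_w f (chain (reflect_step xi) Z y n w) in a0' a1 *.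
set E2 := \int[P]_w f (chain (reflect_step xi') Z y n w) in a1 s2' *.
set E3 := \int[P]_w f (chain (soft_step b xi') Z y n w) in s2' a3 *.
set E4 := \int[PW]_w f (chain (soft_step b gs) V y n w) in a3 s4 *.
set E5 := \int[PW]_w f (chain (reflect_step gs) V y n w) in s4 a5 *.
set E6 := \int[PW]_w f (chain (reflect_step gsig) V y n w) in a5 *.
have -> : M * (2 * del + 4 * t * tau / del + q * comparison_const) =
  M * q + M * (del + t * tau / del) + M * (q * (t + 16)) + M * (q * (10 * t * C)) +
  M * (q * (t + 16)) + M * (del + t * (q * (2 * m2 + 1) + 3 * tau) / del).
  by rewrite /comparison_const /C; field; rewrite gt_eqF.
rewrite distrC in s4.
have -> : E0 - E6 = (E0 - E1) + (E1 - E2) + (E2 - E3) + (E3 - E4) + (E4 - E5) + (E5 - E6) by ring.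
do 5 (apply: le_trans (ler_normD _ _) _; apply: lerD => //).
Qed.

End comparison.

(** * Passage to heavy traffic *)

Section heavy_traffic.
Context (R : realType) d0 (T0 : measurableType d0) (P0 : probability T0 R).
Context (Lam1 S : {RV P0 >-> R}).
Hypotheses (Lam1_ge0 : forall w, 0 <= Lam1 w) (S_ge0 : forall w, 0 <= S w).
Hypotheses (Lam1_sqr : ('E_P0[fun w => (Lam1 w ^+ 2)%R] < +oo)%E)
  (S_sqr : ('E_P0[fun w => (S w ^+ 2)%R] < +oo)%E)
  (load1 : ('E_P0[Lam1] * 'E_P0[S] = 1)%E).

(** The conditional mean of an arrival count at load 1, on a space where rate and service are
    independent. *)
Definition mean_arrivals (p : T0 * T0) : R := Lam1 p.1 * S p.2.

Let PP := (P0 \x P0)%E.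
Local Notation c := mean_arrivals.

Definition second_factorial : R :=
  fine ('E_P0[fun w => (Lam1 w ^+ 2)%R])%E * fine ('E_P0[fun w => (S w ^+ 2)%R])%E.
Local Notation m2 := second_factorial.

Let mL : measurable_fun [set: T0] Lam1. Proof. exact: measurable_funP. Qed.
Let mS : measurable_fun [set: T0] S. Proof. exact: measurable_funP. Qed.

Let mc : measurable_fun [set: T0 * T0] c.
Proof. by apply: measurable_funM; exact: measurableT_comp. Qed.

Let c0 p : 0 <= c p. Proof. by rewrite mulr_ge0. Qed.

Let sqr_fin (X : {RV P0 >-> R}) : ('E_P0[fun w => (X w ^+ 2)%R] < +oo)%E ->
  (\int[P0]_w (X w ^+ 2)%:E = (fine ('E_P0[fun w => (X w ^+ 2)%R]))%:E)%E.
Proof.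
rewrite unlock => fin; rewrite fineK// ge0_fin_numE//.
by apply: integral_ge0 => w _; rewrite lee_fin sqr_ge0.
Qed.

Lemma mean_arrivals_mean : (\int[PP]_p (c p)%:E = 1)%E.
Proof.
rewrite (integral_product_factor P0 P0 mL mS Lam1_ge0 S_ge0).
by rewrite -load1 unlock.
Qed.

Lemma mean_arrivals_sqr : (\int[PP]_p (c p ^+ 2)%:E = m2%:E)%E.
Proof.
under eq_integral do rewrite exprMn.
rewrite (integral_product_factor P0 P0 (f := fun w => Lam1 w ^+ 2) (g := fun w => S w ^+ 2)).
- by rewrite !sqr_fin.
- exact: measurable_funX.
- exact: measurable_funX.
- by move=> w; exact: sqr_ge0.
- by move=> w; exact: sqr_ge0.
Qed.

Lemma second_factorial_ge0 : 0 <= m2.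
Proof.
rewrite mulr_ge0// fine_ge0// unlock.
all: by apply: integral_ge0 => w _; rewrite lee_fin sqr_ge0.
Qed.

Lemma pgf_derive2_cvg rho : 0 < rho ->
  ((arrivals_pgf P0 (fun w => rho * Lam1 w) S)^`(2))%classic z @[z --> 1^'-] -->
  rho ^+ 2 * m2.
Proof.
move=> r0; pose X p := rho * c p.
have mX : measurable_fun [set: T0 * T0] X by exact: measurable_funM.
have X0 p : 0 <= X p by rewrite mulr_ge0// ltW.
have ic2 : PP.-integrable [set: T0 * T0] (EFin \o (fun p => c p ^+ 2)).
  apply/integrableP; split; first by apply/measurable_EFinP; exact: measurable_funX.
  under eq_integral do rewrite gee0_abs ?lee_fin ?sqr_ge0//.
  by rewrite mean_arrivals_sqr ltry.
have iX2 : PP.-integrable [set: T0 * T0] (EFin \o (fun p => X p ^+ 2)).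
  have := integrableZl measurableT (rho ^+ 2) ic2.
  by apply: eq_integrable => // p _; rewrite /= /X [in RHS]exprMn.
have -> : rho ^+ 2 * m2 = \int[PP]_p X p ^+ 2.
  have XE p : X p ^+ 2 = rho ^+ 2 * c p ^+ 2 by rewrite -exprMn.
  under eq_Rintegral do rewrite XE.
  by rewrite RintegralZl// /Rintegral mean_arrivals_sqr.
apply: (exponential_transform_derive2 mX X0 iX2) => z z1.
have mrL : measurable_fun [set: T0] (fun w => rho * Lam1 w) by exact: measurable_funM.
have rL0 w : 0 <= rho * Lam1 w by rewrite mulr_ge0// ltW.
rewrite (arrivals_pgfE P0 mrL mS rL0 S_ge0 (ltW z1)).
by apply: eq_Rintegral => p _; rewrite /X /c mulrA.
Qed.

Context (d : R -> measure_display) (T : forall rho : R, measurableType (d rho)).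
Context (P : forall rho : R, probability (T rho) R).
Context (L V : forall rho : R, nat -> {RV (P rho) >-> R}).
Context (N : forall rho : R, nat -> {RV (P rho) >-> nat}).
Hypothesis queue : forall rho : R, 0 < rho < 1 ->
  resampled_MG1 P0 (fun w => rho * Lam1 w) S (L rho) (V rho) (N rho).

(** For 0 < rho < 1 the counts are identically distributed, so the law of [N rho 0] stands for all
    of them. *)
Let mu (rho : R) : probability nat R := distribution (P rho) (N rho 0).

Let N_weight rho n k : 0 < rho < 1 ->
  P rho (N rho n @^-1` [set k]) = (\int[PP]_p (poisson_weight (rho * c p) k)%:E)%E.
Proof.
move=> rho01; have /andP[r0 _] := rho01.
rewrite (arrivals_law _ mS _ S_ge0 (queue rho01)).
- by apply: eq_integral => p _; rewrite /c mulrA.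
- exact: measurable_funM.
- by move=> w; rewrite mulr_ge0// ltW.
Qed.

Let N_law rho n A : 0 < rho < 1 -> P rho (N rho n @^-1` A) = mu rho A.
Proof.
move=> rho01; have := @nat_measure_eq R (distribution (P rho) (N rho n)) (mu rho).
move=> /(_ _ A); apply => k.
exact: etrans (N_weight n k rho01) (esym (N_weight 0 k rho01)).
Qed.

Let mu_weight rho : 0 < rho < 1 -> forall k,
  mu rho [set k] = (\int[PP]_p (poisson_weight (rho * c p) k)%:E)%E.
Proof. by move=> rho01 k; rewrite -(N_law 0 _ rho01) N_weight. Qed.

Context (dW : measure_display) (TW : measurableType dW) (PW : probability TW R).
Context (W : R -> {RV PW >-> R}) (W_bm : standard_brownian_motion W).
Variables (x t : R).
Hypotheses (x0 : 0 <= x) (t0 : 0 < t).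

Let Q rho := queue_length (Num.truncn (x / (1 - rho))) (N rho).

Definition scaled_queue (rho : R) (w : T rho) : R :=
  (1 - rho) * (@Q rho (Num.truncn (t / (1 - rho) ^+ 2)) w)%:R.

Let B (w : TW) (s : R) := - s + Num.sqrt m2 * W s w.

Lemma measurable_scaled_queue rho : measurable_fun [set: T rho] (@scaled_queue rho).
Proof. by apply: measurable_funM => //; exact: measurable_queue_length. Qed.

Let cvg_start (u : nat -> R) : (forall n, 0 < u n < 1) -> u @ \oo --> (1 : R) ->
  (1 - u n) * (Num.truncn (x / (1 - u n)))%:R @[n --> \oo] --> x.
Proof.
move=> u01 u1; have ch : (fun n => x - (1 - u n)) @ \oo --> x.
  rewrite -[X in _ --> X]subr0 -(subrr 1); apply: cvgB; first exact: cvg_cst.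
  by apply: cvgB => //; exact: cvg_cst.
apply: (squeeze_cvgr _ ch (@cvg_cst _ x _ _ _)).
apply: nearW => n; have /andP[_ un1] := u01 n; have h0 : 0 < 1 - u n by rewrite subr_gt0.
have xh : 0 <= x / (1 - u n) by rewrite divr_ge0// ltW.
have /andP[lo hi] := truncn_itv xh.
rewrite ler_pdivlMr// mulrC in lo; rewrite ltr_pdivrMr// -natr1 mulrDl mul1r mulrC in hi.
by rewrite lo andbT lerBlDr ltW.
Qed.

Lemma scaled_queue_smooth_cvg (f : R -> R) (u : nat -> R) : smooth_test f ->
  (forall n, 0 < u n < 1) -> u @ \oo --> (1 : R) ->
  \int[P (u n)]_w f (scaled_queue w) @[n --> \oo] -->
  \int[PW]_w f (reflection x (B w) t).
Proof.
move=> [f1 [f2 [f3 [M [df df1 df2 fbound]]]]] u01 u1.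
have fM y : `|f y| <= M by case: (fbound y).
have f1M y : `|f1 y| <= M by case: (fbound y).
have f2M y : `|f2 y| <= M by case: (fbound y).
have f3M y : `|f3 y| <= M by case: (fbound y).
have M0 : 0 <= M by exact: le_trans (fM 0).
have cf : continuous f.
  by move=> y; apply: differentiable_continuous; apply/derivable1_diffP; exact: ex_derive.
have bf : bmf f by split; [exact: continuous_measurable_fun|exists M].
have h0 n : 0 < 1 - u n by have /andP[_ ?] := u01 n; rewrite subr_gt0.
have ch : (fun n => 1 - u n) @ \oo --> (0 : R).
  by rewrite -(subrr 1); apply: cvgB => //; exact: cvg_cst.
pose y n := (1 - u n) * (Num.truncn (x / (1 - u n)))%:R.
have gauss : \int[PW]_w f (chain (reflect_step (gauss_drift ((1 - u n) ^+ 2) (Num.sqrt m2)))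
    (bm_increment W ((1 - u n) ^+ 2)) (y n) (Num.truncn (t / (1 - u n) ^+ 2)) w)
    @[n --> \oo] --> \int[PW]_w f (reflection x (B w) t).
  apply: (@cvg_Rintegral_gauss_chain R dW TW PW W W_bm (Num.sqrt m2) x t t0 f
    (fun n => (1 - u n) ^+ 2) y cf bf).
  - by move=> n; rewrite exprn_gt0.
  - by have := @cvg_pow _ _ _ 2 ch; rewrite expr0n.
  - by move=> n; rewrite mulr_ge0// ltW.
  - exact: cvg_start.
set G := (fun n => _) in gauss.
apply/cvgrPdist_le => e e0.
have e4 : 0 < e / 4 by rewrite divr_gt0.
have M1 : 0 < M + 1 by rewrite ltr_wpDl.
(* The error is split into e / 4 each for [del], for [tau], for [q n] and for the convergence of the
   Gaussian walk; [M + 1] is the divisor because [M] may be 0. *)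
pose del := e / 4 / (2 * (M + 1)).
have del0 : 0 < del by rewrite divr_gt0// mulr_gt0.
pose tau := Num.min 1 (e / 4 * del / (4 * t * (M + 1))).
have tau0 : 0 < tau.
  by rewrite lt_min ltr01/=; apply: divr_gt0; apply: mulr_gt0 => //; exact: mulr_gt0.
have tau1 : tau <= 1 by rewrite ge_min lexx.
have tau2 : tau <= e / 4 * del / (4 * t * (M + 1)) by rewrite ge_min lexx orbT.
have tau01 : 0 <= tau <= 1 by rewrite tau1 ltW.
have [K hK] := mixed_poisson_tail mc c0 mu_weight mean_arrivals_mean mean_arrivals_sqr u01 u1 tau0.
pose D := comparison_const m2 K t del.
(* An eighth root of [1 - u n]: it makes both h and the smoothing parameter integer powers of one
   quantity. *)
pose q n := Num.sqrt (Num.sqrt (Num.sqrt (1 - u n))).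
have q0 n : 0 < q n by rewrite !sqrtr_gt0.
have q8 n : 1 - u n = q n ^+ 8.
  rewrite (exprM _ 4 2) (exprM _ 2 2) sqr_sqrtr ?sqrtr_ge0// sqr_sqrtr ?sqrtr_ge0//.
  by rewrite sqr_sqrtr// ltW.
have q1 n : q n <= 1.
  have s1 (z : R) : z <= 1 -> Num.sqrt z <= 1 by move=> z1; rewrite -sqrtr1 ler_wsqrtr.
  apply: (s1); apply: (s1); apply: (s1); have /andP[un0 _] := u01 n; by rewrite gerBl ltW.
have cq : q @ \oo --> (0 : R).
  have cs (v : nat -> R) : v @ \oo --> (0 : R) -> (fun n => Num.sqrt (v n)) @ \oo --> (0 : R).
    by move=> v0; rewrite -(sqrtr0 R); apply: continuous_cvg => //; exact: sqrt_continuous.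
  by apply: (cs); apply: (cs); apply: (cs).
have D1 : 0 < (M + 1) * (`|D| + 1) by rewrite mulr_gt0// ltr_wpDl.
near=> n.
have un01 := u01 n.
have tailn : (\int[mu (u n)]_k (k%:R ^+ 2 * (K < k)%N%:R)%:E <= tau%:E)%E.
  by near: n; exact: hK.
have qn : q n <= e / 4 / ((M + 1) * (`|D| + 1)).
  by near: n; apply: (cvgr_le _ cq); rewrite divr_gt0.
have gn : `|\int[PW]_w f (reflection x (B w) t) - G n| <= e / 4.
  by near: n; move/cvgrPdist_le : gauss; exact.
have meann := mixed_poisson_mean mc c0 mu_weight mean_arrivals_mean un01.
have sqrn := mixed_poisson_sqr mc c0 mu_weight mean_arrivals_mean mean_arrivals_sqr un01.
have comp := @queue_gauss_comparison R f f1 f2 f3 M df df1 df2 fM f1M f2M f3M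
  _ (T (u n)) (P (u n)) (N (u n)) (mg1_arrivals_indep (queue un01)) (mu (u n))
  (fun k A => N_law k A un01) (u n) m2 K tau un01 meann sqrn tailn tau01
  second_factorial_ge0 dW TW PW W W_bm (q n) t del (Num.truncn (x / (1 - u n)))
  (q0 n) (q1 n) (q8 n) t0 del0.
rewrite -/(G n) in comp.
have b1 : M * (2 * del) <= e / 4.
  rewrite (_ : e / 4 = (M + 1) * (2 * del)); last by rewrite /del; field; rewrite gt_eqF.
  have : 0 < 2 * del by rewrite mulr_gt0.
  by rewrite (mulrDl M 1) mul1r lerDl => /ltW.
have b2 : M * (4 * t * tau / del) <= e / 4.
  apply: (@le_trans _ _ ((M + 1) * (4 * t * (e / 4 * del / (4 * t * (M + 1))) / del))).
    have p0 : 0 <= 4 * t * tau / del.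
      by apply: divr_ge0; [apply: mulr_ge0; [apply: mulr_ge0|]|] => //; exact: ltW.
    apply: ler_pM => //; first by rewrite lerDl.
    by rewrite ler_pM2r ?invr_gt0// ler_pM2l// mulr_gt0.
  by rewrite le_eqVlt; apply/orP; left; apply/eqP; field; rewrite !gt_eqF.
have b3 : M * (q n * D) <= e / 4.
  apply: (@le_trans _ _ ((M + 1) * (q n * (`|D| + 1)))).
    apply: (@le_trans _ _ (M * (q n * (`|D| + 1)))).
      rewrite ler_wpM2l// ler_pM2l// (le_trans (ler_norm D))// lerDl//.
    by rewrite ler_wpM2r ?lerDl// mulr_ge0 ?addr_ge0// ltW.
  by rewrite mulrCA; move: qn; rewrite ler_pdivlMr.
have -> : \int[PW]_w f (reflection x (B w) t) - \int[P (u n)]_w f (scaled_queue w) =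
  (\int[PW]_w f (reflection x (B w) t) - G n) -
  (\int[P (u n)]_w f (scaled_queue w) - G n) by ring.
apply: le_trans (ler_normB _ _) _.
apply: le_trans (lerD gn comp) _.
rewrite (mulrDr M (2 * del + _)) (mulrDr M (2 * del)).
apply: le_trans (lerD (lexx (e / 4)) (lerD (lerD b1 b2) b3)) _; lra.
Unshelve. all: by end_near. Qed.

End heavy_traffic.

Theorem theorem5p3 (R : realType)
  (* the laws of S and Lambda_1 *)
  (d0 : measure_display) (T0 : measurableType d0) (P0 : probability T0 R)
  (Lam1 S : {RV P0 >-> R})
  (Lam1_ge0 : forall w, 0 <= Lam1 w) (S_ge0 : forall w, 0 <= S w)
  (Lam1_sqr : ('E_P0[fun w => (Lam1 w ^+ 2)%R] < +oo)%E)
  (S_sqr : ('E_P0[fun w => (S w ^+ 2)%R] < +oo)%E)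
  (load1 : ('E_P0[Lam1] * 'E_P0[S] = 1)%E)
  (* for each load rho in ]0, 1[, a queue with Lambda = rho * Lambda_1 *)
  (d : R -> measure_display) (T : forall rho : R, measurableType (d rho))
  (P : forall rho : R, probability (T rho) R)
  (L V : forall rho : R, nat -> {RV (P rho) >-> R})
  (N : forall rho : R, nat -> {RV (P rho) >-> nat})
  (queue : forall rho : R, 0 < rho < 1 ->
    resampled_MG1 P0 (fun w => rho * Lam1 w) S (L rho) (V rho) (N rho))
  (dW : measure_display) (TW : measurableType dW) (PW : probability TW R)
  (W : R -> {RV PW >-> R}) (W_bm : standard_brownian_motion W)
  (x t : R) (x_ge0 : 0 <= x) (t_gt0 : 0 < t) :
  let nu (rho : R) := arrivals_pgf P0 (fun w => rho * Lam1 w) S in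
  let nu2 (rho : R) := fine ('E_P0[fun w => ((rho * Lam1 w) ^+ 2)%R])%E *
                       fine ('E_P0[fun w => (S w ^+ 2)%R])%E in
  let Q (rho : R) :=
    queue_length (Num.truncn (x / (1 - rho))) (N rho) in
  let B (w : TW) (s : R) := - s + Num.sqrt (nu2 1) * W s w in
  (* nu''(1) = E[Lambda^2] E[S^2], as a left limit since nu may be infinite
     beyond 1; rho = 1 is the heavy-traffic limit *)
  (forall rho : R, 0 < rho <= 1 ->
    ((nu rho)^`(2))%classic z @[z --> 1^'-] --> nu2 rho) /\
  cvg_in_distribution (1 : R)^'- P
    (fun (rho : R) (w : T rho) =>
      (1 - rho) * (@Q rho (Num.truncn (t / (1 - rho) ^+ 2)) w)%:R)
    PW (fun w : TW => reflection x (B w) t).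
Proof.
move=> nu nu2 Q B.
have nu2E rho : nu2 rho = rho ^+ 2 * second_factorial Lam1 S.
  rewrite /nu2 /second_factorial mulrA; congr (_ * _); rewrite unlock.
  have mL : measurable_fun [set: T0] Lam1 by exact: measurable_funP.
  have XE w : ((rho * Lam1 w) ^+ 2)%:E = ((rho ^+ 2)%:E * (Lam1 w ^+ 2)%:E)%E.
    by rewrite -EFinM exprMn.
  under eq_integral do rewrite XE.
  rewrite ge0_integralZl//.
  - rewrite fineM// ge0_fin_numE; first by move: Lam1_sqr; rewrite unlock.
    by apply: integral_ge0 => w _; rewrite lee_fin sqr_ge0.
  - by apply/measurable_EFinP; exact: measurable_funX.
  - by move=> w _; rewrite lee_fin sqr_ge0.
  - by rewrite lee_fin sqr_ge0.
have nu21 : nu2 1 = second_factorial Lam1 S by rewrite nu2E expr1n mul1r.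
split.
  move=> rho /andP[rho0 _]; rewrite nu2E.
  exact: (pgf_derive2_cvg Lam1_ge0 S_ge0 Lam1_sqr S_sqr).
rewrite /B nu21; split.
- by move=> rho; exact: (measurable_scaled_queue N x t).
- exact: measurable_reflection.
move=> f cf bff.
have [C fC] : exists C, forall y, `|f y| <= C.
  by case: bff => C0 [_ hC]; exists (`|C0| + 1) => y; apply: hC => //; rewrite ltr_pwDr// ler_norm.
have bf : bmf f by split; [exact: continuous_measurable_fun|exists C].
have bmfc d' (T' : measurableType d') (X : T' -> R) :
    measurable_fun [set: T'] X -> bmf (fun w => f (X w)).
  by move=> mX; split; [apply: measurableT_comp => //; case: bf|exists C => w].
have EE d' (T' : measurableType d') (P' : probability T' R) (X : T' -> R) :
    measurable_fun [set: T'] X -> ('E_P'[f \o X] = (\int[P']_w f (X w))%:E)%E.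
  by move=> mX; rewrite unlock (EFin_Rintegral P' (bmfc _ _ _ mX)).
rewrite EE; last exact: measurable_reflection.
rewrite (_ : (fun rho => _) =
    (fun rho => (\int[P rho]_w f (scaled_queue N x t w))%:E)); last first.
  by apply/funext => rho; rewrite EE//; exact: (measurable_scaled_queue N x t).
apply: cvg_EFin; first exact: nearW.
apply/cvg_at_leftP => u [u_lt1 cu].
(* A sequence tending to 1 from the left may start with nonpositive terms, where no queue is given;
   these finitely many terms are replaced by 1 / 2. *)
pose v n := if 0 < u n then u n else 2^-1.
have v01 n : 0 < v n < 1.
  by rewrite /v; case: ifP => [->|_]; [rewrite u_lt1|apply/andP; split; lra].
have uv : \forall n \near \oo, v n = u n.
  by near=> n; rewrite /v ifT//; near: n; apply: (cvgr_gt _ cu).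
have cv : v @ \oo --> (1 : R).
  by apply: cvg_trans cu; apply: near_eq_cvg; apply: filterS uv => n ->.
have smooth (g : R -> R) : smooth_test g ->
    \int[P (v n)]_w g (scaled_queue N x t w) @[n --> \oo] -->
    \int[PW]_w g (reflection x (fun s => - s + Num.sqrt (second_factorial Lam1 S) * W s w) t).
  by move=> sg; exact: (scaled_queue_smooth_cvg Lam1_ge0 S_ge0 Lam1_sqr S_sqr load1 queue W_bm).
have := weak_cvg_of_smooth (fun n => @measurable_scaled_queue _ _ _ _ N x t (v n))
  (measurable_reflection W_bm _ x_ge0 t_gt0) smooth cf bff.
apply: cvg_trans; apply: near_eq_cvg; apply: filterS uv => n -> //.
Unshelve. all: by end_near. Qed.
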